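(* Fix $0<s<\sqrt{2}-1$ with $s \neq \frac{1}{5}$, and let $d=\frac{3}{2} + \frac{1}{2}\frac{\log 5}{\log s}$. Let $D_s\subset\mathbb{R}^3$ be the fractal polyhedron defined in the context. There exists a periodic, continuous function $p_{s}: \mathbb{R} \rightarrow \mathbb{R}$ with period $\log (s^{-2})$ such that, as $t\downarrow 0$, \begin{align*} H_{D_{s}}(t) &= \frac{1+s^{3}}{1-5s^{3}} - 6\left(\frac{1-s^{2}}{1-5s^{2}}\right)\frac{t^{1/2}}{\sqrt{\pi}} +\frac{12}{\pi}\left(\frac{1+s}{1-5s}\right)t + 6p_{s}(\log t)\,t^{d} + O\left(t^{3/2}\left(\log(t^{-1})\right)^{3/2}\right). \end{align*}
   Context: The heat content of an open set $D\subset\mathbb{R}^3$ is $H_D(t)=\int_{D} dx \int_{D} dy\, p(x,y;t)$, where $p(x,y;t)=(4\pi t)^{-3/2}e^{-|x-y|^{2}/(4t)}$. Construction of $D_s$: Let $Q_0\subset\mathbb{R}^3$ be an open cube of side-length $1$. Attach a regular open cube $Q_{1,i}$ of side-length $s$ to the centre $c_{1,i}$, $i=1,\dots,6$, of each face of $\partial Q_0$ (outside $Q_0$, with a face of $Q_{1,i}$ lying in that face of $\partial Q_0$ and centred at $c_{1,i}$), such that all the faces are pairwise-parallel. Inductively, for $j=2,3,\dots$, attach $N(j)=6\cdot 5^{j-1}$ open cubes $Q_{j,1},\dots,Q_{j,N(j)}$ of side-length $s^j$ to the centres of the boundary faces of the cubes $Q_{j-1,1},\dots,Q_{j-1,N(j-1)}$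 (the five faces of each that are not attached to a cube of the previous generation), again with pairwise-parallel faces. With $N(1)=6$, define $$D_s=\text{interior}\left\{\overline{Q_0\cup\Big[\bigcup_{j\ge1}\bigcup_{1\le i\le N(j)}Q_{j,i}\Big]}\right\}.$$ For $0<s<\sqrt2-1$ no cubes in the construction overlap. *)

(* Defs.v *)
From HB Require Import structures.
From mathcomp Require Import all_boot all_order all_algebra.
From mathcomp Require Import all_classical all_reals all_analysis.
Import Order.TTheory GRing.Theory Num.Theory.
Import numFieldNormedType.Exports.

Set Implicit Arguments.
Unset Strict Implicit.
Unset Printing Implicit Defensive.

Local Open Scope classical_set_scope.
Local Open Scope ring_scope.

(* On triples, the product topology is the Euclidean topology of R^3. *)
Notation space3 R := (R * R * R)%type.

Section HeatContent.
Context {R : realType}.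

Definition dot (x y : space3 R) : R :=
  x.1.1 * y.1.1 + x.1.2 * y.1.2 + x.2 * y.2.

Definition lebesgue3 : {measure set
    (measurableTypeR R * measurableTypeR R * measurableTypeR R)%type -> \bar R} :=
  ((@lebesgue_measure R \x @lebesgue_measure R) \x @lebesgue_measure R)%E.

Definition heat_kernel (x y : space3 R) (t : R) : R :=
  (4 * pi * t) `^ (- (3 / 2)) * expR (- (dot (x - y) (x - y) / (4 * t))).

Definition heat_content (D : set (space3 R)) (t : R) : \bar R :=
  (\int[lebesgue3]_(x in D) \int[lebesgue3]_(y in D) (heat_kernel x y t)%:E)%E.

End HeatContent.

Section Construction.
Context {R : realType}.
(* [e] gives the common edge directions of all the cubes. *)
Variable e : 'I_3 -> space3 R.

Definition orthonormal_frame : Prop :=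
  forall i j, dot (e i) (e j) = (i == j)%:R.

Definition open_cube (c : space3 R) (a : R) : set (space3 R) :=
  [set x | forall k, `|dot (x - c) (e k)| < a / 2].

(* A face of a cube is named by its outward unit normal: (k, false) stands for
   + e k and (k, true) for - e k. *)
Definition face : Type := 'I_3 * bool.

Definition opposite (u : face) : face := (u.1, ~~ u.2).

Definition outer_normal (u : face) : space3 R := (-1) ^+ u.2 *: e u.1.

Definition face_centre (c : space3 R) (a : R) (u : face) : space3 R :=
  c + (a / 2) *: outer_normal u.

(* A cube of the construction is recorded by its centre together with the face
   of its parent to which it is attached ([None] for the initial cube). If that face is [u],
   the cube touches its parent along its own face [opposite u], which leaves the
   five other faces free. *)
Definition free_faces (o : option face) : seq face :=
  if o is Some u then [seq v <- enum {: face} | v != opposite u]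
  else enum {: face}.

(* The cube of side [b] attached to the centre of the face [u] of the cube of
   centre [c] and side [a]. *)
Definition attach (c : space3 R) (a b : R) (u : face) :
    space3 R * option face :=
  (face_centre c a u + (b / 2) *: outer_normal u, Some u).

Variables (x0 : space3 R) (s : R).

(* The cubes added at the j-th step, all of side s ^+ j; generation 0 is the
   initial unit cube, centred at [x0]. *)
Fixpoint generation (j : nat) : seq (space3 R * option face) :=
  if j is i.+1 then
    [seq attach q.1 (s ^+ i) (s ^+ i.+1) u
      | q <- generation i, u <- free_faces q.2]
  else [:: (x0, None)].

Lemma size_generation j : size (generation j.+1) = (6 * 5 ^ j)%N.
Proof.
have face6 : size (enum {: face}) = 6%N.
  by rewrite -cardE card_prod card_ord card_bool.
have free5 u : size (free_faces (Some u)) = 5%N.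
  rewrite /= -(count_predC (pred1 (opposite u))) in face6.
  rewrite size_filter; move: face6.
  by rewrite count_uniq_mem ?enum_uniq// mem_enum inE add1n => -[].
elim: j => [|j IH]; first by rewrite /= cats0 size_map face6.
have attached q : q \in generation j.+1 -> exists u, q.2 = Some u.
  by move=> /allpairsPdep[p [u [_ _ ->]]]; exists u.
rewrite expnSr mulnA -{}IH {1}/generation -/generation -/(generation j.+1).
rewrite size_allpairs_dep.
suff : all (fun q => size (free_faces q.2) == 5%N) (generation j.+1).
  elim: (generation j.+1) => //= q r IHr /andP[/eqP -> /IHr ->].
  by rewrite mulSn.
by apply/allP => q /attached[u ->]; rewrite free5.
Qed.

Definition fractal_polyhedron : set (space3 R) :=
  interior (closure (\bigcup_j \bigcup_(q in [set` generation j])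
                       open_cube q.1 (s ^+ j))).

End Construction.

(* Main.v *)
Require Import Defs.
From HB Require Import structures.
From mathcomp Require Import all_boot all_order all_algebra.
From mathcomp Require Import all_classical all_reals all_analysis.
From mathcomp Require Import measurable_realfun ring lra.
Import Order.TTheory GRing.Theory Num.Theory.
Import numFieldNormedType.Exports.
Set Implicit Arguments.
Unset Strict Implicit.
Unset Printing Implicit Defensive.
Local Open Scope classical_set_scope.
Local Open Scope ring_scope.

(** The polyhedron is self-similar: a branch, that is, a cube together with everything
    that grows on its free faces, consists of its root cube and of limbs which are
    branches scaled by s. The heat content of a set is the heat that the set exchanges
    with itself, and scaling lengths by s multiplies it by s^3 and the time by s^2.
    Splitting a branch into its root and its limbs therefore gives a renewal equation
    (self_exchange_recursion). With h(t) for the self-exchange of a branch,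
    l = sqrt (t / pi), and averaging over the six directions of growth,
      h(t) = 1 - 6 l + 12 t / pi + 10 s^2 l + 5 s^3 h(t / s^2) + O(t^(3/2)).
    The first three terms are the heat content of the unit cube (cube_self_exchange)
    and the fourth one is the exchange with the five cubes that touch it, in both
    directions (cube_next_exchange). All other pairs are at a positive distance, because
    s^2 + 2 s < 1 (limbs_apart, limb_tip_apart), and exchange at most a multiple
    of t^(3/2) (heat_kernel_far). For boxes the Gaussian kernel splits into three kernels on the
    line, for which the exchange of two intervals is a second difference of an explicit
    second antiderivative (line_exchange_itv, kernel_int2_asymp).

    Subtracting particular solutions of the renewal equation for 1, sqrt t and t, which
    exist since 5 s^3, 5 s^2 and 5 s differ from 1, leaves a solution w of
      w(t) = 5 s^3 w(t / s^2) + O(t^(3/2)).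
    As t^d = 5 s^3 (t / s^2)^d, the quotient w(t) / t^d as a function of x = ln t is
    invariant under the translation by ln (s^(-2)) up to an error of order
    exp ((3/2 - d) x). Since d < 3/2 its translates towards - oo converge, locally
    uniformly, to a continuous periodic function (asymptotically_periodic). The
    argument is the same for 5 s > 1 and for 5 s < 1.

    Two points of measure theory connect this with the polyhedron. The frame may be
    assumed to be the standard one and lengths may be rescaled, because a translation
    invariant measure on space is unique up to a factor (translation_invariant_unique),
    so that a linear map multiplies all volumes by the same number
    (linear_volume_factor). And the interior of the closure of the union of the cubes
    differs from this union by a null set (residue_negligible): by self-similarity the
    added volume is at most 6 s^3 < 1 times itself. *)

(** * Products of measures and translations *)

Section VolumeChange.
Context {R : realType}.
Local Notation X1 := (measurableTypeR R).
Local Notation X3 := (X1 * X1 * X1)%type.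
Local Notation mu1 := (@lebesgue_measure R).
Local Notation mu3 := (@lebesgue3 R).

(** Fubini's theorem asks for bundled sigma-finite measures; this bundles a measure
    whose sigma-finiteness is known as a proposition. *)
Definition sigma_finite_pack d (T : measurableType d)
    (m : {measure set T -> \bar R}) (h : sigma_finite setT m) :
    {sigma_finite_measure set T -> \bar R} :=
  SigmaFiniteMeasure.Pack (SigmaFiniteMeasure.Class
    (Measure.measure_function_Content_isMeasure_mixin (Measure.class m))
    (isSFinite.Axioms_ T R m (sfinite_measure_sigma_finite h))
    (isSigmaFinite.Axioms_ T R m h)).

Lemma sigma_finite_product d1 d2 (T1 : measurableType d1) (T2 : measurableType d2)
    (m1 : {sigma_finite_measure set T1 -> \bar R})
    (m2 : {sigma_finite_measure set T2 -> \bar R}) :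
  sigma_finite setT (m1 \x m2)%E.
Proof.
have /sigma_finiteP[F [TF ndF Foo]] := sigma_finiteT m1.
have /sigma_finiteP[G [TG ndG Goo]] := sigma_finiteT m2.
exists (fun n => F n `*` G n).
  rewrite -setXTT TF TG; apply/seteqP; split => [[x y]|z [n _ [? ?]]]; last by split; exists n.
    move=> [/= [n _ Fnx] [k _ Gky]]; exists (maxn n k) => //; split.
    - by move: x Fnx; exact/subsetPset/ndF/leq_maxl.
    - by move: y Gky; exact/subsetPset/ndG/leq_maxr.
move=> n; have [mF Ffin] := Foo n; have [mG Gfin] := Goo n.
split; first exact: measurableX.
by rewrite product_measure1E// lte_mul_pinfty// ge0_fin_numE.
Qed.

(** The first one is Lebesgue measure of the plane, and the second one is lebesgue3,
    in the form in which Fubini's theorem applies to them. *)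
Definition area : {sigma_finite_measure set (X1 * X1)%type -> \bar R} :=
  sigma_finite_pack (sigma_finite_product mu1 mu1).

Definition volume : {sigma_finite_measure set X3 -> \bar R} :=
  sigma_finite_pack (sigma_finite_product area mu1).

Definition pushm d d' (T : measurableType d) (T' : measurableType d')
    (m : {measure set T -> \bar R}) (f : T -> T') (mf : measurable_fun setT f)
    : {measure set T' -> \bar R}.
Proof.
refine [the {measure set T' -> \bar R} of pushforward m f].
exact: mf.
Defined.

Lemma measurable_preim d d' (T : measurableType d) (T' : measurableType d')
    (f : T -> T') (A : set T') :
  measurable_fun setT f -> measurable A -> measurable (f @^-1` A).
Proof. by move=> mf mA; rewrite -[X in measurable X]setTI; exact: mf. Qed.

(** Fubini's theorem for the indicator function of S. *)
Lemma measure_sections d1 d2 (T1 : measurableType d1) (T2 : measurableType d2)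
    (m1 : {sigma_finite_measure set T1 -> \bar R})
    (m2 : {sigma_finite_measure set T2 -> \bar R}) (S : set (T1 * T2)) :
  measurable S ->
  (\int[m1]_x m2 [set y | S (x, y)] = \int[m2]_y m1 [set x | S (x, y)])%E.
Proof.
move=> mS; have := indic_fubini_tonelli m1 m2 mS.
rewrite indic_fubini_tonelli_FE// indic_fubini_tonelli_GE//.
under eq_integral do rewrite /=.
move=> H; transitivity (\int[m1]_x m2 (xsection S x))%E.
  by apply: eq_integral => x _; congr (m2 _); apply/seteqP; split => y /=;
    rewrite /xsection/= inE.
rewrite H; apply: eq_integral => y _ /=; congr (m1 _).
by apply/seteqP; split => x /=; rewrite /ysection/= inE.
Qed.

Lemma lebesgue_measure_translation (c : X1) (A : set X1) : measurable A ->
  mu1 [set x | A (x + c)] = mu1 A.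
Proof.
move=> mA.
have mc : measurable_fun setT (fun x : X1 => x + c : X1).
  by apply: (measurable_funD (f := id) (g := cst c)).
suff : mu1 A = pushm mu1 mc A by move=> ->.
apply: lebesgue_measure_unique mA => _ [[a b]] _ <-.
rewrite /pushm/= /pushforward.
have -> : (fun x => x + c) @^-1` `]a, b]%classic = `](a - c), (b - c)]%classic.
  by apply/seteqP; split => x /=; rewrite !in_itv/= ltrBlDr lerBrDr.
rewrite !lebesgue_measure_itv/= !lte_fin ltrD2r; case: ifPn => // _.
by rewrite -!EFinB; congr EFin; ring.
Qed.

Lemma product_translation d1 d2 (T1 : measurableType d1) (T2 : measurableType d2)
    (m1 : {sigma_finite_measure set T1 -> \bar R})
    (m2 : {sigma_finite_measure set T2 -> \bar R}) (f1 : T1 -> T1) (f2 : T2 -> T2)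
    (B : set (T1 * T2)) :
  measurable_fun setT f1 -> measurable_fun setT f2 ->
  (forall A, measurable A -> m1 (f1 @^-1` A) = m1 A) ->
  (forall A, measurable A -> m2 (f2 @^-1` A) = m2 A) ->
  measurable B ->
  (m1 \x m2)%E [set x | B (f1 x.1, f2 x.2)] = (m1 \x m2)%E B.
Proof.
move=> mf1 mf2 h1 h2 mB.
have mf : measurable_fun setT (fun x : T1 * T2 => (f1 x.1, f2 x.2)).
  by apply: measurable_fun_pair; apply: measurableT_comp.
rewrite [RHS](_ : _ = pushm (m1 \x m2)%E mf B)//.
apply: product_measure_unique mB => A1 A2 mA1 mA2.
rewrite /pushm/= /pushforward -h1// -h2// -product_measure1E//;
  exact: measurable_preim.
Qed.

Lemma volume_translation (c : X3) (B : set X3) : measurable B ->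
  mu3 [set x | B (x + c)] = mu3 B.
Proof.
case: c => [[c1 c2] c3] mB.
have mc (c : X1) : measurable_fun setT (fun x : X1 => x + c : X1).
  by apply: (measurable_funD (f := id) (g := cst c)).
apply: (@product_translation _ _ _ _ area mu1
  (fun x => (x.1 + c1, x.2 + c2)) (fun x => x + c3)) => //.
- by apply: measurable_fun_pair; apply: (measurableT_comp (mc _)).
- move=> A mA; apply: (@product_translation _ _ _ _ mu1 mu1
    (fun x => x + c1) (fun x => x + c2)) => // A' mA';
  exact: lebesgue_measure_translation.
- by move=> A mA; exact: lebesgue_measure_translation.
Qed.

End VolumeChange.

(** * Linear maps and volume *)

Section Similarity.
Context {R : realType}.
Local Notation X1 := (measurableTypeR R).
Local Notation X3 := (X1 * X1 * X1)%type.
Local Notation mu1 := (@lebesgue_measure R).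
Local Notation mu3 := (@lebesgue3 R).

Section Coordinates.
Context d (T : measurableType d).
Implicit Types f g : T -> X3.

Lemma measurable_coord1 f :
  measurable_fun setT f -> measurable_fun setT (fun z => (f z).1.1 : X1).
Proof.
move=> mf; have m1 := measurableT_comp (@measurable_fst _ _ (X1 * X1)%type X1) mf.
exact: (measurableT_comp (@measurable_fst _ _ X1 X1) m1).
Qed.

Lemma measurable_coord2 f :
  measurable_fun setT f -> measurable_fun setT (fun z => (f z).1.2 : X1).
Proof.
move=> mf; have m1 := measurableT_comp (@measurable_fst _ _ (X1 * X1)%type X1) mf.
exact: (measurableT_comp (@measurable_snd _ _ X1 X1) m1).
Qed.

Lemma measurable_coord3 f :
  measurable_fun setT f -> measurable_fun setT (fun z => (f z).2 : X1).
Proof.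
exact: (measurableT_comp (@measurable_snd _ _ (X1 * X1)%type X1)).
Qed.

Lemma measurable_funB3 f g :
  measurable_fun setT f -> measurable_fun setT g ->
  measurable_fun setT (fun z => f z - g z : X3).
Proof.
move=> mf mg.
have mcoord (h h' : T -> X1) : measurable_fun setT h -> measurable_fun setT h' ->
  measurable_fun setT (fun z => h z - h' z : X1) by exact: measurable_funB.
apply: (measurable_fun_pair (f := fun z => (f z - g z).1 : X1 * X1)).
  apply: measurable_fun_pair; apply: mcoord;
  by [exact: measurable_coord1|exact: measurable_coord2].
by apply: mcoord; exact: measurable_coord3.
Qed.

Lemma measurable_funN3 f :
  measurable_fun setT f -> measurable_fun setT (fun z => - f z : X3).
Proof.
move=> mf; under eq_fun do rewrite -sub0r.
exact: (measurable_funB3 (f := cst 0)).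
Qed.

Lemma measurable_funD3 f g :
  measurable_fun setT f -> measurable_fun setT g ->
  measurable_fun setT (fun z => f z + g z : X3).
Proof.
move=> mf mg; under eq_fun do rewrite -[g _]opprK.
by apply: measurable_funB3 => //; exact: measurable_funN3.
Qed.

Lemma measurable_fun_dot f g :
  measurable_fun setT f -> measurable_fun setT g ->
  measurable_fun setT (fun z => dot (f z) (g z) : X1).
Proof.
move=> mf mg; apply: measurable_funD.
  apply: measurable_funD; apply: measurable_funM;
  by [exact: measurable_coord1|exact: measurable_coord2].
by apply: measurable_funM; exact: measurable_coord3.
Qed.

End Coordinates.

Definition box (r : R) : set X3 :=
  [set x | [/\ `|x.1.1| <= r, `|x.1.2| <= r & `|x.2| <= r]].

Lemma boxE r : box r = `[- r, r]%classic `*` `[- r, r]%classic `*` `[- r, r]%classic.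
Proof.
apply/seteqP; split => -[[x y] z]; rewrite /box /= !in_itv/= -!ler_norml.
  by case=> -> -> ->.
by case=> -[-> ->] ->.
Qed.

Lemma measurable_box r : measurable (box r).
Proof.
rewrite boxE; have mI : measurable (`[- r, r]%classic : set X1) by exact: measurable_itv.
exact: (measurableX (measurableX mI mI) mI).
Qed.

Lemma volume_product (A1 A2 A3 : set X1) :
  measurable A1 -> measurable A2 -> measurable A3 ->
  mu3 (A1 `*` A2 `*` A3) = (mu1 A1 * mu1 A2 * mu1 A3)%E.
Proof.
move=> m1 m2 m3; rewrite [LHS](product_measure1E area mu1)//.
  by congr (_ * _)%E; rewrite [LHS]product_measure1E.
exact: measurableX.
Qed.

Lemma volume_box r : 0 <= r -> mu3 (box r) = ((2 * r) ^+ 3)%:E.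
Proof.
rewrite le_eqVlt => /predU1P[<-|r0].
  rewrite boxE volume_product// oppr0 lebesgue_measure_itv/= ltxx !mul0e.
  by rewrite mulr0 expr0n.
rewrite boxE volume_product// lebesgue_measure_itv/= lte_fin gtrN//.
by rewrite -!EFinB -!EFinM; congr EFin; ring.
Qed.

Definition translation_invariant (m : set X3 -> \bar R) :=
  forall (c : X3) (B : set X3), measurable B -> m [set x : X3 | B (x + c)] = m B.

(** Uniqueness of the translation invariant measure.  Fubini's theorem evaluates
    in two orders the measure of the pairs (x, y) with y in A and x + y in B;
    the substitution of y - x for y turns one of the values into
    nu B * m (- A). *)
Lemma translation_invariant_unique (m nu : {sigma_finite_measure set X3 -> \bar R})
    (A B : set X3) :
  translation_invariant m -> translation_invariant nu ->
  measurable A -> measurable B -> (forall x, A (- x) <-> A x) ->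
  (nu A * m B = nu B * m A)%E.
Proof.
move=> m_transl nu_transl mA mB symA.
have int_indic (C : set X3) (v : \bar R) : (0 <= v)%E -> measurable C ->
    (\int[nu]_y ((\1_C y)%:E * v) = nu C * v)%E.
  move=> v0 mC; rewrite ge0_integralZr//; last exact/measurable_EFinP.
  by rewrite integral_indic// setIT.
have mS1 : measurable [set z : X3 * X3 | A z.2 /\ B (z.1 + z.2)].
  apply: measurableI; first exact: (measurable_preim (@measurable_snd _ _ X3 X3) mA).
  apply: (measurable_preim (f := fun z : X3 * X3 => z.1 + z.2 : X3) _ mB).
  by apply: measurable_funD3; [exact: measurable_fst|exact: measurable_snd].
have mS2 : measurable [set z : X3 * X3 | A (z.2 - z.1) /\ B z.2].
  apply: measurableI; last exact: (measurable_preim (@measurable_snd _ _ X3 X3) mB).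
  apply: (measurable_preim (f := fun z : X3 * X3 => z.2 - z.1 : X3) _ mA).
  by apply: measurable_funB3; [exact: measurable_snd|exact: measurable_fst].
have H1 := measure_sections m nu mS1.
have H2 := measure_sections m nu mS2.
have E12 : (\int[m]_x nu [set y : X3 | A y /\ B (x + y)%R] =
            \int[m]_x nu [set y : X3 | A (y - x)%R /\ B y])%E.
  apply: eq_integral => x _.
  have mAB : measurable [set y : X3 | A (y - x) /\ B y].
    apply: measurableI mB.
    apply: (measurable_preim (f := fun y : X3 => y - x : X3) _ mA).
    by apply: measurable_funB3; [exact: measurable_id|exact: measurable_cst].
  rewrite -(nu_transl x _ mAB).
  by congr (nu _); apply/seteqP; split => y /=; rewrite addrK [y + x]addrC.
have F1 : (\int[nu]_y m [set x : X3 | A y /\ B (x + y)%R] = nu A * m B)%E.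
  rewrite -int_indic//; apply: eq_integral => y _; rewrite indicE.
  have [|] := boolP (y \in A).
    rewrite inE => Ay; rewrite mul1e -[RHS](m_transl y _ mB).
    by congr (m _); apply/seteqP; split => x //= [].
  rewrite notin_setE => Ay; rewrite mul0e (_ : [set _ | _] = set0) ?measure0//.
  by apply/seteqP; split => x //= [].
have F2 : (\int[nu]_y m [set x : X3 | A (y - x)%R /\ B y] = nu B * m A)%E.
  rewrite -int_indic//; apply: eq_integral => y _; rewrite indicE.
  have [|] := boolP (y \in B).
    rewrite inE => By; rewrite mul1e -[RHS](m_transl (- y) _ mA).
    congr (m _); apply/seteqP; split => x /=; rewrite -[y - x]opprB symA;
    by [case|split].
  rewrite notin_setE => By; rewrite mul0e (_ : [set _ | _] = set0) ?measure0//.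
  by apply/seteqP; split => x //= [].
by rewrite -F1 -F2 -H1 -H2.
Qed.

(** A linear bijection psi of space multiplies all volumes by the same factor,
    because the image of the volume under psi is translation invariant.  The factor
    can therefore be read off from a single symmetric set A. *)
Lemma linear_volume_factor (psi chi : X3 -> X3) (A : set X3) (k : R) :
  measurable_fun setT psi -> measurable_fun setT chi ->
  {morph psi : x y / x + y} -> cancel psi chi -> cancel chi psi ->
  measurable A -> (forall x, A (- x) <-> A x) -> (0 < mu3 A < +oo)%E ->
  (mu3 (psi @^-1` A) = k%:E * mu3 A)%E ->
  forall B, measurable B -> (mu3 (psi @^-1` B) = k%:E * mu3 B)%E.
Proof.
move=> mpsi mchi psiD psiK chiK mA symA /andP[A_gt0 A_fin] Ak B mB.
pose nu0 := pushm mu3 mpsi.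
have nu_sfin : sigma_finite setT nu0.
  exists (fun n => chi @^-1` (box n%:R)).
    apply/seteqP; split => // x _.
    pose m := `|(chi x).1.1| + `|(chi x).1.2| + `|(chi x).2|.
    exists (Num.truncn m).+1 => //=.
    have := truncnS_gt m; rewrite /box/= /m => /ltW h.
    by split; apply: le_trans h; [rewrite -addrA lerDl addr_ge0|
      rewrite addrAC lerDr addr_ge0|rewrite lerDr addr_ge0].
  move=> n; split; first exact: (measurable_preim mchi (measurable_box _)).
  rewrite /nu0/= /pushforward (_ : psi @^-1` _ = box n%:R); last first.
    by apply/seteqP; split => x; rewrite /preimage/= psiK.
  by rewrite volume_box// ltry.
have nu_transl : translation_invariant (sigma_finite_pack nu_sfin).
  move=> c C mC.
  transitivity (mu3 (psi @^-1` C)) => //.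
  rewrite -(volume_translation (chi c) (measurable_preim mpsi mC)).
  rewrite /=/pushforward.
  by congr (mu3 _); apply/seteqP; split => x; rewrite /preimage/= psiD chiK.
have H := translation_invariant_unique (m := volume) (@volume_translation R)
  nu_transl mA mB symA.
have {}H : (mu3 (psi @^-1` A) * mu3 B = mu3 (psi @^-1` B) * mu3 A)%E by exact: H.
rewrite Ak in H.
have [a Aa] : exists a, mu3 A = a%:E.
  by exists (fine (mu3 A)); rewrite fineK// ge0_fin_numE// measure_ge0.
move: A_gt0 H; rewrite Aa lte_fin => a0.
rewrite muleAC => /(congr1 (fun v => v * (a^-1)%:E)%E).
by rewrite -!muleA -!EFinM mulfV ?gt_eqF// !mule1.
Qed.

End Similarity.

Section Frames.
Context {R : realType}.
Local Notation X1 := (measurableTypeR R).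
Local Notation X3 := (X1 * X1 * X1)%type.
Local Notation mu3 := (@lebesgue3 R).
Implicit Types x y z : space3 R.

Lemma dotC x y : dot x y = dot y x.
Proof. by rewrite /dot; ring. Qed.

Lemma dotDl x y z : dot (x + y) z = dot x z + dot y z.
Proof. by rewrite /dot /=; ring. Qed.

Lemma dotNl x z : dot (- x) z = - dot x z.
Proof. by rewrite /dot /=; ring. Qed.

Lemma dotBl x y z : dot (x - y) z = dot x z - dot y z.
Proof. by rewrite dotDl dotNl. Qed.

Lemma dotZl (a : R) x z : dot (a *: x) z = a * dot x z.
Proof. by rewrite /dot /= /GRing.scale/=; ring. Qed.

Lemma dot0l z : dot 0 z = 0.
Proof. by rewrite /dot /=; ring. Qed.

Definition o1 : 'I_3 := lift ord0 ord0.
Definition o2 : 'I_3 := lift ord0 (lift ord0 ord0).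

Lemma ord3P (k : 'I_3) : [\/ k = ord0, k = o1 | k = o2].
Proof.
case: k => -[|[|[|//]]] h; [constructor 1|constructor 2|constructor 3];
exact: val_inj.
Qed.

Variable e : 'I_3 -> space3 R.
Hypothesis he : orthonormal_frame e.

(** The frame identifies space isometrically with the triples of coordinates; all
    the cubes have their faces parallel to the coordinate planes after this
    identification. *)
Definition coords x : X3 := (dot x (e ord0), dot x (e o1), dot x (e o2)).
Definition point (c : X3) : X3 := c.1.1 *: e ord0 + c.1.2 *: e o1 + c.2 *: e o2.

Lemma pointK : cancel point coords.
Proof.
by move=> [[a b] c]; rewrite /coords /point !dotDl !dotZl !he /=;
  congr (_, _, _); ring.
Qed.

(** An orthonormal system of three vectors is complete, since a matrix commutes with
    its inverse. *)
Lemma coordsK : cancel coords point.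
Proof.
pose cd x (j : 'I_3) : R := if j == ord0 then x.1.1 else if j == o1 then x.1.2 else x.2.
pose M : 'M[R]_3 := \matrix_(i, j) cd (e i) j.
have MMt : M *m M^T = 1%:M.
  apply/matrixP => i j; rewrite !mxE -he !big_ord_recl big_ord0 !mxE /cd /dot /=.
  by rewrite addr0 addrA.
have := mulmx1C MMt.
move=> /matrixP H.
have {}H i j : cd (e ord0) i * cd (e ord0) j + cd (e o1) i * cd (e o1) j +
    cd (e o2) i * cd (e o2) j = (i == j)%:R.
  by have := H i j; rewrite !mxE !big_ord_recl big_ord0 !mxE addr0 addrA.
move=> [[a b] c].
have E j : cd (a, b, c) j =
    a * (cd (e ord0) ord0 * cd (e ord0) j + cd (e o1) ord0 * cd (e o1) j +
         cd (e o2) ord0 * cd (e o2) j) +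
    b * (cd (e ord0) o1 * cd (e ord0) j + cd (e o1) o1 * cd (e o1) j +
         cd (e o2) o1 * cd (e o2) j) +
    c * (cd (e ord0) o2 * cd (e ord0) j + cd (e o1) o2 * cd (e o1) j +
         cd (e o2) o2 * cd (e o2) j).
  by rewrite !H; case: (ord3P j) => -> /=; rewrite /cd/=; ring.
have Ea := E ord0; have Eb := E o1; have Ec := E o2.
move: Ea Eb Ec; rewrite /cd/= /coords /point /dot/=.
move: (e ord0) (e o1) (e o2) => [[x0 y0] z0] [[x1 y1] z1] [[x2 y2] z2] /=.
move=> Ea Eb Ec.
have sc (u v : R) : u *: v = u * v by [].
by congr (_, _, _); rewrite /= ?sc; [rewrite [RHS]Ea|rewrite [RHS]Eb|
  rewrite [RHS]Ec]; ring.
Qed.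

Lemma dot_coords x y : dot (coords x) (coords y) = dot x y.
Proof.
rewrite -[in RHS](coordsK x); move: (coords x) => c.
by rewrite /point !dotDl !dotZl ![dot (e _) _]dotC.
Qed.

Lemma coordsB x y : coords (x - y) = coords x - coords y.
Proof. by rewrite /coords !dotBl. Qed.

Lemma measurable_coords : measurable_fun setT (coords : X3 -> X3).
Proof.
have h k : measurable_fun setT (fun x : X3 => dot x (e k) : X1).
  exact: (measurable_fun_dot (f := id) (g := cst (e k))).
exact: measurable_fun_pair (measurable_fun_pair (h _) (h _)) (h _).
Qed.

Lemma measurable_scale3 (a : R) : measurable_fun setT (fun x : X3 => a *: x : X3).
Proof.
have h (f : X3 -> X1) : measurable_fun setT f ->
    measurable_fun setT (fun x => a * f x : X1).
  by move=> mf; exact: (measurable_funM (f := cst a)).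
exact: (measurable_fun_pair (measurable_fun_pair
  (h _ (measurable_coord1 (f := id) _)) (h _ (measurable_coord2 (f := id) _)))
  (h _ (measurable_coord3 (f := id) _))).
Qed.

Lemma measurable_point : measurable_fun setT (point : X3 -> X3).
Proof.
have h (f : X3 -> X1) v : measurable_fun setT f ->
    measurable_fun setT (fun x => f x *: v : X3).
  case: v => [[v1 v2] v3] mf.
  have hm w : measurable_fun setT (fun x => f x * w : X1).
    exact: (measurable_funM (g := cst w)).
  exact: (measurable_fun_pair (measurable_fun_pair (hm v1) (hm v2)) (hm v3)).
apply: measurable_funD3; first apply: measurable_funD3.
- exact: (h _ _ (measurable_coord1 (f := id) _)).
- exact: (h _ _ (measurable_coord2 (f := id) _)).
- exact: (h _ _ (measurable_coord3 (f := id) _)).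
Qed.

Lemma volume_scale (s : R) (B : set X3) : 0 < s -> measurable B ->
  (mu3 [set x : X3 | B (s *: x)] = ((s ^+ 3)^-1)%:E * mu3 B)%E.
Proof.
move=> s0 mB.
apply: (linear_volume_factor (psi := fun x => s *: x) (chi := fun x => s^-1 *: x)
   (A := box 1) (measurable_scale3 s) (measurable_scale3 s^-1)) => //.
- by move=> x y; rewrite scalerDr.
- by move=> x; rewrite scalerA mulVf ?gt_eqF// scale1r.
- by move=> x; rewrite scalerA mulfV ?gt_eqF// scale1r.
- exact: measurable_box.
- by move=> x; rewrite /box/= !normrN.
- by rewrite volume_box// lte_fin ltry andbT; lra.
rewrite (_ : _ @^-1` _ = box s^-1); last first.
  have h u : (`|s * u| <= 1) = (`|u| <= s^-1).
    by rewrite normrM gtr0_norm// mulrC -ler_pdivlMr// div1r.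
  by apply/seteqP; split => x; rewrite /box/= /GRing.scale/= !h.
by rewrite !volume_box// ?invr_ge0 ?ltW// -EFinM; congr EFin; field; rewrite gt_eqF.
Qed.

(** Rotations multiply volumes by 1, because the unit ball is its own image. *)
Lemma volume_coords (B : set X3) : measurable B -> mu3 (coords @^-1` B) = mu3 B.
Proof.
move=> mB; rewrite -[RHS]mul1e.
pose ball1 : set X3 := [set x | dot x x < 1].
have mball : measurable ball1.
  rewrite -[X in measurable X]setTI.
  have : measurable_fun setT (fun x : X3 => dot x x : X1).
    exact: measurable_fun_dot.
  move=> /(_ measurableT `]-oo, 1[%classic) h.
  rewrite (_ : ball1 = (fun x : X3 => dot x x) @^-1` `]-oo, 1[%classic); last first.
    by apply/seteqP; split => x; rewrite /= in_itv.
  by apply: h; exact: measurable_itv.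
have sub1 : box 2^-1 `<=` ball1.
  move=> x [h1 h2 h3]; rewrite /ball1/= /dot.
  have sq (u : R) : `|u| <= 2^-1 -> u * u <= 4^-1.
    rewrite -expr2 -real_normK ?num_real// => h.
    have -> : 4^-1 = 2^-1 ^+ 2 :> R by field.
    by rewrite ler_sqr// ?nnegrE ?invr_ge0.
  by have := sq _ h1; have := sq _ h2; have := sq _ h3; lra.
have sub2 : ball1 `<=` box 1.
  move=> x; rewrite /ball1/= /dot /box/= => h.
  have sq (u : R) : u * u <= 1 -> `|u| <= 1.
    by rewrite -expr2 -real_normK ?num_real// expr_le1.
  by split; apply: sq; have := sqr_ge0 x.1.1; have := sqr_ge0 x.1.2;
     have := sqr_ge0 x.2; rewrite !expr2; lra.
apply: (linear_volume_factor (psi := coords) (chi := point) (A := ball1)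
   measurable_coords measurable_point) => //.
- by move=> x y; rewrite /coords !dotDl.
- exact: coordsK.
- exact: pointK.
- by move=> x; rewrite /ball1/= dotNl (dotC x) dotNl opprK.
- have le1 : (mu3 (box 2^-1) <= mu3 ball1)%E.
    by apply: le_measure => //; rewrite inE//; exact: measurable_box.
  have le2 : (mu3 ball1 <= mu3 (box 1))%E.
    by apply: le_measure => //; rewrite inE//; exact: measurable_box.
  apply/andP; split; [apply: lt_le_trans le1|apply: le_lt_trans le2 _];
    rewrite volume_box ?invr_ge0 ?ltry//.
- rewrite mul1e; congr (mu3 _); apply/seteqP; split => x;
  by rewrite /ball1 /preimage/= dot_coords.
Qed.

End Frames.

(** * Exchange of heat between two sets *)

Section HeatExchange.
Context {R : realType}.
Local Notation X1 := (measurableTypeR R).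
Local Notation X3 := (X1 * X1 * X1)%type.
Local Notation mu1 := (@lebesgue_measure R).
Local Notation mu3 := (@lebesgue3 R).
Implicit Types (A B : set X3) (t : R).

(** The amount of heat that is found in A at time t when B is filled with heat of
    density 1 at time 0. The heat content of A is exchange A A. *)
Definition exchange A B t : \bar R :=
  (\int[mu3]_(x in A) \int[mu3]_(y in B) (heat_kernel x y t)%:E)%E.

Lemma heat_kernel_ge0 (x y : X3) t : 0 <= heat_kernel x y t.
Proof. by rewrite mulr_ge0 ?powR_ge0 ?expR_ge0. Qed.

Lemma heat_kernelC (x y : X3) t : heat_kernel x y t = heat_kernel y x t.
Proof.
rewrite /heat_kernel -[x - y]opprB dotNl (dotC (y - x)) dotNl opprK.
by [].
Qed.

Lemma measurable_heat_kernel t :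
  measurable_fun setT (fun z : X3 * X3 => heat_kernel z.1 z.2 t : X1).
Proof.
have mB : measurable_fun setT (fun z : X3 * X3 => z.1 - z.2 : X3).
  by apply: measurable_funB3; [exact: measurable_fst|exact: measurable_snd].
apply: (measurable_funM (f := cst _)); first exact: measurable_cst.
apply: (measurableT_comp (f := expR)); first exact: measurable_expR.
apply: measurable_funN.
apply: (measurable_funM (g := cst _)); last exact: measurable_cst.
exact: measurable_fun_dot.
Qed.

Lemma measurable_heat_kernelE t :
  measurable_fun setT (fun z : X3 * X3 => (heat_kernel z.1 z.2 t)%:E).
Proof. by apply/measurable_EFinP; exact: measurable_heat_kernel. Qed.

Lemma measurable_heat_kernelr (x : X3) t :
  measurable_fun setT (fun y : X3 => (heat_kernel x y t)%:E).
Proof.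
exact: (measurable_fun_pair2 x (measurable_heat_kernelE t)).
Qed.

Lemma measurable_indic_comp d (T : measurableType d) (f : T -> X3) B :
  measurable B -> measurable_fun setT f ->
  measurable_fun setT (fun z => (\1_B (f z))%:E : \bar R).
Proof.
move=> mB mf; apply/measurable_EFinP.
have mI : measurable_fun setT (\1_B : X3 -> X1) by exact: measurable_indic.
exact: (measurableT_comp mI mf).
Qed.

Lemma measurable_exchange B t : measurable B ->
  measurable_fun setT (fun x : X3 => \int[mu3]_(y in B) (heat_kernel x y t)%:E)%E.
Proof.
move=> mB.
pose f (z : X3 * X3) : \bar R := ((heat_kernel z.1 z.2 t)%:E * (\1_B z.2)%:E)%E.
have mf : measurable_fun setT f.
  apply: emeasurable_funM.
    exact: measurable_heat_kernelE.
  by apply: measurable_indic_comp mB _; exact: measurable_snd.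
have f0 z : (0 <= f z)%E.
  by rewrite /f -EFinM lee_fin mulr_ge0// heat_kernel_ge0.
have := measurable_fun_fubini_tonelli_F (m2 := volume) f mf f0.
apply: eq_measurable_fun => x _.
rewrite /fubini_F [RHS]integral_mkcond; apply: eq_integral => y _.
rewrite /f patchE indicE; case: ifPn => _; first by rewrite mule1.
by rewrite mule0.
Qed.

Lemma heat_kernel_le (x y : X3) t : 0 <= t ->
  heat_kernel x y t <= (4 * pi * t) `^ (- (3 / 2)).
Proof.
move=> t0; rewrite /heat_kernel -[leRHS]mulr1 ler_wpM2l ?powR_ge0//.
rewrite -[leRHS]expR0 ler_expR oppr_le0 divr_ge0 ?mulr_ge0// /dot.
by rewrite -!expr2 !addr_ge0 ?sqr_ge0.
Qed.

Lemma exchange_ge0 A B t : (0 <= exchange A B t)%E.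
Proof.
apply: integral_ge0 => x _; apply: integral_ge0 => y _.
by rewrite lee_fin heat_kernel_ge0.
Qed.

Lemma exchangeC A B t : measurable A -> measurable B -> exchange A B t = exchange B A t.
Proof.
move=> mA mB.
pose f (z : X3 * X3) : \bar R :=
  ((\1_A z.1)%:E * ((heat_kernel z.1 z.2 t)%:E * (\1_B z.2)%:E))%E.
have mf : measurable_fun setT f.
  apply: emeasurable_funM.
    by apply: measurable_indic_comp mA _; exact: measurable_fst.
  apply: emeasurable_funM.
    exact: measurable_heat_kernelE.
  by apply: measurable_indic_comp mB _; exact: measurable_snd.
have f0 z : (0 <= f z)%E.
  by rewrite /f -!EFinM lee_fin mulr_ge0// mulr_ge0// heat_kernel_ge0.
have := fubini_tonelli (m1 := volume) (m2 := volume) f mf f0.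
have -> : (\int[volume]_x \int[volume]_y f (x, y) = exchange A B t)%E.
  rewrite [RHS]integral_mkcond; apply: eq_integral => x _.
  rewrite patchE /f /= indicE; case: ifPn => _ /=; last first.
    by under eq_integral do rewrite mul0e; rewrite integral0.
  rewrite [RHS]integral_mkcond; apply: eq_integral => y _.
  by rewrite mul1e patchE indicE; case: ifPn => _; rewrite ?mule1 ?mule0.
have -> // : (\int[volume]_y \int[volume]_x f (x, y) = exchange B A t)%E.
rewrite [RHS]integral_mkcond; apply: eq_integral => y _.
rewrite patchE /f /= [(\1_B y)]indicE; case: ifPn => _ /=; last first.
  by under eq_integral do rewrite !mule0; rewrite integral0.
rewrite [RHS]integral_mkcond; apply: eq_integral => x _.
rewrite mule1 patchE indicE heat_kernelC.
by case: ifPn => _; rewrite ?mul1e ?mul0e.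
Qed.

Lemma exchangeUl A1 A2 B t : measurable A1 -> measurable A2 -> measurable B ->
  A1 `&` A2 = set0 -> (exchange (A1 `|` A2) B t = exchange A1 B t + exchange A2 B t)%E.
Proof.
move=> mA1 mA2 mB dA; apply: ge0_integral_setU => //; last exact/disj_set2P.
  by apply: measurable_funTS; exact: measurable_exchange.
by move=> x _; apply: integral_ge0 => y _; rewrite lee_fin heat_kernel_ge0.
Qed.

Lemma exchangeUr A1 A2 B t : measurable A1 -> measurable A2 -> measurable B ->
  A1 `&` A2 = set0 -> (exchange B (A1 `|` A2) t = exchange B A1 t + exchange B A2 t)%E.
Proof.
move=> mA1 mA2 mB dA; have := exchangeUl t mA1 mA2 mB dA.
rewrite (exchangeC t mA1 mB) (exchangeC t mA2 mB) => <-.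
exact: (exchangeC t mB (measurableU _ _ mA1 mA2)).
Qed.

Lemma le_exchange A B t (M : R) : measurable A -> measurable B -> 0 <= M ->
  (forall x y, A x -> B y -> heat_kernel x y t <= M) ->
  (exchange A B t <= M%:E * mu3 A * mu3 B)%E.
Proof.
move=> mA mB M0 kM.
apply: (@le_trans _ _ (\int[mu3]_(x in A) (M%:E * mu3 B))%E).
  apply: ge0_le_integral => //.
  - by move=> x _; apply: integral_ge0 => y _; rewrite lee_fin heat_kernel_ge0.
  - by apply: measurable_funTS; exact: measurable_exchange.
  - move=> x Ax; rewrite -integral_cst//; apply: ge0_le_integral => //.
    + by move=> y _; rewrite lee_fin heat_kernel_ge0.
    + by apply: measurable_funTS; exact: measurable_heat_kernelr.
    + by move=> y By; rewrite lee_fin kM.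
rewrite (integral_cst mu3 mA) muleAC; exact: lexx.
Qed.

(** The kernel is bounded at a fixed time, so that a null set exchanges no heat. *)
Lemma exchange_negligible A N t : 0 <= t -> measurable A -> measurable N -> mu3 N = 0 ->
  exchange (A `|` N) (A `|` N) t = exchange A A t.
Proof.
move=> t0 mA mN N0; pose N' := N `\` A.
have mN' : measurable N' by exact: measurableD.
have N'0 : mu3 N' = 0 by apply: (subset_measure0 _ _ _ N0) => // x [].
have -> : A `|` N = A `|` N'.
  apply/seteqP; split => x [Ax|Nx]; try by left.
    by case: (pselect (A x)) => ?; [left|right].
  by right; case: Nx.
have dis : A `&` N' = set0 by apply/seteqP; split => x // -[Ax [_ /(_ Ax)]].
have e0 B B' : measurable B -> measurable B' -> (mu3 B = 0)%E -> exchange B B' t = 0.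
  move=> mB mB' B0; apply/eqP; rewrite eq_le exchange_ge0 andbT.
  apply: le_trans (le_exchange mB mB' (M := (4 * pi * t) `^ (- (3 / 2))) _ _) _.
  - exact: powR_ge0.
  - by move=> x y _ _; exact: heat_kernel_le.
  - by rewrite B0 mule0 mul0e.
have mU := measurableU _ _ mA mN'.
rewrite (exchangeUl t mA mN' mU dis) (exchangeUr t mA mN' mA dis) (e0 _ _ mN' mU N'0).
rewrite (exchangeC t mA mN') (e0 _ _ mN' mA N'0) !adde0; reflexivity.
Qed.

(** Each of the two integrals contributes a factor k, and the kernel cancels one of
    them. *)
Lemma exchange_change (sigma : X3 -> X3) (k : R) A B t t' :
  0 < k -> measurable_fun setT sigma ->
  (forall C, measurable C -> (mu3 (sigma @^-1` C) = k%:E * mu3 C)%E) ->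
  (forall x y, heat_kernel x y t = k^-1 * heat_kernel (sigma x) (sigma y) t') ->
  measurable A -> measurable B ->
  (exchange (sigma @^-1` A) (sigma @^-1` B) t = k%:E * exchange A B t')%E.
Proof.
move=> k0 msig vol_sig ker mA mB.
have int_sig C (f : X3 -> \bar R) : measurable C -> measurable_fun setT f ->
    (forall x, 0 <= f x)%E ->
    (\int[mu3]_(x in sigma @^-1` C) f (sigma x) = k%:E * \int[mu3]_(x in C) f x)%E.
  move=> mC mf f0.
  rewrite -(ge0_integral_pushforward msig mu3 mC)//; last exact: measurable_funTS.
  rewrite -(ge0_integral_mscale mu3 mC (NngNum (ltW k0)))//; last exact: measurable_funTS.
  by apply: eq_measure_integral => E mE _; exact: vol_sig.
rewrite /exchange -int_sig; last 3 first.
- exact: mA.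
- exact: measurable_exchange.
- by move=> x; apply: integral_ge0 => y _; rewrite lee_fin heat_kernel_ge0.
apply: eq_integral => x _.
under eq_integral do rewrite ker EFinM.
rewrite ge0_integralZl//; last 3 first.
- apply: measurable_funTS.
  exact: (measurableT_comp (measurable_heat_kernelr (sigma x) t') msig).
- by move=> y _; rewrite lee_fin heat_kernel_ge0.
- by rewrite lee_fin invr_ge0 ltW.
rewrite (int_sig B (fun y => (heat_kernel (sigma x) y t')%:E))//; last 2 first.
- exact: measurable_heat_kernelr.
- by move=> y; rewrite lee_fin heat_kernel_ge0.
  by rewrite muleA -EFinM mulVf ?gt_eqF// mul1e.
exact: (measurable_preim msig).
Qed.

(** Parabolic scaling: lengths are multiplied by s and times by s^2. *)
Lemma exchange_scale (s : R) (c : space3 R) A B t : 0 < s -> 0 < t ->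
  measurable A -> measurable B ->
  exchange [set x : X3 | A (s^-1 *: (x - c))] [set x : X3 | B (s^-1 *: (x - c))] t =
  ((s ^+ 3)%:E * exchange A B (t / s ^+ 2))%E.
Proof.
move=> s0 t0 mA mB.
apply: (exchange_change (sigma := fun x : X3 => s^-1 *: (x - c) : X3)) => //.
- by rewrite exprn_gt0.
- apply: (measurableT_comp (measurable_scale3 _)).
  by apply: measurable_funB3; [exact: measurable_id|exact: measurable_cst].
- move=> C mC.
  have mC' : measurable [set x : X3 | C (s^-1 *: x)].
    exact: (measurable_preim (measurable_scale3 s^-1)).
  rewrite [LHS](volume_translation (- c) mC') volume_scale ?invr_gt0//.
  by rewrite exprVn invrK.
- move=> x y; rewrite /heat_kernel.
  rewrite -scalerBr opprB addrA subrK !dotZl (dotC (x - y) (s^-1 *: _)) dotZl.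
  rewrite [RHS]mulrA; congr (_ * expR (- _)); last first.
    by field; rewrite !gt_eqF.
  have -> : 4 * pi * (t / s ^+ 2) = 4 * pi * t * s ^- 2 by rewrite mulrA.
  have c0 : 0 <= 4 * pi * t by rewrite !mulr_ge0 ?pi_ge0// ltW.
  rewrite (powRM _ c0) ?invr_ge0 ?exprn_ge0 ?(ltW s0)//.
  have -> : (s ^- 2) `^ (- (3 / 2)) = s ^+ 3.
    rewrite -(powR_invn 2 (ltW s0)) -powRrM -(powR_mulrn 3 (ltW s0)).
    by congr (_ `^ _); field.
  by rewrite [RHS]mulrC mulfK// gt_eqF// exprn_gt0.
Qed.

End HeatExchange.

(** * Exchange of heat between boxes *)

Section BoxExchange.
Context {R : realType}.
Local Notation X1 := (measurableTypeR R).
Local Notation X3 := (X1 * X1 * X1)%type.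
Local Notation mu1 := (@lebesgue_measure R).
Local Notation mu3 := (@lebesgue3 R).

Lemma integral_product d1 d2 (T1 : measurableType d1) (T2 : measurableType d2)
    (m1 : {sigma_finite_measure set T1 -> \bar R})
    (m2 : {sigma_finite_measure set T2 -> \bar R})
    (A : set T1) (B : set T2) (f1 : T1 -> \bar R) (f2 : T2 -> \bar R) :
  measurable A -> measurable B ->
  measurable_fun setT f1 -> measurable_fun setT f2 ->
  (forall x, 0 <= f1 x)%E -> (forall y, 0 <= f2 y)%E ->
  (\int[m1 \x m2]_(z in A `*` B) (f1 z.1 * f2 z.2) =
   (\int[m1]_(x in A) f1 x) * (\int[m2]_(y in B) f2 y))%E.
Proof.
move=> mA mB mf1 mf2 f1_ge0 f2_ge0.
pose g1 := f1 \_ A; pose g2 := f2 \_ B.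
have mg1 : measurable_fun setT g1.
  by apply/(measurable_restrictT _ mA); exact: measurable_funTS.
have mg2 : measurable_fun setT g2.
  by apply/(measurable_restrictT _ mB); exact: measurable_funTS.
have g1_ge0 x : (0 <= g1 x)%E by rewrite /g1 patchE; case: ifP.
have g2_ge0 x : (0 <= g2 x)%E by rewrite /g2 patchE; case: ifP.
rewrite integral_mkcond [in RHS]integral_mkcond [X in (_ = _ * X)%E]integral_mkcond.
rewrite -/g1 -/g2.
pose g (z : T1 * T2) := (g1 z.1 * g2 z.2)%E.
transitivity (\int[m1 \x m2]_z g z)%E.
  apply: eq_integral => z _; rewrite /g /g1 /g2 !patchE.
  rewrite in_setX; case: (z.1 \in A) => /=; last by rewrite mul0e.
  by case: (z.2 \in B) => //=; rewrite mule0.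
have mg : measurable_fun setT g.
  apply: emeasurable_funM.
    exact: (measurableT_comp mg1 (@measurable_fst _ _ T1 T2)).
  exact: (measurableT_comp mg2 (@measurable_snd _ _ T1 T2)).
rewrite (fubini_tonelli1 g mg)//; last by move=> z; rewrite mule_ge0.
rewrite -ge0_integralZr//; last by apply: integral_ge0.
by apply: eq_integral => x _; rewrite /fubini_F /g/= ge0_integralZl.
Qed.

Definition line_kernel (t a b : R) : R :=
  (4 * pi * t) `^ (- (1 / 2)) * expR (- ((a - b) ^+ 2 / (4 * t))).

Definition line_exchange (A B : set X1) (t : R) : \bar R :=
  (\int[mu1]_(x in A) \int[mu1]_(y in B) (line_kernel t x y)%:E)%E.

Lemma line_kernel_ge0 t a b : 0 <= line_kernel t a b.
Proof. by rewrite mulr_ge0 ?powR_ge0 ?expR_ge0. Qed.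

Lemma heat_kernel_factor (x y : space3 R) (t : R) : 0 < t ->
  heat_kernel x y t =
  line_kernel t x.1.1 y.1.1 * line_kernel t x.1.2 y.1.2 * line_kernel t x.2 y.2.
Proof.
move=> t0; rewrite /heat_kernel /line_kernel /dot/=.
have -> : - (3 / 2) = - (1 / 2) + - (1 / 2) + - (1 / 2) :> R by field.
have c0 : 4 * pi * t != 0 by rewrite !mulf_neq0 ?gt_eqF ?pi_gt0.
rewrite !powRD ?c0 ?implybT//.
have -> (a b c : R) : - ((a * a + b * b + c * c) / (4 * t)) =
  - (a ^+ 2 / (4 * t)) + - (b ^+ 2 / (4 * t)) + - (c ^+ 2 / (4 * t)).
  by field; rewrite gt_eqF.
by rewrite !expRD; ring.
Qed.

Lemma measurable_line_kernel t :
  measurable_fun setT (fun z : X1 * X1 => (line_kernel t z.1 z.2)%:E).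
Proof.
apply/measurable_EFinP.
apply: (measurable_funM (f := cst _)); first exact: measurable_cst.
apply: (measurableT_comp (f := expR)); first exact: measurable_expR.
apply: measurable_funN.
apply: (measurable_funM (g := cst _)); last exact: measurable_cst.
apply: measurable_funX; apply: measurable_funB; first exact: measurable_fst.
exact: measurable_snd.
Qed.

Lemma measurable_line_kernelr t a :
  measurable_fun setT (fun b : X1 => (line_kernel t a b)%:E).
Proof. exact: (measurable_fun_pair2 a (measurable_line_kernel t)). Qed.

Lemma measurable_line_exchange t (B : set X1) : measurable B ->
  measurable_fun setT (fun x : X1 => \int[mu1]_(y in B) (line_kernel t x y)%:E)%E.
Proof.
move=> mB.
pose f (z : X1 * X1) : \bar R := ((line_kernel t z.1 z.2)%:E * (\1_B z.2)%:E)%E.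
have mI : measurable_fun setT (\1_B : X1 -> X1) by exact: measurable_indic.
have mf : measurable_fun setT f.
  apply: emeasurable_funM; first exact: measurable_line_kernel.
  by apply/measurable_EFinP; exact: (measurableT_comp mI (@measurable_snd _ _ X1 X1)).
have f0 z : (0 <= f z)%E.
  by rewrite /f -EFinM lee_fin mulr_ge0// line_kernel_ge0.
have := measurable_fun_fubini_tonelli_F (m2 := mu1) f mf f0.
apply: eq_measurable_fun => x _.
rewrite /fubini_F [RHS]integral_mkcond; apply: eq_integral => y _.
rewrite /f patchE indicE; case: ifPn => _; first by rewrite mule1.
by rewrite mule0.
Qed.

Lemma integral_product3 (A1 A2 A3 : set X1) (f1 f2 f3 : X1 -> \bar R) :
  measurable A1 -> measurable A2 -> measurable A3 ->
  measurable_fun setT f1 -> measurable_fun setT f2 -> measurable_fun setT f3 ->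
  (forall x, 0 <= f1 x)%E -> (forall x, 0 <= f2 x)%E -> (forall x, 0 <= f3 x)%E ->
  (\int[mu3]_(z in A1 `*` A2 `*` A3) (f1 z.1.1 * f2 z.1.2 * f3 z.2) =
   (\int[mu1]_(x in A1) f1 x) * (\int[mu1]_(x in A2) f2 x) *
   (\int[mu1]_(x in A3) f3 x))%E.
Proof.
move=> mA1 mA2 mA3 mf1 mf2 mf3 f1_ge0 f2_ge0 f3_ge0.
rewrite -(integral_product mu1 mu1)//.
rewrite -(integral_product area mu1 (f1 := fun z => f1 z.1 * f2 z.2)%E)//.
- exact: measurableX.
- apply: emeasurable_funM.
    exact: (measurableT_comp mf1 (@measurable_fst _ _ X1 X1)).
  exact: (measurableT_comp mf2 (@measurable_snd _ _ X1 X1)).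
- by move=> z; rewrite mule_ge0.
Qed.

(** The Gaussian kernel is a product over the axes, so that boxes reduce to
    intervals. *)
Lemma exchange_product (A1 A2 A3 B1 B2 B3 : set X1) (t : R) : 0 < t ->
  measurable A1 -> measurable A2 -> measurable A3 ->
  measurable B1 -> measurable B2 -> measurable B3 ->
  exchange (A1 `*` A2 `*` A3) (B1 `*` B2 `*` B3) t =
  (line_exchange A1 B1 t * line_exchange A2 B2 t * line_exchange A3 B3 t)%E.
Proof.
move=> t0 mA1 mA2 mA3 mB1 mB2 mB3.
have int_ge0 (B : set X1) (x : X1) : (0 <= \int[mu1]_(y in B) (line_kernel t x y)%:E)%E.
  by apply: integral_ge0 => y _; rewrite lee_fin line_kernel_ge0.
rewrite /line_exchange -integral_product3//; try exact: measurable_line_exchange.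
apply: eq_integral => x _.
rewrite -integral_product3//; try exact: measurable_line_kernelr;
  try by move=> y; rewrite lee_fin line_kernel_ge0.
by apply: eq_integral => y _; rewrite heat_kernel_factor// !EFinM.
Qed.

End BoxExchange.

(** * Gaussian tails *)

Section GaussianTails.
Context {R : realType}.
Local Notation mu1 := (@lebesgue_measure R).

Definition gaussF (x : R) : R := (\int[mu1]_(u in `]-oo, x]) gauss_fun u)%R.

Lemma integrable_gauss (A : set R) : measurable A -> mu1.-integrable A (EFin \o gauss_fun).
Proof. by move=> mA; apply: integrableS integrableT_gauss. Qed.

Lemma gaussF_derive (x : R) : is_derive x 1 gaussF (gauss_fun x).
Proof.
have x1 : x < x + 1 by rewrite ltrDl.
have [dF dFE] := @continuous_FTC1 R gauss_fun -oo%O x (x + 1) x1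
  (integrable_gauss (measurable_itv _)) (ltNyr x) (@continuous_gauss_fun R x).
apply: DeriveDef; first exact: dF.
by rewrite -derive1E; exact: dFE.
Qed.

Lemma gaussFE (x : R) : (gaussF x)%:E = (\int[mu1]_(u in `]-oo, x]) (gauss_fun u)%:E)%E.
Proof.
rewrite /gaussF /Rintegral fineK//.
by apply: integrable_fin_num => //; exact: integrable_gauss.
Qed.

(** On the tail u / x is at least 1, and u exp (- u^2) has an elementary
    antiderivative. *)
Lemma gauss_upper_tail (x : R) : 0 < x ->
  (\int[mu1]_(u in `[x, +oo[) (gauss_fun u)%:E <= (expR (- x ^+ 2) / (2 * x))%:E)%E.
Proof.
move=> x0.
pose f u : R := x^-1 * (u * gauss_fun u).
pose F u : R := - (2 * x)^-1 * gauss_fun u.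
have cf : continuous f.
  move=> u; apply: cvgM; first exact: cvg_cst.
  by apply: cvgM; [exact: cvg_id|exact: continuous_gauss_fun].
have dF (u : R) : is_derive u 1 F (f u).
  rewrite /F /f /gauss_fun.
  apply: is_derive_eq.
  rewrite /GRing.scale/=.
  by field; rewrite gt_eqF.
have cF : continuous F.
  by move=> u; apply: cvgM; [exact: cvg_cst|exact: continuous_gauss_fun].
have <- : (\int[mu1]_(u in `[x, +oo[) (f u)%:E)%E = (expR (- x ^+ 2) / (2 * x))%:E.
  rewrite (@ge0_continuous_FTC2y R f F x 0).
  - rewrite /F /gauss_fun -EFinB; congr EFin; ring.
  - move=> u xu; rewrite /f !mulr_ge0 ?invr_ge0 ?gauss_fun_ge0 ?(ltW x0)//.
    exact: le_trans (ltW x0) xu.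
  - by apply: continuous_subspaceT.
  - rewrite -[X in _ --> X](mulr0 (- (2 * x)^-1)).
    by apply: cvgM; [exact: cvg_cst|exact: cvg_gauss_fun].
  - by move=> u _; have [] := dF u.
  - exact/cvg_at_right_filter/cF.
  - by move=> u _; rewrite derive1E; have [] := dF u.
apply: ge0_le_integral => //.
- by move=> u _; rewrite lee_fin gauss_fun_ge0.
- by apply: measurable_funTS; apply/measurable_EFinP; exact: measurable_gauss_fun.
- apply: measurable_funTS; apply/measurable_EFinP.
  exact: continuous_measurable_fun.
- move=> u /=; rewrite in_itv/= andbT => xu; rewrite lee_fin /f mulrA.
  by rewrite ler_peMl ?gauss_fun_ge0// mulrC ler_pdivlMr// mul1r.
Qed.

Lemma gaussF_pos (x : R) : 0 < x ->
  `|Num.sqrt pi - gaussF x| <= expR (- x ^+ 2) / (2 * x).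
Proof.
move=> x0.
have H : (Num.sqrt pi)%:E = ((gaussF x)%:E +
    \int[mu1]_(u in `[x, +oo[) (gauss_fun u)%:E)%E :> \bar R.
  rewrite -integralT_gauss gaussFE.
  have -> : [set: R] = `]-oo, x]%classic `|` `]x, +oo[%classic.
    by apply/seteqP; split => u //= _; rewrite !in_itv/= andbT; case: (leP u x); [left|right].
  rewrite ge0_integral_setU//.
  - congr (_ + _)%E; rewrite integral_itv_obnd_cbnd//.
    by apply: measurable_funTS; apply/measurable_EFinP; exact: measurable_gauss_fun.
  - by apply: measurable_funTS; apply/measurable_EFinP; exact: measurable_gauss_fun.
  - by move=> u _; rewrite lee_fin gauss_fun_ge0.
  - apply/disj_set2P/seteqP; split => u //= [].
    by rewrite !in_itv/= andbT => /le_lt_trans /[apply]; rewrite ltxx.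
have Q0 : (0 <= \int[mu1]_(u in `[x, +oo[) (gauss_fun u)%:E)%E.
  by apply: integral_ge0 => u _; rewrite lee_fin gauss_fun_ge0.
have := gauss_upper_tail x0.
move: Q0 H; case: (\int[mu1]_(u in `[x, +oo[) (gauss_fun u)%:E)%E => // q.
by rewrite !lee_fin => q0 -[->] qle; rewrite addrAC subrr add0r ger0_norm.
Qed.

Lemma gaussF_neg (x : R) : 0 < x -> `|gaussF (- x)| <= expR (- x ^+ 2) / (2 * x).
Proof.
move=> x0; rewrite ger0_norm; last first.
  by apply: Rintegral_ge0 => u _; exact: gauss_fun_ge0.
rewrite -lee_fin gaussFE ge0_integration_by_substitutionNy.
- apply: le_trans (gauss_upper_tail x0).
  by under eq_integral do rewrite /= /gauss_fun sqrrN.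
- by apply: continuous_subspaceT; exact: continuous_gauss_fun.
- by move=> u _; exact: gauss_fun_ge0.
Qed.

End GaussianTails.

(** * Exchange of heat between intervals *)

Section LineExchange.
Context {R : realType}.
Local Notation X1 := (measurableTypeR R).
Local Notation mu1 := (@lebesgue_measure R).

Lemma integral_oo_derivative (f F : R -> R) (a b : R) : a < b ->
  (forall x : R, is_derive x 1 F (f x)) -> continuous f ->
  (\int[mu1]_(x in `]a, b[) (f x)%:E = (F b - F a)%:E)%E.
Proof.
move=> ab dF cf.
have cF : continuous F.
  move=> x; apply/differentiable_continuous/derivable1_diffP.
  by have [] := dF x.
rewrite -(@integral_itv_bndoo R a b (EFin \o f) true false).
  rewrite (@continuous_FTC2 R f F a b)//.
  - exact: continuous_subspaceT.
  - split.
    + by move=> x _; have [] := dF x.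
    + exact/cvg_at_right_filter/cF.
    + exact/cvg_at_left_filter/cF.
  - by move=> x _; rewrite derive1E; have [] := dF x.
apply: measurable_funTS; apply/measurable_EFinP.
exact: continuous_measurable_fun.
Qed.

(** Two successive antiderivatives of the heat kernel of the line, where c stands for
    2 sqrt t. Their constants of integration make the first one odd and the second
    one vanish at 0. *)
Definition kernel_int (c z : R) : R := (Num.sqrt pi)^-1 * gaussF (z / c) - 2^-1.
Definition kernel_int2 (c z : R) : R :=
  z * kernel_int c z + c / (2 * Num.sqrt pi) * (gauss_fun (z / c) - 1).

Lemma sqrt_pi_gt0 : 0 < Num.sqrt pi :> R.
Proof. by rewrite sqrtr_gt0 pi_gt0. Qed.

Lemma line_kernelE (c a b : R) : 0 < c ->
  line_kernel (c ^+ 2 / 4) a b = (c * Num.sqrt pi)^-1 * gauss_fun ((a - b) / c).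
Proof.
move=> c0; rewrite /line_kernel /gauss_fun; congr (_ * expR (- _)); last first.
  by field; rewrite gt_eqF.
have -> : 4 * pi * (c ^+ 2 / 4) = c ^+ 2 * pi :> R by field.
rewrite powRN powRM ?pi_ge0 ?sqr_ge0// !div1r !powR12_sqrt ?pi_ge0 ?sqr_ge0//.
by rewrite sqrtr_sqr ger0_norm// ltW.
Qed.

Lemma kernel_int_derive (c z : R) : 0 < c ->
  is_derive z 1 (kernel_int c) ((c * Num.sqrt pi)^-1 * gauss_fun (z / c)).
Proof.
move=> c0; have dF := gaussF_derive (z / c).
have d1 : is_derive z 1 (fun z : R => z / c) c^-1.
  have -> : (fun z : R => z / c) = (fun z => c^-1 *: z) by apply/funext => u; rewrite mulrC.
  by apply: is_derive_eq; rewrite /GRing.scale/= mulr1.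
have d2 : is_derive z 1 (gaussF \o (fun z : R => z / c)) (gauss_fun (z / c) * c^-1).
  exact: is_derive1_comp.
rewrite /kernel_int.
have -> : (fun z : R => (Num.sqrt pi)^-1 * gaussF (z / c) - 2^-1) =
  (fun z => (Num.sqrt pi)^-1 *: (gaussF \o (fun z : R => z / c)) z - 2^-1) by [].
apply: is_derive_eq.
rewrite scaler0 subr0 /GRing.scale/= invfM; ring.
Qed.

Lemma gauss_scaled_derive (c z : R) : 0 < c ->
  is_derive z 1 (fun z => gauss_fun (z / c)) (- (2 * z / c ^+ 2) * gauss_fun (z / c)).
Proof.
move=> c0; rewrite /gauss_fun.
have -> : (fun z : R => expR (- (z / c) ^+ 2)) =
    (expR \o (fun z : R => - (c ^- 2) *: z ^+ 2)).
  by apply/funext => u /=; congr expR; rewrite /GRing.scale/=; field; rewrite gt_eqF.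
have d1 : is_derive z 1 (fun z : R => - (c ^- 2) *: z ^+ 2) (- (c^-2) * (2 * z)).
  by apply: is_derive_eq; rewrite /GRing.scale/=; ring.
have := @is_derive1_comp R expR (fun z : R => - (c ^- 2) *: z ^+ 2) z _ _
  (is_derive_expR _) d1.
move=> h; apply: (is_derive_eq h).
rewrite mulrC; congr (_ * expR _); rewrite /GRing.scale/=; field; by rewrite gt_eqF.
Qed.

Lemma kernel_int2_derive (c z : R) : 0 < c ->
  is_derive z 1 (kernel_int2 c) (kernel_int c z).
Proof.
move=> c0; have d1 := kernel_int_derive z c0; have d2 := gauss_scaled_derive z c0.
rewrite /kernel_int2.
apply: is_derive_eq.
rewrite /GRing.scale/=.
by field; rewrite !gt_eqF ?sqrt_pi_gt0.
Qed.

(** The kernel depends on x - y alone, so that integrating it over two intervals gives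
    a second difference of its second antiderivative. *)
Lemma line_exchange_itv (t a b a' b' : R) : 0 < t -> a < b -> a' < b' ->
  let Phi := kernel_int2 (2 * Num.sqrt t) in
  line_exchange `]a, b[%classic `]a', b'[%classic t =
  (Phi (b - a') - Phi (b - b') - (Phi (a - a') - Phi (a - b')))%:E.
Proof.
move=> t0 ab ab' Phi; set c := 2 * Num.sqrt t.
have c0 : 0 < c by rewrite mulr_gt0// sqrtr_gt0.
have -> : t = c ^+ 2 / 4 by rewrite exprMn sqr_sqrtr ?ltW//; field.
rewrite /line_exchange.
have cgauss x : continuous (fun y : R => gauss_fun ((x - y) / c)).
  move=> y; apply: (@continuous_comp _ _ _ (fun y : R => (x - y) / c) gauss_fun).
    apply: cvgM; last exact: cvg_cst.
    by apply: cvgB; [exact: cvg_cst|exact: cvg_id].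
  exact: continuous_gauss_fun.
have cP : continuous (kernel_int c).
  move=> x; apply/differentiable_continuous/derivable1_diffP.
  by have [] := kernel_int_derive x c0.
have dshift (u v : R) (f : R -> R) (df : R) : is_derive (u - v) 1 f df ->
    is_derive u 1 (fun u => f (u - v)) df.
  move=> h; have d1 : is_derive u 1 (fun u : R => u - v) 1.
    by apply: is_derive_eq; rewrite subr0.
  by have := @is_derive1_comp R f (fun u => u - v) u _ _ h d1; rewrite mulr1.
have d_inner (x y : R) : is_derive y 1 (fun y => - kernel_int c (x - y))
    ((c * Num.sqrt pi)^-1 * gauss_fun ((x - y) / c)).
  have d0 := kernel_int_derive (x - y) c0.
  have d1 : is_derive y 1 (fun y : R => x - y) (-1).
    apply: is_derive_eq.
    by rewrite add0r mul1r.
  have d2 := @is_derive1_comp R (kernel_int c) (fun y => x - y) y _ _ d0 d1.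
  have d3 := is_deriveN d2.
  by apply: (is_derive_eq d3); rewrite mulrN1 opprK.
have d_outer (x : R) : is_derive x 1 (fun x => Phi (x - a') - Phi (x - b'))
    (kernel_int c (x - a') - kernel_int c (x - b')).
  have d1 := dshift x a' _ _ (kernel_int2_derive (x - a') c0).
  have d2 := dshift x b' _ _ (kernel_int2_derive (x - b') c0).
  exact: (is_deriveB d1 d2).
have c_inner (x : R) :
    continuous (fun y : R => (c * Num.sqrt pi)^-1 * gauss_fun ((x - y) / c)).
  by move=> y0; apply: cvgM; [exact: cvg_cst|exact: cgauss].
have c_outer : continuous (fun x : R => kernel_int c (x - a') - kernel_int c (x - b')).
  have h v : continuous (fun x : R => kernel_int c (x - v)).
    move=> u; apply: (@continuous_comp _ _ _ (fun x : R => x - v) (kernel_int c)); last exact: cP.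
    by apply: cvgB; [exact: cvg_id|exact: cvg_cst].
  by move=> u; apply: cvgB; exact: h.
rewrite -(integral_oo_derivative ab d_outer c_outer).
apply: eq_integral => x _.
under eq_integral do rewrite line_kernelE//.
rewrite (integral_oo_derivative ab' (d_inner x) (c_inner x)).
by congr EFin; ring.
Qed.

Lemma kernel_int2_0 (c : R) : kernel_int2 c 0 = 0.
Proof. by rewrite /kernel_int2 mul0r add0r mul0r /gauss_fun expr0n/= oppr0 expR0 subrr mulr0. Qed.

Lemma expR_le_inv (u : R) : 0 < u -> expR (- u) <= u^-1.
Proof.
move=> u0; rewrite expRN lef_pV2 ?posrE ?expR_gt0//.
by apply: le_trans (expR_ge1Dx u); rewrite lerDr.
Qed.

Lemma sqrt_pi_ge1 : 1 <= Num.sqrt pi :> R.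
Proof.
rewrite -[leLHS]sqrtr1; apply: ler_wsqrtr.
by have := @pi_ge2 R; lra.
Qed.

(** As c tends to 0 the kernel tends to the point mass at 0, whose even second
    antiderivative is |z| / 2; the constant comes from the normalization at 0. What is
    left is a Gaussian tail, far smaller than the bound. *)
Lemma kernel_int2_asymp (c z : R) : 0 < c -> z != 0 ->
  `|kernel_int2 c z - (`|z| / 2 - c / (2 * Num.sqrt pi))| <= c ^+ 3 / z ^+ 2.
Proof.
move=> c0 z0.
have z2 : 0 < z ^+ 2 by rewrite exprn_even_gt0.
set E := gauss_fun (z / c).
have E_le : E <= c ^+ 2 / z ^+ 2.
  have -> : c ^+ 2 / z ^+ 2 = ((z / c) ^+ 2)^-1 by field; rewrite z0 gt_eqF.
  by apply: expR_le_inv; rewrite exprn_even_gt0// mulf_neq0// invr_neq0 ?gt_eqF.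
have p0 := sqrt_pi_gt0.
have tail : `|z * kernel_int c z - `|z| / 2| <= c / (2 * Num.sqrt pi) * E.
  rewrite /kernel_int; case: (ltgtP z 0) z0 => // [zlt|zgt] _.
    rewrite [`|z|]ltr0_norm//.
    have -> : z * ((Num.sqrt pi)^-1 * gaussF (z / c) - 2^-1) - (- z) / 2 =
       z * (Num.sqrt pi)^-1 * gaussF (z / c) by field; rewrite gt_eqF.
    have z'0 : 0 < (- z) / c by rewrite divr_gt0// oppr_gt0.
    have := gaussF_neg z'0; rewrite mulNr opprK sqrrN => h.
    rewrite !normrM [`|z|]ltr0_norm// gtr0_norm ?invr_gt0//.
    apply: le_trans (ler_wpM2l _ h) _; first by rewrite divr_ge0 ?oppr_ge0 ?ltW.
    rewrite -/(gauss_fun _) -/E le_eqVlt; apply/orP; left; apply/eqP.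
    field.
    by rewrite (gt_eqF p0) (gt_eqF c0) (lt_eqF zlt).
  rewrite [`|z|]gtr0_norm//.
  have -> : z * ((Num.sqrt pi)^-1 * gaussF (z / c) - 2^-1) - z / 2 =
     - (z * (Num.sqrt pi)^-1 * (Num.sqrt pi - gaussF (z / c))) by field; rewrite gt_eqF.
  have z'0 : 0 < z / c by rewrite divr_gt0.
  have := gaussF_pos z'0 => h.
  rewrite normrN !normrM [`|z|]gtr0_norm// [`|_^-1|]gtr0_norm ?invr_gt0//.
  apply: le_trans (ler_wpM2l _ h) _; first by rewrite divr_ge0 ?ltW.
  rewrite -/(gauss_fun _) -/E le_eqVlt; apply/orP; left; apply/eqP.
  by field; rewrite !gt_eqF.
have -> : kernel_int2 c z - (`|z| / 2 - c / (2 * Num.sqrt pi)) =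
   (z * kernel_int c z - `|z| / 2) + c / (2 * Num.sqrt pi) * E.
  by rewrite /kernel_int2 -/E; ring.
apply: le_trans (ler_normD _ _) _.
have cE : 0 <= c / (2 * Num.sqrt pi) * E.
  by rewrite mulr_ge0 ?gauss_fun_ge0 ?divr_ge0 ?mulr_ge0 ?ltW.
rewrite [`|_ * E|]ger0_norm//.
apply: le_trans (lerD tail (lexx _)) _.
have -> : c / (2 * Num.sqrt pi) * E + c / (2 * Num.sqrt pi) * E =
  (c * E) / Num.sqrt pi by field; rewrite gt_eqF.
rewrite ler_pdivrMr//.
have -> : c ^+ 3 / z ^+ 2 * Num.sqrt pi = c * (c ^+ 2 / z ^+ 2) * Num.sqrt pi.
  by ring.
apply: (@le_trans _ _ (c * (c ^+ 2 / z ^+ 2))).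
  by rewrite ler_wpM2l// ltW.
by rewrite ler_peMr ?sqrt_pi_ge1// mulr_ge0 ?divr_ge0 ?sqr_ge0// ltW.
Qed.

End LineExchange.

(** * A cube with itself and with a cube that touches it *)

Section CubeExchange.
Context {R : realType}.
Local Notation X1 := (measurableTypeR R).
Local Notation X3 := (X1 * X1 * X1)%type.
Local Notation mu1 := (@lebesgue_measure R).
Local Notation mu3 := (@lebesgue3 R).

(** The heat lost per unit of area through a flat face. *)
Definition face_loss (t : R) : R := Num.sqrt t / Num.sqrt pi.

(** The size t^(3/2) of the error terms, written without a real exponent. *)
Definition t32 (t : R) : R := t * Num.sqrt t.

(** The second antiderivative of the kernel up to an error of order t^(3/2); it
    vanishes at the origin, which is why endpoints that touch are singled out. *)
Definition kernel_int2_lim (z t : R) : R := `|z| / 2 - (z != 0)%:R * face_loss t.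

Lemma kernel_int2_near (z : R) : exists C : R, 0 <= C /\ forall t, 0 < t ->
  `|kernel_int2 (2 * Num.sqrt t) z - kernel_int2_lim z t| <= C * t32 t.
Proof.
rewrite /kernel_int2_lim; have [->|z0] := eqVneq z 0.
  exists 0; split=> // t t0.
  by rewrite kernel_int2_0 normr0 !mul0r subrr subr0 normr0.
have z2 : 0 < z ^+ 2 by rewrite exprn_even_gt0.
exists (8 / z ^+ 2); split=> [|t t0]; first by rewrite divr_ge0 ?sqr_ge0.
have c0 : 0 < 2 * Num.sqrt t by rewrite mulr_gt0 ?sqrtr_gt0.
have -> : face_loss t = (2 * Num.sqrt t) / (2 * Num.sqrt pi).
  by rewrite /face_loss; field; rewrite gt_eqF// sqrt_pi_gt0.
rewrite mul1r; apply: le_trans (kernel_int2_asymp c0 z0) _.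
have -> : (2 * Num.sqrt t) ^+ 3 = 8 * (Num.sqrt t ^+ 2 * Num.sqrt t) by ring.
rewrite sqr_sqrtr ?(ltW t0)// /t32 le_eqVlt; apply/orP; left; apply/eqP.
by ring.
Qed.

Lemma line_exchange_near (a b a' b' : R) : a < b -> a' < b' ->
  exists C : R, 0 <= C /\ forall t, 0 < t -> exists v,
    line_exchange `]a, b[%classic `]a', b'[%classic t = v%:E /\
    `|v - (kernel_int2_lim (b - a') t - kernel_int2_lim (b - b') t -
           (kernel_int2_lim (a - a') t - kernel_int2_lim (a - b') t))| <= C * t32 t.
Proof.
move=> ab ab'.
have [C1 [C10 H1]] := kernel_int2_near (b - a').
have [C2 [C20 H2]] := kernel_int2_near (b - b').
have [C3 [C30 H3]] := kernel_int2_near (a - a').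
have [C4 [C40 H4]] := kernel_int2_near (a - b').
exists (C1 + C2 + C3 + C4); split=> [|t t0]; first by rewrite !addr_ge0.
eexists; split; first exact: line_exchange_itv.
have := H1 t t0; have := H2 t t0; have := H3 t t0; have := H4 t t0.
rewrite !ler_norml => /andP[? ?] /andP[? ?] /andP[? ?] /andP[? ?].
by apply/andP; split; lra.
Qed.

Definition unit_itv : set X1 := `](- 2^-1), 2^-1[%classic.
Definition centred_itv (s : R) : set X1 := `](- (s / 2)), (s / 2)[%classic.
(** As in the names of the faces, side is true for the negative direction. *)
Definition next_itv (s : R) (side : bool) : set X1 :=
  if side then `](- 2^-1 - s), (- 2^-1)[%classic else `]2^-1, (2^-1 + s)[%classic.

Lemma line_exchange_self : exists C : R, 0 <= C /\ forall t, 0 < t -> exists v,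
  line_exchange unit_itv unit_itv t = v%:E /\
  `|v - (1 - 2 * face_loss t)| <= C * t32 t.
Proof.
have h : - 2^-1 < 2^-1 :> R by lra.
have [C [C0 HC]] := line_exchange_near h h.
exists C; split=> // t t0; have [v [-> Hv]] := HC t t0.
exists v; split=> //; apply: le_trans Hv; rewrite le_eqVlt; apply/orP; left; apply/eqP.
congr `|_ - _|; rewrite /kernel_int2_lim.
rewrite !subrr eqxx opprK normr0.
have -> : 2^-1 + 2^-1 = 1 :> R by field.
have -> : - 2^-1 - 2^-1 = - 1 :> R by field.
by rewrite normrN normr1 oppr_eq0 oner_eq0 /=; field.
Qed.

Lemma line_exchange_next (s : R) (side : bool) : 0 < s ->
  exists C : R, 0 <= C /\ forall t, 0 < t -> exists v,
  line_exchange unit_itv (next_itv s side) t = v%:E /\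
  `|v - face_loss t| <= C * t32 t.
Proof.
move=> s0.
have h : - 2^-1 < 2^-1 :> R by lra.
have s1 : 1 + s != 0 by rewrite gt_eqF//; lra.
have n1 : `|1 + s| = 1 + s by rewrite gtr0_norm//; lra.
case: side.
  have h' : - 2^-1 - s < - 2^-1 by lra.
  have [C [C0 HC]] := line_exchange_near h h'.
  exists C; split=> // t t0; have [v [-> Hv]] := HC t t0.
  exists v; split=> //; apply: le_trans Hv; rewrite le_eqVlt; apply/orP; left; apply/eqP.
  congr `|_ - _|; rewrite /kernel_int2_lim.
  have -> : 2^-1 - (- 2^-1 - s) = 1 + s by field.
  have -> : 2^-1 - - 2^-1 = 1 :> R by field.
  have -> : - 2^-1 - (- 2^-1 - s) = s by ring.
  by rewrite subrr eqxx normr0 n1 s1 normr1 oner_eq0 (gtr0_norm s0) (gt_eqF s0)/=; field.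
have h' : 2^-1 < 2^-1 + s by lra.
have [C [C0 HC]] := line_exchange_near h h'.
exists C; split=> // t t0; have [v [-> Hv]] := HC t t0.
exists v; split=> //; apply: le_trans Hv; rewrite le_eqVlt; apply/orP; left; apply/eqP.
congr `|_ - _|; rewrite /kernel_int2_lim.
have -> : 2^-1 - (2^-1 + s) = - s by ring.
have -> : - 2^-1 - 2^-1 = - 1 :> R by field.
have -> : - 2^-1 - (2^-1 + s) = - (1 + s) by field.
rewrite subrr eqxx normr0 !normrN !oppr_eq0 n1 s1 normr1 oner_eq0 (gtr0_norm s0).
by rewrite (gt_eqF s0)/=; field.
Qed.

Lemma line_exchange_lateral (s : R) : 0 < s -> s < 1 ->
  exists C : R, 0 <= C /\ forall t, 0 < t -> exists v,
  line_exchange unit_itv (centred_itv s) t = v%:E /\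
  `|v - s| <= C * t32 t.
Proof.
move=> s0 s_lt1.
have h : - 2^-1 < 2^-1 :> R by lra.
have h' : - (s / 2) < s / 2 by lra.
have [C [C0 HC]] := line_exchange_near h h'.
exists C; split=> // t t0; have [v [-> Hv]] := HC t t0.
exists v; split=> //; apply: le_trans Hv; rewrite le_eqVlt; apply/orP; left; apply/eqP.
congr `|_ - _|; rewrite /kernel_int2_lim.
have p0 : 0 < (1 + s) / 2 by lra.
have m0 : 0 < (1 - s) / 2 by lra.
have -> : 2^-1 - (- (s / 2)) = (1 + s) / 2 by field.
have -> : 2^-1 - s / 2 = (1 - s) / 2 by field.
have -> : - 2^-1 - (- (s / 2)) = - ((1 - s) / 2) by field.
have -> : - 2^-1 - s / 2 = - ((1 + s) / 2) by field.
rewrite !normrN !oppr_eq0 (gtr0_norm p0) (gtr0_norm m0) (gt_eqF p0) (gt_eqF m0)/=.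
by field.
Qed.

Lemma mul3_near (C M eps x y z x0 y0 z0 : R) :
  0 <= C -> 0 <= M -> 0 <= eps <= 1 ->
  `|x0| <= M -> `|y0| <= M -> `|z0| <= M ->
  `|x - x0| <= C * eps -> `|y - y0| <= C * eps -> `|z - z0| <= C * eps ->
  `|x * y * z - x0 * y0 * z0| <= 3 * (M + C) ^+ 2 * C * eps.
Proof.
move=> C0 M0 /andP[e0 e1] hx0 hy0 hz0 hx hy hz.
have big (u u0 : R) : `|u0| <= M -> `|u - u0| <= C * eps -> `|u| <= M + C.
  move=> h1 h2; rewrite -(subrK u0 u) addrC.
  apply: le_trans (ler_normD _ _) (lerD h1 (le_trans h2 _)).
  by rewrite ler_piMr.
have Hx := big _ _ hx0 hx; have Hy := big _ _ hy0 hy.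
have Hy0 : `|y0| <= M + C by rewrite (le_trans hy0)// lerDl.
have Hz0 : `|z0| <= M + C by rewrite (le_trans hz0)// lerDl.
have -> : x * y * z - x0 * y0 * z0 =
  x * y * (z - z0) + x * z0 * (y - y0) + y0 * z0 * (x - x0) by ring.
have prod (u v w : R) : `|u| <= M + C -> `|v| <= M + C -> `|w| <= C * eps ->
    `|u * v * w| <= (M + C) ^+ 2 * (C * eps).
  by move=> hu hv hw; rewrite !normrM expr2 !ler_pM// mulr_ge0.
have -> : 3 * (M + C) ^+ 2 * C * eps = (M + C) ^+ 2 * (C * eps) +
   (M + C) ^+ 2 * (C * eps) + (M + C) ^+ 2 * (C * eps) by ring.
apply: le_trans (ler_normD _ _) (lerD (le_trans (ler_normD _ _) (lerD _ _)) _);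
exact: prod.
Qed.

Lemma t32_bound (t : R) : 0 < t -> t <= 1 -> 0 <= t32 t <= 1.
Proof.
move=> t0 t1; rewrite /t32 mulr_ge0 ?(ltW t0) ?sqrtr_ge0//=.
rewrite mulr_ile1 ?(ltW t0) ?sqrtr_ge0//.
by rewrite -[leRHS]sqrtr1 ler_wsqrtr.
Qed.

Lemma face_loss_bound (t : R) : 0 < t -> t <= 1 -> 0 <= face_loss t <= 1.
Proof.
move=> t0 t1; rewrite /face_loss divr_ge0 ?sqrtr_ge0//=.
rewrite ler_pdivrMr ?sqrt_pi_gt0// mul1r (le_trans _ sqrt_pi_ge1)//.
by rewrite -[leRHS]sqrtr1 ler_wsqrtr.
Qed.

(** The cube of 1 - 2 l, where l = face_loss t, is 1 - 6 l + 12 l^2 - 8 l^3 with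
    l^2 = t / pi. The three powers of l belong to the faces, the edges and the corners
    of the cube, and the corners are as small as the error. *)
Lemma cube_self_exchange :
  exists C : R, 0 <= C /\ forall t, 0 < t -> t <= 1 -> exists v,
  (line_exchange unit_itv unit_itv t *
   line_exchange unit_itv unit_itv t *
   line_exchange unit_itv unit_itv t = v%:E)%E /\
  `|v - (1 - 6 * face_loss t + 12 / pi * t)| <= C * t32 t.
Proof.
have [C [C0 HC]] := line_exchange_self.
exists (3 * (1 + C) ^+ 2 * C + 8); split=> [|t t0 t1].
  apply: addr_ge0 => //; by rewrite !mulr_ge0 ?addr_ge0.
have [v [-> Hv]] := HC t t0.
exists (v * v * v); split=> //.
have /andP[r0 r1] := face_loss_bound t0 t1; set r := face_loss t in Hv r0 r1 *.
have n1 : `|1 - 2 * r| <= 1 by rewrite ler_norml; apply/andP; split; lra.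
have := mul3_near C0 ler01 (t32_bound t0 t1) n1 n1 n1 Hv Hv Hv.
have r2 : r ^+ 2 = t / pi.
  by rewrite /r /face_loss expr_div_n !sqr_sqrtr ?pi_ge0// ltW.
have r3 : 0 <= r ^+ 3 <= t32 t.
  rewrite exprn_ge0//= /r /face_loss /t32 expr_div_n exprS sqr_sqrtr ?(ltW t0)//.
  rewrite [Num.sqrt t * t]mulrC ler_pdivrMr ?exprn_gt0 ?sqrt_pi_gt0//.
  by rewrite ler_peMr ?exprn_ege1 ?sqrt_pi_ge1// mulr_ge0 ?sqrtr_ge0// ltW.
have -> : 12 / pi * t = 12 * r ^+ 2 by rewrite r2; ring.
move: r3 => /andP[r30 r31].
rewrite !ler_norml => /andP[h1 h2]; apply/andP; split; lra.
Qed.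

(** Through the common face the intervals exchange face_loss t. In the two lateral
    directions the short interval lies inside the unit interval, and its endpoints
    stay away from those of the unit interval: up to the error it loses nothing. *)
Lemma cube_next_exchange (s : R) (side : bool) : 0 < s -> s < 1 ->
  exists C : R, 0 <= C /\ forall t, 0 < t -> t <= 1 -> exists v,
  (line_exchange unit_itv (next_itv s side) t *
   line_exchange unit_itv (centred_itv s) t *
   line_exchange unit_itv (centred_itv s) t = v%:E)%E /\
  `|v - s ^+ 2 * face_loss t| <= C * t32 t.
Proof.
move=> s0 s1.
have [C1 [C10 HC1]] := line_exchange_next side s0.
have [C2 [C20 HC2]] := line_exchange_lateral s0 s1.
pose C := C1 + C2; have C0 : 0 <= C by rewrite addr_ge0.
exists (3 * (1 + C) ^+ 2 * C); split=> [|t t0 t1].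
  by rewrite !mulr_ge0 ?addr_ge0.
have [v [-> Hv]] := HC1 t t0; have [w [-> Hw]] := HC2 t t0.
exists (v * w * w); split=> //.
have e01 := t32_bound t0 t1; have /andP[e0 _] := e01.
have {}Hv : `|v - face_loss t| <= C * t32 t.
  by apply: le_trans Hv _; rewrite ler_wpM2r// lerDl.
have {}Hw : `|w - s| <= C * t32 t.
  by apply: le_trans Hw _; rewrite ler_wpM2r// lerDr.
have /andP[r0 r1] := face_loss_bound t0 t1.
have n1 : `|face_loss t| <= 1 by rewrite ger0_norm.
have n2 : `|s| <= 1 by rewrite gtr0_norm// ltW.
have := mul3_near C0 ler01 e01 n1 n2 n2 Hv Hw Hw.
by have -> : face_loss t * s * s = s ^+ 2 * face_loss t by ring.
Qed.

End CubeExchange.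

(** * Distant sets and continuity in time *)

Section ExchangeBounds.
Context {R : realType}.
Local Notation X1 := (measurableTypeR R).
Local Notation X3 := (X1 * X1 * X1)%type.
Local Notation mu3 := (@lebesgue3 R).
Implicit Types (A B : set X3) (t : R).

Lemma exchange_le_affine A B t t' (k b : R) :
  measurable A -> measurable B -> 0 <= k -> 0 <= b ->
  (forall x y, heat_kernel x y t <= k * heat_kernel x y t' + b) ->
  (exchange A B t <= k%:E * exchange A B t' + b%:E * mu3 A * mu3 B)%E.
Proof.
move=> mA mB k0 b0 le_k.
pose g x := (\int[mu3]_(y in B) (heat_kernel x y t')%:E)%E.
have mg : measurable_fun setT g by exact: measurable_exchange.
have g0 x : (0 <= g x)%E by apply: integral_ge0 => y _; rewrite lee_fin heat_kernel_ge0.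
have inner x : (\int[mu3]_(y in B) (heat_kernel x y t)%:E <= k%:E * g x + b%:E * mu3 B)%E.
  have mk := measurable_funTS (D := B) (measurable_heat_kernelr x t').
  have mk' : measurable_fun B (fun y => k%:E * (heat_kernel x y t')%:E)%E.
    exact: measurable_funeM.
  rewrite /g -ge0_integralZl//; last by move=> y _; rewrite lee_fin heat_kernel_ge0.
  rewrite -(integral_cst mu3 mB b%:E) -ge0_integralD//; last first.
    by move=> y _; rewrite -EFinM lee_fin mulr_ge0// heat_kernel_ge0.
  apply: ge0_le_integral => //.
  - by move=> y _; rewrite lee_fin heat_kernel_ge0.
  - by apply: measurable_funTS; exact: measurable_heat_kernelr.
  - by apply: emeasurable_funD => //; exact: measurable_cst.
  - by move=> y _; rewrite -EFinM -EFinD lee_fin.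
have mgA := measurable_funTS (D := A) mg.
have mgA' : measurable_fun A (fun x => k%:E * g x)%E by exact: measurable_funeM.
have cst0 : (0 <= b%:E * mu3 B)%E by rewrite mule_ge0.
rewrite /exchange -/g -ge0_integralZl//; last by move=> x _; exact: g0.
have -> : (b%:E * mu3 A * mu3 B = b%:E * mu3 B * mu3 A)%E by rewrite muleAC.
rewrite -(integral_cst mu3 mA (b%:E * mu3 B)) -ge0_integralD//; last first.
  by move=> x _; apply: mule_ge0 => //; exact: g0.
apply: (ge0_le_integral mu3 mA); last by move=> x _; exact: inner.
- by move=> x _; apply: integral_ge0 => y _; rewrite lee_fin heat_kernel_ge0.
- by apply: measurable_funTS; exact: measurable_exchange.
- by apply: emeasurable_funD; [exact: mgA'|exact: measurable_cst].
Qed.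

Lemma exchange_fin A B t : 0 <= t -> measurable A -> measurable B ->
  (mu3 A < +oo)%E -> (mu3 B < +oo)%E -> exchange A B t \is a fin_num.
Proof.
move=> t0 mA mB fA fB; rewrite ge0_fin_numE ?exchange_ge0//.
apply: le_lt_trans (le_exchange mA mB (powR_ge0 _ _) (fun x y _ _ => heat_kernel_le x y t0)) _.
by rewrite -[mu3 A]fineK ?ge0_fin_numE// -[mu3 B]fineK ?ge0_fin_numE// -!EFinM ltry.
Qed.

Opaque exchange.

(** Heat hardly reaches a positive distance: the Gaussian factor beats every
    power of t. *)
Lemma heat_kernel_far (delta : R) : 0 < delta ->
  exists C : R, 0 <= C /\ forall (x y : X3) t, 0 < t ->
    delta ^+ 2 <= dot (x - y) (x - y) -> heat_kernel x y t <= C * t32 t.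
Proof.
move=> d0; have d2 : 0 < delta ^+ 2 by rewrite exprn_gt0.
exists ((12 / delta ^+ 2) ^+ 3); split=> [|x y t t0 far].
  by rewrite exprn_ge0// divr_ge0// ltW.
have pow : (4 * pi * t) `^ (- (3 / 2)) <= (t * Num.sqrt t)^-1.
  have -> : (t * Num.sqrt t)^-1 = t `^ (- (3 / 2)).
    rewrite powRN; congr (_^-1).
    have -> : 3 / 2 = 1 + 2^-1 :> R by field.
    by rewrite powRD ?(gt_eqF t0) ?implybT// powRr1 ?(ltW t0)// powR12_sqrt ?ltW.
  rewrite !powRN lef_pV2 ?posrE ?powR_gt0 ?mulr_gt0 ?pi_gt0//.
  apply: ge0_ler_powR; rewrite ?nnegrE ?(ltW t0) ?mulr_ge0 ?pi_ge0 ?(ltW t0)//.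
  by rewrite ler_peMl ?(ltW t0)//; have := @pi_ge2 R; lra.
pose u := delta ^+ 2 / (4 * t).
have u0 : 0 < u by rewrite divr_gt0// mulr_gt0.
have ex : expR (- (dot (x - y) (x - y) / (4 * t))) <= 27 / u ^+ 3.
  apply: (@le_trans _ _ (expR (- u))).
    by rewrite ler_expR lerN2 ler_pM2r// invr_gt0 mulr_gt0.
  have -> : - u = - (u / 3) + - (u / 3) + - (u / 3) by field.
  rewrite !expRD.
  have h : expR (- (u / 3)) <= 3 / u.
    have u3 : 0 < u / 3 by rewrite divr_gt0.
    by have := expR_le_inv u3; rewrite invf_div.
  have -> : 27 / u ^+ 3 = 3 / u * (3 / u) * (3 / u) by field; rewrite gt_eqF.
  by rewrite !ler_pM ?mulr_ge0 ?expR_ge0.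
apply: (@le_trans _ _ ((t * Num.sqrt t)^-1 * (27 / u ^+ 3))).
  by rewrite ler_pM ?powR_ge0 ?expR_ge0.
rewrite /u /t32 le_eqVlt; apply/orP; left; apply/eqP.
have st : 0 < Num.sqrt t by rewrite sqrtr_gt0.
have E : t = Num.sqrt t ^+ 2 by rewrite sqr_sqrtr// ltW.
move: (Num.sqrt t) st E => r r0 E.
by rewrite E; field; rewrite !gt_eqF.
Qed.

Definition rexchange A B t : R := fine (exchange A B t).

(** Up to a constant, t^(3/2) times the exchange is an integral of exp (- q / t). The
    increase of this function of t is controlled because u exp (- u) is at most 1. *)
Lemma exp_time (q t t' : R) : 0 <= q -> 0 < t -> t <= t' ->
  expR (- (q / t)) <= expR (- (q / t')) <= expR (- (q / t)) + (t' - t) / t.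
Proof.
move=> q0 t0 tt'; have t'0 : 0 < t' by apply: lt_le_trans tt'.
apply/andP; split.
  by rewrite ler_expR lerN2 ler_wpM2l// lef_pV2.
pose u := q / t'; pose k := (t' - t) / t.
have u0 : 0 <= u by rewrite divr_ge0// ltW.
have k0 : 0 <= k by rewrite divr_ge0 ?subr_ge0// ltW.
have -> : - (q / t) = - u + - (u * k) by rewrite /u /k; field; rewrite !gt_eqF.
rewrite expRD -/u -/k.
have h1 : 1 - u * k <= expR (- (u * k)) by exact: expR_ge1Dx.
have h2 : expR (- u) * u <= 1.
  rewrite expRN mulrC ler_pdivrMr ?expR_gt0// mul1r.
  by apply: le_trans (expR_ge1Dx u); rewrite lerDr.
have h3 : expR (- u) * (1 - u * k) <= expR (- u) * expR (- (u * k)).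
  by rewrite ler_wpM2l ?expR_ge0.
have h4 : expR (- u) * u * k <= k by rewrite -[leRHS]mul1r ler_wpM2r.
have E : expR (- u) = expR (- u) * (1 - u * k) + expR (- u) * u * k by ring.
by rewrite [leLHS]E lerD.
Qed.

(** By exp_time the function J below, which is t^(3/2) times the exchange up to a
    constant, is Lipschitz near every positive time. *)
Lemma rexchange_continuous A B : measurable A -> measurable B ->
  (mu3 A < +oo)%E -> (mu3 B < +oo)%E ->
  forall t, 0 < t -> {for t, continuous (rexchange A B)}.
Proof.
move=> mA mB fA fB t0 t0_gt0.
pose a t : R := 4 * pi * t * Num.sqrt (4 * pi * t).
have a_gt0 t : 0 < t -> 0 < a t.
  move=> t_gt0; have h : 0 < 4 * pi * t by rewrite !mulr_gt0// pi_gt0.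
  by rewrite mulr_gt0// sqrtr_gt0.
pose J t := a t * rexchange A B t.
pose M := fine (mu3 A) * fine (mu3 B).
have M0 : 0 <= M by rewrite mulr_ge0 ?fine_ge0.
have rexE t : 0 < t -> exchange A B t = (rexchange A B t)%:E.
  by move=> t_gt0; rewrite fineK// exchange_fin ?ltW.
have kerE x y t : 0 < t ->
    heat_kernel x y t = (a t)^-1 * expR (- (dot (x - y) (x - y) / 4 / t)).
  move=> t_gt0; rewrite /heat_kernel; congr (_ * expR (- _)); last first.
    by field; rewrite gt_eqF.
  have h : 0 < 4 * pi * t by rewrite !mulr_gt0// pi_gt0.
  have -> : - (3 / 2) = - (1 + 2^-1) :> R by field.
  by rewrite powRN powRD ?(gt_eqF h) ?implybT// powRr1 ?(ltW h)// powR12_sqrt ?ltW.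
have q0 (x y : X3) : 0 <= dot (x - y) (x - y) / 4.
  by rewrite divr_ge0// /dot -!expr2 !addr_ge0 ?sqr_ge0.
have Jbound t t' : 0 < t -> t <= t' -> J t <= J t' <= J t + M * ((t' - t) / t).
  move=> t_gt0 tt'; have t'_gt0 : 0 < t' by apply: lt_le_trans tt'.
  have at0 := a_gt0 _ t_gt0; have at'0 := a_gt0 _ t'_gt0.
  apply/andP; split.
    have := @exchange_le_affine A B t t' (a t' / a t) 0 mA mB.
    rewrite (rexE _ t_gt0) (rexE _ t'_gt0) !mul0e adde0 -EFinM lee_fin => h.
    rewrite /J mulrC -ler_pdivlMr// mulrAC; apply: h => //.
      by rewrite divr_ge0 ?ltW.
    move=> x y; rewrite !kerE// addr0.
    have -> (E : R) : a t' / a t * ((a t')^-1 * E) = (a t)^-1 * E.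
      by field; rewrite !gt_eqF.
    by rewrite ler_wpM2l ?invr_ge0 ?(ltW at0)//; case/andP: (exp_time (q0 x y) t_gt0 tt').
  have := @exchange_le_affine A B t' t (a t / a t') ((a t')^-1 * ((t' - t) / t)) mA mB.
  rewrite (rexE _ t_gt0) (rexE _ t'_gt0) -EFinM.
  rewrite -[mu3 A]fineK ?ge0_fin_numE// -[mu3 B]fineK ?ge0_fin_numE//.
  rewrite -!EFinM -EFinD lee_fin => h.
  rewrite /J mulrC -ler_pdivlMr//.
  have -> : (a t * rexchange A B t + M * ((t' - t) / t)) / a t' =
    a t / a t' * rexchange A B t + (a t')^-1 * ((t' - t) / t) * fine (mu3 A) * fine (mu3 B).
    by rewrite /M; ring.
  apply: h.
  - by rewrite divr_ge0 ?ltW.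
  - by rewrite mulr_ge0 ?invr_ge0 ?(ltW at'0)// divr_ge0 ?subr_ge0// ltW.
  - move=> x y; rewrite !kerE//.
    have -> (E : R) : a t / a t' * ((a t)^-1 * E) = (a t')^-1 * E.
      by field; rewrite !gt_eqF.
    rewrite -mulrDr ler_wpM2l ?invr_ge0 ?(ltW at'0)//.
    by case/andP: (exp_time (q0 x y) t_gt0 tt').
have Jlip t t' : t0 / 2 < t -> t0 / 2 < t' -> `|J t - J t'| <= M * (2 / t0) * `|t - t'|.
  wlog tt' : t t' / t <= t'.
    move=> W; case: (leP t t') => [|/ltW] tt' ht ht'; first exact: W.
    by rewrite distrC (distrC t); exact: W.
  move=> ht ht'; have t_gt0 : 0 < t by apply: lt_trans ht; rewrite divr_gt0.
  have /andP[J1 J2] := Jbound t t' t_gt0 tt'.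
  rewrite distrC ger0_norm ?subr_ge0// distrC ger0_norm ?subr_ge0//.
  rewrite lerBlDl (le_trans J2)// lerD2l -mulrA ler_wpM2l// mulrC.
  rewrite ler_wpM2r ?subr_ge0// -[2 / t0]invf_div lef_pV2 ?posrE ?divr_gt0//.
  exact: ltW.
have near_gt (z : R) : z < t0 -> \forall t \near t0, z < t.
  by move=> zt0; apply: (@cvgr_gt R R (nbhs t0) _ id t0 _ z zt0); exact: cvg_id.
have near_dist (z : R) : 0 < z -> \forall t \near t0, `|t0 - t| <= z.
  by move=> z0; apply/nbhs_ballP; exists z => // t; rewrite /ball/= => /ltW.
have cJ : {for t0, continuous J}.
  apply/cvgrPdist_le => /= eps eps0.
  pose L := M * (2 / t0) + 1.
  have L0 : 0 < L by rewrite ltr_wpDl// mulr_ge0// divr_ge0// ltW.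
  near=> t.
  apply: (le_trans (Jlip _ _ _ _)).
  - by lra.
  - near: t; apply: near_gt.
    by lra.
  apply: (@le_trans _ _ (L * `|t0 - t|)).
    by rewrite ler_wpM2r// lerDl.
  rewrite mulrC -ler_pdivlMr//.
  by near: t; apply: near_dist; rewrite divr_gt0.
have ca : {for t0, continuous a}.
  have c4 : {for t0, continuous (fun t : R => 4 * pi * t)}.
    by apply: cvgM; [exact: cvg_cst|exact: cvg_id].
  apply: cvgM; first exact: c4.
  apply: (@continuous_comp _ _ _ (fun t : R => 4 * pi * t) Num.sqrt); first exact: c4.
  exact: sqrt_continuous.
have E : rexchange A B t0 = (a t0)^-1 * J t0 by rewrite /J mulKf// gt_eqF// a_gt0.
have cq : {for t0, continuous (fun t => (a t)^-1 * J t)}.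
  by apply: cvgM => //; apply: cvgV => //; rewrite gt_eqF// a_gt0.
have Enear : \forall t \near t0, (a t)^-1 * J t = rexchange A B t.
  near=> t; rewrite /J mulKf// gt_eqF// a_gt0//.
  by near: t; exact: near_gt.
rewrite /prop_for /continuous_at E.
exact: cvg_trans (near_eq_cvg Enear) cq.
Unshelve. all: by end_near.
Qed.

End ExchangeBounds.

(** * Branches, limbs and their distances *)

Section Tree.
Context {R : realType}.
Local Notation X1 := (measurableTypeR R).
Local Notation X3 := (X1 * X1 * X1)%type.
Implicit Types (x y : X3) (u v w : face) (o : option face).

Definition crd x (k : 'I_3) : R :=
  if k == ord0 then x.1.1 else if k == o1 then x.1.2 else x.2.

Lemma crd_eq x y : (forall k, crd x k = crd y k) -> x = y.
Proof.
move: x y => [[a b] c] [[a' b'] c'] h.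
by have := h ord0; have := h o1; have := h o2; rewrite /crd/= => -> -> ->.
Qed.

Lemma crdB x y k : crd (x - y) k = crd x k - crd y k.
Proof. by rewrite /crd; case: ifP => // _; case: ifP. Qed.

Lemma crdZ (a : R) x k : crd (a *: x) k = a * crd x k.
Proof. by rewrite /crd; case: ifP => // _; case: ifP. Qed.

Lemma crd_dist x y k : (crd x k - crd y k) ^+ 2 <= dot (x - y) (x - y).
Proof.
rewrite -crdB; move: (x - y) => z; rewrite /dot -!expr2.
by case: (ord3P k) => ->; rewrite /crd/=;
  have := sqr_ge0 z.1.1; have := sqr_ge0 z.1.2; have := sqr_ge0 z.2; lra.
Qed.

Lemma continuous_crd3 k : continuous (fun x : space3 R => crd x k : R).
Proof.
have c1 : continuous (fst : R * R * R -> R * R) by move=> [? ?]; exact: cvg_fst.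
have c11 : continuous (fst : R * R -> R) by move=> [? ?]; exact: cvg_fst.
have c12 : continuous (snd : R * R -> R) by move=> [? ?]; exact: cvg_snd.
rewrite /crd; case: (ord3P k) => -> x /=.
- by apply: (@continuous_comp _ _ _ (fst : R * R * R -> R * R) fst); [exact: c1|exact: c11].
- by apply: (@continuous_comp _ _ _ (fst : R * R * R -> R * R) snd); [exact: c1|exact: c12].
- by case: x => ? ?; exact: cvg_snd.
Qed.

Definition sgn u : R := (-1) ^+ u.2.

Definition normal u : X3 :=
  ((u.1 == ord0)%:R * sgn u, (u.1 == o1)%:R * sgn u, (u.1 == o2)%:R * sgn u).

Lemma crd_normal u k : crd (normal u) k = (u.1 == k)%:R * sgn u.
Proof. by case: (ord3P k) => ->. Qed.

Lemma coords_normal (e : 'I_3 -> space3 R) u : orthonormal_frame e ->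
  coords e (outer_normal e u) = normal u.
Proof.
move=> he; apply: crd_eq => k; rewrite crd_normal /coords /outer_normal !dotZl !he.
by case: (ord3P k) => -> /=; rewrite /crd/= mulrC.
Qed.

Definition unit_cube : set X3 := [set x | forall k, `|crd x k| < 2^-1].

Variable s : R.

(** Attaching a cube of relative size s to the face u of the unit cube is the
    similarity whose inverse is this map. *)
Definition zoom u x : X3 := s^-1 *: (x - ((1 + s) / 2) *: normal u).

(** The cubes that are n generations younger than the unit cube, which is itself
    attached to its parent as recorded by o. *)
Fixpoint level (n : nat) o : set X3 :=
  if n is m.+1 then [set x | exists2 v, v \in free_faces o & level m (Some v) (zoom v x)]
  else unit_cube.

Definition branch o : set X3 := \bigcup_n level n o.

(** The part of a branch that grows on the face v of its root. *)
Definition limb v : set X3 := [set x | branch (Some v) (zoom v x)].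

(** The root of a limb. *)
Definition next_cube v : set X3 := [set x | unit_cube (zoom v x)].

Lemma branchE o x : branch o x <-> unit_cube x \/ exists2 v, v \in free_faces o & limb v x.
Proof.
split=> [[[|n] _ h]|[h|[v vo [n _ h]]]].
- by left.
- by case: h => v vo h; right; exists v => //; exists n.
- by exists 0%N.
- by exists n.+1 => //; exists v.
Qed.

Lemma free_facesP u v : (v \in free_faces (Some u)) = (v != opposite u).
Proof. by rewrite /free_faces mem_filter mem_enum andbT. Qed.

Lemma free_faces0 v : v \in free_faces None.
Proof. by rewrite /free_faces mem_enum. Qed.

Lemma opposite_neq u v : v != opposite u -> v = u \/ v.1 != u.1.
Proof.
case: u v => [i a] [j b]; rewrite /opposite /= xpair_eqE negb_and.
have [-> /= /negPn|ji _] := eqVneq j i; last by right.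
by case: a b => [] [] // _; left.
Qed.

Lemma sgn_sq u : sgn u * sgn u = 1.
Proof. by rewrite /sgn -expr2 sqrr_sign. Qed.

Lemma norm_sgn u : `|sgn u| = 1.
Proof. by rewrite /sgn normr_sign. Qed.

Hypothesis s_gt0 : 0 < s.
Hypothesis s_small : s ^+ 2 + 2 * s < 1.

Lemma s_lt1 : s < 1.
Proof. by have := sqr_ge0 s; have := s_small; rewrite expr2; lra. Qed.

Lemma crd_zoom u x k :
  crd x k = (1 + s) / 2 * ((u.1 == k)%:R * sgn u) + s * crd (zoom u x) k.
Proof.
rewrite /zoom crdZ crdB crdZ crd_normal.
rewrite mulVKf; last by rewrite gt_eqF.
by rewrite addrC subrK.
Qed.

Lemma crd_zoom_axis u x : sgn u * crd x u.1 = (1 + s) / 2 + s * (sgn u * crd (zoom u x) u.1).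
Proof.
rewrite {1}(crd_zoom u) eqxx mul1r mulrDr.
have -> : sgn u * ((1 + s) / 2 * sgn u) = (1 + s) / 2 * (sgn u * sgn u) by ring.
by rewrite sgn_sq; ring.
Qed.

(** How far a branch reaches from its centre in a coordinate direction:
    1/2 + s + s^2 + ... *)
Definition reach : R := 2^-1 + s / (1 - s).

(** What is left, in a lateral direction, between a limb and the boundary of the face
    that carries it. It is positive if and only if s^2 + 2 s < 1, that is, if
    s < sqrt 2 - 1. *)
Definition gap : R := 2^-1 - s * reach.

Lemma reach_step : (1 + s) / 2 + s * reach = reach.
Proof. by have := s_lt1; rewrite /reach => h; field; rewrite subr_eq0 gt_eqF. Qed.

Lemma reach_gt0 : 0 < reach.
Proof.
by have := s_lt1 => h; rewrite /reach addr_gt0 ?invr_gt0// divr_gt0// subr_gt0.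
Qed.

Lemma gap_gt0 : 0 < gap.
Proof.
have h := s_lt1; have h1 : 0 < 1 - s by rewrite subr_gt0.
have -> : gap = (1 - 2 * s - s ^+ 2) / (2 * (1 - s)).
  by rewrite /gap /reach; field; rewrite gt_eqF.
by rewrite divr_gt0 ?mulr_gt0//; have := s_small; lra.
Qed.

Lemma gap_lt : gap < 2^-1.
Proof. by rewrite /gap ltrBlDr ltrDl mulr_gt0 ?reach_gt0. Qed.

Lemma branch_reach o x : branch o x -> forall k, `|crd x k| <= reach.
Proof.
move=> [n _]; elim: n o x => [|n IH] o x /= h k.
  apply: le_trans (ltW (h k)) _; rewrite /reach lerDl divr_ge0 ?subr_ge0 ?ltW//.
  exact: s_lt1.
case: h => v _ /IH/(_ k) h; rewrite (crd_zoom v) -reach_step.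
apply: le_trans (ler_normD _ _) _; apply: lerD; last first.
  by rewrite normrM gtr0_norm// ler_wpM2l// ltW.
have h12 : 0 <= (1 + s) / 2 by rewrite divr_ge0 ?addr_ge0 ?ltW.
rewrite normrM (ger0_norm h12) normrM norm_sgn mulr1 ler_piMr//.
by case: (_ == _); rewrite ?normr1// normr0.
Qed.

(** The face by which a branch is attached carries no limb, and the limbs on its side
    faces reach back at most s * reach < 1/2 from the centre. *)
Lemma branch_forward u x : branch (Some u) x -> - 2^-1 < sgn u * crd x u.1.
Proof.
have lt_abs (a b : R) : `|a| < b -> forall w, - b < sgn w * a.
  by move=> ab w; rewrite ltrNl; apply: ltr_normlW; rewrite normrN normrM norm_sgn mul1r.
move=> [n _]; elim: n u x => [|n IH] u x /= h; first exact: lt_abs.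
case: h => v; rewrite free_facesP => /opposite_neq vu hv.
have := gap_gt0; have := s_lt1; have := gap_lt => g2 s1 g0.
case: vu => [->|vu] in hv *.
  rewrite crd_zoom_axis; have h := IH _ _ hv.
  have : s * - 2^-1 < s * (sgn u * crd (zoom u x) u.1) by rewrite ltr_pM2l.
  by lra.
rewrite (crd_zoom v) (negbTE vu) mul0r mulr0 add0r.
have := branch_reach (ex_intro2 _ _ n I hv) u.1 => hr.
have : - (s * reach) <= sgn u * (s * crd (zoom v x) u.1).
  rewrite lerNl; apply: le_trans (ler_norm _) _.
  by rewrite normrN !normrM norm_sgn mul1r gtr0_norm// ler_wpM2l// ltW.
by move: g0; rewrite /gap; lra.
Qed.

Lemma limb_beyond v x : limb v x -> 2^-1 < sgn v * crd x v.1.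
Proof.
move=> /branch_forward h; rewrite crd_zoom_axis.
have : s * - 2^-1 < s * (sgn v * crd (zoom v x) v.1) by rewrite ltr_pM2l.
by lra.
Qed.

Lemma limb_lateral v x k : limb v x -> v.1 != k -> `|crd x k| <= 2^-1 - gap.
Proof.
move=> h vk; rewrite (crd_zoom v) (negbTE vk) mul0r mulr0 add0r.
rewrite normrM gtr0_norm// /gap opprB addrC subrK ler_wpM2l ?(ltW s_gt0)//.
exact: branch_reach h k.
Qed.

Definition limb_tip v : set X3 :=
  [set x | exists2 w, w \in free_faces (Some v) & limb w (zoom v x)].

Lemma limbE v x : limb v x <-> next_cube v x \/ limb_tip v x.
Proof. exact: branchE. Qed.

(** Of the limbs that grow on the root of the limb v, the one that grows forwards lies
    beyond this root, and those that grow sideways stay at the distance s * gap from the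
    face by which the root is attached. *)
Lemma limb_tip_far v x : limb_tip v x -> 2^-1 + s * gap <= sgn v * crd x v.1.
Proof.
case=> w; rewrite free_facesP => /opposite_neq wv hw; rewrite crd_zoom_axis.
have g2 := gap_lt.
have : s * (gap - 2^-1) <= s * (sgn v * crd (zoom v x) v.1).
  rewrite ler_pM2l//; case: wv => wv.
    by have := limb_beyond hw; rewrite wv; lra.
  have := limb_lateral hw wv => h.
  rewrite -(opprB 2^-1) lerNl; apply: le_trans (ler_norm _) _.
  by rewrite normrN normrM norm_sgn mul1r.
by lra.
Qed.

Lemma unit_cube_near v x : unit_cube x -> sgn v * crd x v.1 < 2^-1.
Proof.
by move=> /(_ v.1) h; apply: le_lt_trans (ler_norm _) _; rewrite normrM norm_sgn mul1r.
Qed.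

(** The limb v lies beyond the plane of the face v, whereas every other limb stays
    below this plane by at least gap: it grows either on the opposite face or
    sideways. *)
Lemma limbs_apart v w : v != w -> forall x y, limb v x -> limb w y ->
  gap ^+ 2 <= dot (x - y) (x - y).
Proof.
move=> vw x y hx hy; have g0 := gap_gt0; have g2 := gap_lt.
apply: le_trans (crd_dist x y v.1).
have bx := limb_beyond hx.
suff : gap <= `|crd x v.1 - crd y v.1|.
  by move=> h; rewrite -[leRHS]real_normK ?num_real// ler_sqr ?nnegrE ?normr_ge0// ltW.
rewrite -[leRHS]mul1r -(norm_sgn v) -normrM (mulrBr (sgn v)).
apply: le_trans (ler_norm _).
suff : sgn v * crd y v.1 <= 2^-1 - gap by lra.
have [wv|wv] := eqVneq w.1 v.1.
  have by_ := limb_beyond hy.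
  have sw : sgn w = - sgn v.
    move: vw wv; case: (v) (w) => [i a] [j b] /= + ji; rewrite ji xpair_eqE eqxx /=.
    by rewrite /sgn /=; case: a b => [] [] // _; rewrite ?expr0 ?expr1 ?opprK.
  by move: by_; rewrite sw wv mulNr; lra.
have := limb_lateral hy wv => h.
by apply: le_trans (ler_norm _) _; rewrite normrM norm_sgn mul1r.
Qed.

Lemma limb_tip_apart v x y : unit_cube x -> limb_tip v y ->
  (s * gap) ^+ 2 <= dot (x - y) (x - y).
Proof.
move=> hx hy; have g0 := gap_gt0.
apply: le_trans (crd_dist x y v.1).
have sg : 0 < s * gap by rewrite mulr_gt0.
suff : s * gap <= `|crd x v.1 - crd y v.1|.
  by move=> h; rewrite -[leRHS]real_normK ?num_real// ler_sqr ?nnegrE ?normr_ge0// ltW.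
rewrite distrC -[leRHS]mul1r -(norm_sgn v) -normrM (mulrBr (sgn v)).
apply: le_trans (ler_norm _).
have := limb_tip_far hy; have := unit_cube_near v hx; lra.
Qed.

End Tree.

(** * Generations of cubes and open sets *)

Section Polyhedron.
Context {R : realType}.
Local Notation X1 := (measurableTypeR R).
Local Notation X3 := (X1 * X1 * X1)%type.
Local Notation mu3 := (@lebesgue3 R).

(** The measurable structure of a product is generated by boxes, and an open
    set is the union of the rational boxes that it contains. *)
Lemma open_measurable3 (O : set (space3 R)) : open O -> measurable (O : set X3).
Proof.
move=> oO.
pose I := (rat * rat * rat * nat)%type.
pose q (i : I) : space3 R := (ratr i.1.1.1, ratr i.1.1.2, ratr i.1.2).
pose B (i : I) : set (space3 R) :=
  ball (ratr i.1.1.1 : R) (i.2.+1%:R^-1) `*` ball (ratr i.1.1.2 : R) (i.2.+1%:R^-1)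
  `*` ball (ratr i.1.2 : R) (i.2.+1%:R^-1).
have mB i : measurable (B i : set X3).
  have mb (x e : R) : measurable (ball x e : set X1) by exact: measurable_ball.
  exact: (measurableX (measurableX (mb _ _) (mb _ _)) (mb _ _)).
have -> : O = \bigcup_(i in [set i | B i `<=` O]) B i.
  apply/seteqP; split => [x Ox|x [i /= BO /BO]//].
  have /nbhs_ballP[e /= e0 be] : nbhs x O by exact: open_nbhs_nbhs.
  pose n := Num.truncn (2 / e); pose r : R := n.+1%:R^-1.
  have r0 : 0 < r by rewrite invr_gt0.
  have re : r + r <= e.
    have := truncnS_gt (2 / e); rewrite -/n => /ltW.
    rewrite ler_pdivrMr// mulrC => h.
    have -> : r + r = 2 / n.+1%:R by rewrite /r; ring.
    by rewrite ler_pdivrMr.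
  have rat_near (a : R) : exists p : rat, ball (ratr p : R) r a.
    have ar : a - r < a + r by rewrite ltrBlDr -addrA ltrDl addr_gt0.
    have [p] := rat_in_itvoo ar; rewrite in_itv/= => /andP[p1 p2].
    by exists p; rewrite /ball/= ltr_norml; apply/andP; split; lra.
  move: x Ox be => [[x1 x2] x3] Ox be.
  have [p1 h1] := rat_near x1; have [p2 h2] := rat_near x2.
  have [p3 h3] := rat_near x3.
  exists (p1, p2, p3, n) => //=.
  move=> [[y1 y2] y3] [[/= b1 b2] /= b3]; apply: be.
  have tri (a p y : R) : ball p r a -> ball p r y -> ball a e y.
    by move=> pa py; apply: le_ball re _ _; apply: ball_triangle py; exact: ball_sym.
  by split; [split|]; [exact: tri b1|exact: tri b2|exact: tri b3].
rewrite bigcup_mkcond; apply: countable_bigcupT_measurable => [|i].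
  exact: countableP.
by case: ifP.
Qed.

Lemma closed_measurable3 (C : set (space3 R)) : closed C -> measurable (C : set X3).
Proof.
move=> cC; rewrite -[C]setCK; apply: measurableC; apply: open_measurable3.
exact: closed_openC.
Qed.

Section Link.
Variables (e : 'I_3 -> space3 R) (x0 : space3 R) (s : R).
Hypothesis he : orthonormal_frame e.
Hypothesis s_gt0 : 0 < s.

Lemma crd_coords (y : space3 R) k : crd (coords e y) k = dot y (e k).
Proof. by case: (ord3P k) => ->. Qed.

Lemma open_cubeE (c : space3 R) (a : R) : 0 < a ->
  open_cube e c a = [set x | unit_cube (a^-1 *: coords e (x - c))].
Proof.
move=> a0; apply/seteqP; split => x h k; move: (h k);
  rewrite crdZ crd_coords normrM gtr0_norm ?invr_gt0//.
  by rewrite -ltr_pdivlMl ?invr_gt0// invrK.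
by rewrite -ltr_pdivlMl ?invr_gt0// invrK.
Qed.

Lemma coordsZ (a : R) (y : space3 R) : coords e (a *: y) = a *: coords e y.
Proof. by rewrite /coords !dotZl. Qed.

Lemma coords_attach (a b : R) (c x : space3 R) (u : face) :
  coords e (x - (attach e c a b u).1) = coords e (x - c) - ((a + b) / 2) *: normal u.
Proof.
rewrite /attach/= /face_centre -(coords_normal u he) -coordsZ -coordsB; congr (coords e _).
rewrite -addrA -scalerDl opprD addrA; congr (_ - _ *: _).
by rewrite -mulrDl.
Qed.

(** The definition of the polyhedron grows every cube from its parent; the
    self-similarity is visible when the same cubes are grown from the root. *)
Lemma generation_level n i (x : space3 R) :
  (exists2 q, q \in generation e x0 s (i + n) & open_cube e q.1 (s ^+ (i + n)) x) <->
  (exists2 q, q \in generation e x0 s i &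
     level s n q.2 ((s ^+ i)^-1 *: coords e (x - q.1))).
Proof.
elim: n i => [|n IH] i.
  rewrite addn0; split=> -[q qi h]; exists q => //; move: h;
  by rewrite open_cubeE ?exprn_gt0.
have zoomE (q : space3 R * option face) u :
    zoom s u ((s ^+ i)^-1 *: coords e (x - q.1)) =
    (s ^+ i.+1)^-1 *: coords e (x - (attach e q.1 (s ^+ i) (s ^+ i.+1) u).1).
  have si : s ^+ i != 0 by rewrite gt_eqF// exprn_gt0.
  rewrite coords_attach /zoom !scalerBr !scalerA; congr (_ *: _ - _ *: _).
    by rewrite exprS invfM.
  by rewrite exprS; field; rewrite si gt_eqF.
rewrite addnS -addSn IH; split.
  case=> _ /allpairsPdep[q [u [qi uq ->]]] h; exists q => //=; exists u => //.
  by rewrite zoomE.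
case=> q qi /= [u uq]; rewrite zoomE => h.
exists (attach e q.1 (s ^+ i) (s ^+ i.+1) u) => //.
by apply/allpairsPdep; exists q, u.
Qed.

Lemma cubes_branch :
  \bigcup_j \bigcup_(q in [set` generation e x0 s j]) open_cube e q.1 (s ^+ j) =
  [set x | branch s None (coords e (x - x0))].
Proof.
apply/seteqP; split => x.
  case=> j _ [q /= qj h].
  have /(generation_level j 0 x) : exists2 q, q \in generation e x0 s (0 + j) &
    open_cube e q.1 (s ^+ (0 + j)) x by exists q.
  case=> q' /=; rewrite inE => /eqP -> /=; rewrite expr0 invr1 scale1r => h'.
  by exists j.
case=> j _ h.
have : exists2 q, q \in generation e x0 s 0 &
     level s j q.2 ((s ^+ 0)^-1 *: coords e (x - q.1)).
  by exists (x0, None); rewrite ?inE//= expr0 invr1 scale1r.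
by move=> /generation_level[q qj hq]; exists j => //; exists q.
Qed.

End Link.

Section Topology.
Variable s : R.

Lemma continuous_zoom u : continuous (zoom s u : space3 R -> space3 R).
Proof.
move=> x; rewrite /zoom; apply: cvgZr; apply: cvgB; first exact: cvg_id.
exact: cvg_cst.
Qed.

Lemma continuous_coords (e : 'I_3 -> space3 R) (c : space3 R) :
  continuous (fun x : space3 R => coords e (x - c) : space3 R).
Proof.
have cd k : continuous (fun x : space3 R => dot (x - c) (e k)).
  have ck j : continuous (fun x : space3 R => crd (x - c) j).
    move=> x.
    apply: (@continuous_comp _ _ _ (fun x : space3 R => x - c) (fun y : space3 R => crd y j)).
      by apply: cvgB; [exact: cvg_id|exact: cvg_cst].
    exact: continuous_crd3.
  move=> x; apply: cvgD; first apply: cvgD.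
  - by apply: cvgM; [exact: (ck ord0)|exact: cvg_cst].
  - by apply: cvgM; [exact: (ck o1)|exact: cvg_cst].
  - by apply: cvgM; [exact: (ck o2)|exact: cvg_cst].
move=> x; exact: (cvg_pair (cvg_pair (cd ord0 x) (cd o1 x)) (cd o2 x)).
Qed.

Lemma open_unit_cube : open (unit_cube : set (space3 R)).
Proof.
have ok k : open [set x : space3 R | `|crd x k| < 2^-1].
  apply: (@open_comp _ _ (fun x : space3 R => `|crd x k|) [set y : R | y < 2^-1]).
    move=> x _; apply: (@continuous_comp _ _ _ (fun x : space3 R => crd x k) (fun y : R => `|y|)).
      exact: continuous_crd3.
    exact: norm_continuous.
  exact: open_lt.
have -> : unit_cube = [set x : space3 R | `|crd x ord0| < 2^-1] `&`
    [set x | `|crd x o1| < 2^-1] `&` [set x | `|crd x o2| < 2^-1].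
  apply/seteqP; split => [x h|x [[h0 h1] h2] k].
    by split; [split|]; exact: h.
  by case: (ord3P k) => ->.
by apply: openI => //; apply: openI.
Qed.

Definition closed_cube : set (space3 R) := [set x | forall k, `|crd x k| <= 2^-1].

Lemma closed_closed_cube : closed closed_cube.
Proof.
have ok k : closed [set x : space3 R | `|crd x k| <= 2^-1].
  apply: (@closed_comp _ _ (fun x : space3 R => `|crd x k|) [set y : R | y <= 2^-1]).
    move=> x _; apply: (@continuous_comp _ _ _ (fun x : space3 R => crd x k) (fun y : R => `|y|)).
      exact: continuous_crd3.
    exact: norm_continuous.
  exact: closed_le.
have -> : closed_cube = [set x : space3 R | `|crd x ord0| <= 2^-1] `&`
    [set x | `|crd x o1| <= 2^-1] `&` [set x | `|crd x o2| <= 2^-1].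
  apply/seteqP; split => [x h|x [[h0 h1] h2] k].
    by split; [split|]; exact: h.
  by case: (ord3P k) => ->.
by apply: closedI => //; apply: closedI.
Qed.

Lemma open_zoom u (A : set (space3 R)) : open A -> open [set x | A (zoom s u x)].
Proof. by move=> oA; apply: open_comp oA => x _; exact: continuous_zoom. Qed.

Lemma closed_zoom u (A : set (space3 R)) : closed A -> closed [set x | A (zoom s u x)].
Proof. by move=> oA; apply: closed_comp oA => x _; exact: continuous_zoom. Qed.

Lemma open_branch o : open (branch s o : set (space3 R)).
Proof.
apply: bigcup_open => n _; elim: n o => [|n IH] o; first exact: open_unit_cube.
have -> : level s n.+1 o = \bigcup_(v in [set v | v \in free_faces o])
    [set x | level s n (Some v) (zoom s v x)].
  by apply/seteqP; split => x [v vo h]; exists v.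
by apply: bigcup_open => v _; apply: open_zoom; exact: IH.
Qed.

Lemma open_limb v : open (limb s v : set (space3 R)).
Proof. by apply: open_zoom; exact: open_branch. Qed.

Lemma open_limb_tip v : open (limb_tip s v : set (space3 R)).
Proof.
have -> : limb_tip s v = \bigcup_(w in [set w | w \in free_faces (Some v)])
    [set x | limb s w (zoom s v x)].
  by apply/seteqP; split => x [w vo h]; exists w.
by apply: bigcup_open => w _; apply: open_zoom; exact: open_limb.
Qed.

End Topology.

End Polyhedron.

(** * Null sets added by the closure *)

Section Volumes.
Context {R : realType}.
Local Notation X1 := (measurableTypeR R).
Local Notation X3 := (X1 * X1 * X1)%type.
Local Notation mu1 := (@lebesgue_measure R).
Local Notation mu3 := (@lebesgue3 R).

Lemma box_crd (r : R) (x : X3) : box r x <-> forall k, `|crd x k| <= r.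
Proof.
split=> [[h0 h1 h2] k|h]; first by case: (ord3P k) => ->.
by split; [exact: h ord0|exact: h o1|exact: h o2].
Qed.

Lemma unit_cubeE : unit_cube = unit_itv `*` unit_itv `*` unit_itv :> set X3.
Proof.
apply/seteqP; split => [x h|[[x1 x2] x3] [[/= h0 h1] h2] k].
  have h0 := h ord0; have h1 := h o1; have h2 := h o2.
  by move: h0 h1 h2; rewrite /crd/= /unit_itv !ltr_norml; split; [split|]; rewrite /= in_itv.
move: h0 h1 h2; rewrite /unit_itv/= !in_itv/= -!ltr_norml => h0 h1 h2.
by case: (ord3P k) => ->.
Qed.

Lemma measurable_unit_cube : measurable (unit_cube : set X3).
Proof. by apply: open_measurable3; exact: open_unit_cube. Qed.

Lemma volume_unit_cube : mu3 unit_cube = 1%E.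
Proof.
rewrite unit_cubeE volume_product /unit_itv// lebesgue_measure_itv/= lte_fin.
have -> : - 2^-1 < 2^-1 :> R by lra.
rewrite -EFinB -!EFinM.
have -> : 2^-1 - - 2^-1 = 1 :> R by field.
by rewrite !mulr1.
Qed.

Lemma boundary_cube_negligible : mu3 (closed_cube `\` unit_cube : set X3) = 0.
Proof.
have -> : closed_cube = box 2^-1 :> set X3.
  by apply/seteqP; split => x; rewrite box_crd.
have vb : mu3 (box 2^-1) = 1%E.
  rewrite volume_box ?invr_ge0//; congr EFin; by field.
have fb : (mu3 (box 2^-1) < +oo)%E by rewrite vb ltry.
have := measureD (measurable_box _) measurable_unit_cube fb.
have -> : box 2^-1 `&` unit_cube = unit_cube :> set X3.
  by apply/setIidPr => x h; apply/box_crd => k; apply: ltW; exact: h.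
move=> H; transitivity (mu3 (box 2^-1) - mu3 unit_cube)%E; first exact: H.
by rewrite vb volume_unit_cube subee.
Qed.

Variable s : R.
Hypothesis s_gt0 : 0 < s.
Hypothesis s_small : s ^+ 2 + 2 * s < 1.

Lemma measurable_zoom u (A : set X3) : measurable A -> measurable [set x : X3 | A (zoom s u x)].
Proof.
move=> mA; apply: (measurable_preim (f := zoom s u : X3 -> X3)) => //.
apply: (measurableT_comp (measurable_scale3 s^-1)).
by apply: measurable_funB3; [exact: measurable_id|exact: measurable_cst].
Qed.

Lemma volume_zoom u (A : set X3) : measurable A ->
  mu3 [set x : X3 | A (zoom s u x)] = ((s ^+ 3)%:E * mu3 A)%E.
Proof.
move=> mA.
have mA' : measurable [set x : X3 | A (s^-1 *: x)].
  exact: (measurable_preim (measurable_scale3 s^-1)).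
rewrite [LHS](volume_translation (- (((1 + s) / 2) *: normal u)) mA').
by rewrite volume_scale ?invr_gt0// exprVn invrK.
Qed.

Lemma exchange_zoom u (A B : set X3) t : 0 < t -> measurable A -> measurable B ->
  exchange [set x : X3 | A (zoom s u x)] [set x : X3 | B (zoom s u x)] t =
  ((s ^+ 3)%:E * exchange A B (t / s ^+ 2))%E.
Proof. by move=> t0 mA mB; exact: exchange_scale. Qed.

Lemma measurable_branch o : measurable (branch s o : set X3).
Proof. by apply: open_measurable3; exact: open_branch. Qed.

Lemma measurable_limb v : measurable (limb s v : set X3).
Proof. by apply: open_measurable3; exact: open_limb. Qed.

Lemma branch_box o : branch s o `<=` box (reach s).
Proof. by move=> x h; apply/box_crd; exact: branch_reach h. Qed.

Lemma volume_sub_box (A : set X3) : measurable A -> A `<=` box (reach s) ->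
  (mu3 A <= ((2 * reach s) ^+ 3)%:E)%E.
Proof.
move=> mA Ab; rewrite -volume_box; last by rewrite ltW// reach_gt0.
by apply: le_measure => //; rewrite inE//; exact: measurable_box.
Qed.

Lemma closed_box (r : R) : closed (box r : set (space3 R)).
Proof.
have ok k : closed [set x : space3 R | `|crd x k| <= r].
  apply: (@closed_comp _ _ (fun x : space3 R => `|crd x k|) [set y : R | y <= r]).
    move=> x _; apply: (@continuous_comp _ _ _ (fun x : space3 R => crd x k) (fun y : R => `|y|)).
      exact: continuous_crd3.
    exact: norm_continuous.
  exact: closed_le.
have -> : box r = [set x : space3 R | `|crd x ord0| <= r] `&`
    [set x | `|crd x o1| <= r] `&` [set x | `|crd x o2| <= r].
  apply/seteqP; split => [x /box_crd h|x [[h0 h1] h2]].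
    by split; [split|]; exact: h.
  by split.
by apply: closedI => //; apply: closedI.
Qed.

(** The points that the closure adds to a branch: the boundaries of the cubes and
    the accumulation points of the ever smaller cubes. *)
Definition residue o : set (space3 R) := closure (branch s o) `\` branch s o.

Lemma measurable_residue o : measurable (residue o : set X3).
Proof.
apply: measurableD; last exact: measurable_branch.
by apply: closed_measurable3; exact: closed_closure.
Qed.

(** The branch is contained in a finite, hence closed, union of the closed cube and the
    closures of the limbs. *)
Lemma residue_sub o : residue o `<=`
  (closed_cube `\` unit_cube) `|`
  \bigcup_(v in [set: face]) [set x | residue (Some v) (zoom s v x)].
Proof.
move=> x [cx nx].
pose K : set (space3 R) := closed_cube `|` \bigcup_(v in [set v | v \in free_faces o])
   [set x | closure (branch s (Some v)) (zoom s v x)].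
have cK : closed K.
  apply: closedU; first exact: closed_closed_cube.
  by apply: closed_bigcup => // v _; apply: closed_zoom; exact: closed_closure.
have bK : branch s o `<=` K.
  move=> y /branchE[h|[v vo h]]; first by left => k; exact: ltW.
  by right; exists v => //; apply: subset_closure.
have : K x by move: cx; rewrite closureE; apply.
case=> [h|[v vo h]].
  by left; split => // h'; apply: nx; apply/branchE; left.
right; exists v => //; split => // h'; apply: nx; apply/branchE; right.
by exists v.
Qed.

(** The six residues have a finite total volume. Each residue is covered, up to the
    boundary of a cube, by copies of all six at the scale s, so that this total is at
    most 6 s^3 times itself, while 6 s^3 < 1. *)
Lemma residue_negligible o : mu3 (residue o) = 0.
Proof.
pose M o := fine (mu3 (residue o)).
have fin o' : mu3 (residue o') \is a fin_num.
  rewrite ge0_fin_numE//; apply: le_lt_trans (volume_sub_box (measurable_residue o') _) (ltry _).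
  move=> x [cx _]; have := cx; rewrite closureE; apply; split; first exact: closed_box.
  exact: branch_box.
have M0 o' : 0 <= M o' by rewrite fine_ge0.
have step o' : M o' <= s ^+ 3 * \sum_(v : face) M (Some v).
  rewrite -lee_fin fineK//.
  have mz v := measurable_zoom v (measurable_residue (Some v)).
  have -> : ((s ^+ 3 * \sum_(v : face) M (Some v))%:E =
     \sum_(v : face) mu3 [set x : X3 | residue (Some v) (zoom s v x)])%E.
    rewrite mulr_sumr -sumEFin; apply: eq_bigr => v _.
    by rewrite volume_zoom ?EFinM ?fineK//; exact: measurable_residue.
  have mcd : measurable (closed_cube `\` unit_cube : set X3).
    apply: measurableD; last exact: measurable_unit_cube.
    by apply: closed_measurable3; exact: closed_closed_cube.
  have mU : measurable (\big[setU/set0]_(v : face) [set x : X3 | residue (Some v) (zoom s v x)]).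
    by apply: bigsetU_measurable => v _; exact: mz.
  apply: (@le_trans _ _ (mu3 ((closed_cube `\` unit_cube) `|`
     \big[setU/set0]_(v : face) [set x : X3 | residue (Some v) (zoom s v x)]))).
    apply: le_measure; rewrite ?inE; [exact: measurable_residue|exact: measurableU|].
    apply: subset_trans (residue_sub (o := o')) _; apply: setUS.
    by move=> x [v _ h]; rewrite -bigcup_seq; exists v => //=; rewrite mem_index_enum.
  apply: (@le_trans _ _ (mu3 (closed_cube `\` unit_cube) +
     mu3 (\big[setU/set0]_(v : face) [set x : X3 | residue (Some v) (zoom s v x)]))%E).
    exact: measureU2.
  rewrite [X in (X + _)%E]boundary_cube_negligible add0e.
  pose P (A : set X3) (m : \bar R) := measurable A /\ (mu3 A <= m)%E.
  suff [] : P (\big[setU/set0]_(v : face) [set x : X3 | residue (Some v) (zoom s v x)])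
     (\sum_(v : face) mu3 [set x : X3 | residue (Some v) (zoom s v x)])%E by [].
  apply: big_ind2 => [|A m B n [mA Am] [mB Bn]|v _].
  - by split; rewrite ?measure0.
  - split; first exact: measurableU.
    by apply: le_trans (measureU2 _ mA mB) _; exact: leeD.
  - by split; [exact: mz|exact: lexx].
have s3 : 6 * s ^+ 3 < 1.
  have s12 : s < 2^-1 by have := s_small; have := sqr_ge0 s; lra.
  have : s ^+ 3 <= 2^-1 ^+ 3 by rewrite ler_pXn2r ?nnegrE ?invr_ge0 ?ltW.
  have -> : 2^-1 ^+ 3 = 8^-1 :> R by field.
  by lra.
have sum0 : \sum_(v : face) M (Some v) = 0.
  set S := \sum_(v : face) _.
  have S0 : 0 <= S by apply: sumr_ge0.
  have : S <= 6 * s ^+ 3 * S.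
    have -> : 6 * s ^+ 3 * S = \sum_(v : face) (s ^+ 3 * S).
      rewrite sumr_const card_prod card_ord card_bool -mulr_natl.
      by ring.
    by apply: ler_sum => v _; exact: step.
  move=> h; apply/eqP; rewrite eq_le S0 andbT.
  have : (1 - 6 * s ^+ 3) * S <= 0 by lra.
  by rewrite pmulr_rle0// subr_gt0.
have := step o; rewrite sum0 mulr0 => h.
have : M o = 0 by apply/eqP; rewrite eq_le h M0.
by rewrite /M => h'; rewrite -[LHS]fineK// h'.
Qed.

End Volumes.

(** * The renewal equation *)

Section Recursion.
Context {R : realType}.
Local Notation X1 := (measurableTypeR R).
Local Notation X3 := (X1 * X1 * X1)%type.
Local Notation mu3 := (@lebesgue3 R).
Opaque exchange line_exchange.

(** Between such sets the exchange is finite, so that it may be subtracted. *)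
Definition finite_volume (A : set X3) := measurable A /\ (mu3 A < +oo)%E.

Lemma rexchangeK (A B : set X3) t : 0 < t -> finite_volume A -> finite_volume B ->
  exchange A B t = (rexchange A B t)%:E.
Proof. by move=> t0 [mA fA] [mB fB]; rewrite fineK// exchange_fin// ltW. Qed.

Lemma rexchangeC (A B : set X3) t : finite_volume A -> finite_volume B ->
  rexchange A B t = rexchange B A t.
Proof. by move=> [mA _] [mB _]; rewrite /rexchange (exchangeC t mA mB). Qed.

Lemma finite_volumeU (A B : set X3) : finite_volume A -> finite_volume B ->
  finite_volume (A `|` B).
Proof.
move=> [mA fA] [mB fB]; split; first exact: measurableU.
by apply: le_lt_trans (measureU2 _ mA mB) _; exact: lte_add_pinfty.
Qed.

Lemma rexchangeUl (A A' B : set X3) t : 0 < t ->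
  finite_volume A -> finite_volume A' -> finite_volume B -> A `&` A' = set0 ->
  rexchange (A `|` A') B t = rexchange A B t + rexchange A' B t.
Proof.
move=> t0 hA hA' hB dis; apply: EFin_inj.
rewrite EFinD -(rexchangeK t0 (finite_volumeU hA hA') hB) -(rexchangeK t0 hA hB).
rewrite -(rexchangeK t0 hA' hB).
by apply: exchangeUl => //; [case: hA|case: hA'|case: hB].
Qed.

Lemma rexchange_ge0 (A B : set X3) t : 0 <= rexchange A B t.
Proof. by apply: fine_ge0; exact: exchange_ge0. Qed.

Lemma rexchange_le (A B : set X3) t (K V : R) : 0 < t -> 0 <= K -> 0 <= V ->
  measurable A -> measurable B -> (mu3 A <= V%:E)%E -> (mu3 B <= V%:E)%E ->
  (forall x y, A x -> B y -> heat_kernel x y t <= K) ->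
  rexchange A B t <= K * V * V.
Proof.
move=> t0 K0 V0 mA mB AV BV h; rewrite -lee_fin -rexchangeK//; last 2 first.
- by split=> //; exact: le_lt_trans AV (ltry _).
- by split=> //; exact: le_lt_trans BV (ltry _).
apply: le_trans (le_exchange mA mB K0 h) _.
rewrite !EFinM lee_pmul ?mule_ge0 ?lee_fin//.
by rewrite lee_pmul ?lee_fin.
Qed.

Lemma rexchange_set0 (B : set X3) t : measurable B -> rexchange set0 B t = 0.
Proof.
move=> mB; rewrite /rexchange.
have -> : exchange set0 B t = 0%E.
  apply/eqP; rewrite eq_le exchange_ge0 andbT.
  have h (x y : X3) : set0 x -> B y -> heat_kernel x y t <= 0 by [].
  apply: le_trans (le_exchange measurable0 mB (lexx 0) h) _.
  by rewrite !mul0e.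
by [].
Qed.

Lemma rexchange_val (A B : set X3) t (x : R) : exchange A B t = x%:E -> rexchange A B t = x.
Proof. by rewrite /rexchange => ->. Qed.

Opaque rexchange.

Variable s : R.
Hypothesis s_gt0 : 0 < s.
Hypothesis s_small : s ^+ 2 + 2 * s < 1.

Let V : R := (2 * reach s) ^+ 3.
Let V0 : 0 <= V.
Proof. by rewrite exprn_ge0// mulr_ge0// ltW// reach_gt0. Qed.

Lemma volume_branch o : (mu3 (branch s o) <= V%:E)%E.
Proof. by apply: volume_sub_box => //; [exact: measurable_branch|exact: branch_box]. Qed.

Lemma finite_volume_branch o : finite_volume (branch s o).
Proof.
by split; [exact: measurable_branch|exact: le_lt_trans (volume_branch o) (ltry _)].
Qed.

Lemma limb_branch v : limb s v `<=` branch s None.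
Proof. by move=> x h; apply/branchE; right; exists v => //; exact: free_faces0. Qed.

Lemma volume_limb v : (mu3 (limb s v) <= V%:E)%E.
Proof.
apply: le_trans (volume_branch None); apply: le_measure; rewrite ?inE.
- exact: measurable_limb.
- exact: measurable_branch.
- exact: limb_branch.
Qed.

Lemma finite_volume_limb v : finite_volume (limb s v).
Proof.
by split; [exact: measurable_limb|exact: le_lt_trans (volume_limb v) (ltry _)].
Qed.

Lemma volume_cube_le : (mu3 unit_cube <= V%:E)%E.
Proof.
apply: le_trans (volume_branch None); apply: le_measure; rewrite ?inE.
- exact: measurable_unit_cube.
- exact: measurable_branch.
- by move=> x h; apply/branchE; left.
Qed.

Lemma finite_volume_cube : finite_volume unit_cube.
Proof.
by split; [exact: measurable_unit_cube|exact: le_lt_trans volume_cube_le (ltry _)].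
Qed.

Lemma measurable_next_cube v : measurable (next_cube s v : set X3).
Proof. by apply: measurable_zoom => //; exact: measurable_unit_cube. Qed.

Lemma measurable_limb_tip v : measurable (limb_tip s v : set X3).
Proof. by apply: open_measurable3; exact: open_limb_tip. Qed.

Lemma next_cube_limb v : next_cube s v `<=` limb s v.
Proof. by move=> x h; apply/limbE; left. Qed.

Lemma limb_tip_limb v : limb_tip s v `<=` limb s v.
Proof. by move=> x h; apply/limbE; right. Qed.

Lemma volume_limb_tip v : (mu3 (limb_tip s v) <= V%:E)%E.
Proof.
apply: le_trans (volume_limb v); apply: le_measure; rewrite ?inE.
- exact: measurable_limb_tip.
- exact: measurable_limb.
- exact: limb_tip_limb.
Qed.

Lemma finite_volume_sub (A B : set X3) : measurable A -> A `<=` B -> finite_volume B ->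
  finite_volume A.
Proof.
move=> mA AB [mB fB]; split=> //; apply: le_lt_trans fB.
by apply: le_measure => //; rewrite inE.
Qed.

Definition limbs (r : seq face) : set X3 := \big[setU/set0]_(v <- r) limb s v.

Lemma limbsP r (x : X3) : limbs r x <-> exists2 v, v \in r & limb s v x.
Proof.
rewrite /limbs -bigcup_seq; split=> [[v vr h]|[v vr h]]; by exists v.
Qed.

Lemma limbs_disjoint v w : v != w -> limb s v `&` limb s w = set0.
Proof.
move=> vw; apply/seteqP; split => x // -[hv hw].
have := limbs_apart s_gt0 s_small vw hv hw.
by rewrite subrr dot0l leNgt exprn_gt0// gap_gt0.
Qed.

Lemma finite_volume_limbs r : finite_volume (limbs r).
Proof.
apply: (@finite_volume_sub _ (branch s None)).
- by apply: bigsetU_measurable => v _; exact: measurable_limb.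
- by move=> x /limbsP[v _ h]; exact: limb_branch h.
- exact: finite_volume_branch.
Qed.

Lemma rexchange_limbsl r (B : set X3) t : 0 < t -> uniq r -> finite_volume B ->
  rexchange (limbs r) B t = \sum_(v <- r) rexchange (limb s v) B t.
Proof.
move=> t0 + hB; elim: r => [_|v r IH /= /andP[vr ur]].
  by rewrite /limbs !big_nil rexchange_set0//; case: hB.
have -> : limbs (v :: r) = limb s v `|` limbs r by rewrite /limbs big_cons.
have dis : limb s v `&` limbs r = set0.
  apply/seteqP; split => x // -[hv /limbsP[w wr hw]].
  have vw : v != w by apply: contraNneq vr => ->.
  by rewrite -(limbs_disjoint vw); split.
rewrite big_cons -(IH ur).
exact: (rexchangeUl t0 (finite_volume_limb v) (finite_volume_limbs r) hB dis).
Qed.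

Lemma branch_limbs o : branch s o = unit_cube `|` limbs (free_faces o) :> set X3.
Proof.
apply/seteqP; split => x.
  by move=> /branchE[h|h]; [left|right; apply/limbsP].
by case=> [h|/limbsP h]; apply/branchE; [left|right].
Qed.

Lemma uniq_free o : uniq (free_faces o).
Proof.
by case: o => [u|]; rewrite /free_faces; [apply: filter_uniq|]; exact: enum_uniq.
Qed.

Lemma size_free o : (size (free_faces o) <= 6)%N.
Proof.
have h : size (enum {: face}) = 6%N by rewrite -cardE card_prod card_ord card_bool.
case: o => [u|]; last by rewrite /free_faces h.
by rewrite /free_faces size_filter -h; exact: count_size.
Qed.

Definition self_exchange o t : R := rexchange (branch s o) (branch s o) t.

Lemma self_exchangeE o t : 0 < t ->
  self_exchange o t = rexchange unit_cube unit_cube t +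
    2 * (\sum_(v <- free_faces o) rexchange unit_cube (limb s v) t) +
    \sum_(v <- free_faces o) \sum_(w <- free_faces o) rexchange (limb s v) (limb s w) t.
Proof.
move=> t0; set L := limbs (free_faces o).
have hQ := finite_volume_cube; have hL := finite_volume_limbs (free_faces o).
have dis : unit_cube `&` L = set0.
  apply/seteqP; split => x // -[hx /limbsP[v _ hv]].
  have := limb_beyond s_gt0 s_small hv; have := unit_cube_near v hx.
  by move=> /lt_trans /[apply]; rewrite ltxx.
rewrite /self_exchange branch_limbs -/L.
have hU := finite_volumeU hQ hL.
have hl v := finite_volume_limb v.
have EQL : rexchange L unit_cube t = \sum_(v <- free_faces o) rexchange unit_cube (limb s v) t.
  rewrite (rexchange_limbsl t0 (uniq_free o) hQ); apply: eq_bigr => v _.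
  exact: rexchangeC (hl v) hQ.
have ELL : rexchange L L t =
    \sum_(v <- free_faces o) \sum_(w <- free_faces o) rexchange (limb s v) (limb s w) t.
  rewrite (rexchange_limbsl t0 (uniq_free o) hL); apply: eq_bigr => v _.
  rewrite (rexchangeC t (hl v) hL) (rexchange_limbsl t0 (uniq_free o) (hl v)).
  by apply: eq_bigr => w _; exact: rexchangeC (hl w) (hl v).
rewrite (rexchangeUl t0 hQ hL hU dis) (rexchangeC t hQ hU) (rexchangeC t hL hU).
rewrite (rexchangeUl t0 hQ hL hQ dis) (rexchangeUl t0 hQ hL hL dis).
rewrite (rexchangeC t hQ hL) EQL ELL.
by ring.
Qed.

Lemma limb_self v t : 0 < t ->
  rexchange (limb s v) (limb s v) t = s ^+ 3 * self_exchange (Some v) (t / s ^+ 2).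
Proof.
move=> t0; have ts0 : 0 < t / s ^+ 2 by rewrite divr_gt0// exprn_gt0.
have hv := finite_volume_limb v; have hb := finite_volume_branch (Some v).
have mb := measurable_branch s (Some v).
have Ezoom : exchange (limb s v) (limb s v) t = ((s ^+ 3)%:E *
    exchange (branch s (Some v)) (branch s (Some v)) (t / s ^+ 2))%E.
  exact: exchange_zoom.
by apply: rexchange_val; rewrite Ezoom (rexchangeK ts0 hb hb) -EFinM.
Qed.

Lemma next_cubeE v : next_cube s v =
  (if v.1 == ord0 then next_itv s v.2 else centred_itv s) `*`
  (if v.1 == o1 then next_itv s v.2 else centred_itv s) `*`
  (if v.1 == o2 then next_itv s v.2 else centred_itv s) :> set X3.
Proof.
have side (x : X3) k : (`|crd (zoom s v x) k| < 2^-1) =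
    (crd x k \in (if v.1 == k then next_itv s v.2 else centred_itv s)).
  rewrite (crd_zoom s_gt0 v x k); move: (crd _ k) => z.
  have -> : (`|z| < 2^-1) = (- (s / 2) < s * z < s / 2).
    have -> : (`|z| < 2^-1) = (`|s * z| < s / 2).
      by rewrite normrM gtr0_norm// ltr_pM2l.
    by rewrite ltr_norml.
  case: (v.1 == k); last first.
    by rewrite mul0r mulr0 add0r /centred_itv mem_setE in_itv.
  rewrite mul1r /next_itv /sgn; case: v.2; rewrite mem_setE in_itv/=.
    by rewrite expr1; apply/andP/andP => -[? ?]; split; lra.
  by rewrite expr0; apply/andP/andP => -[? ?]; split; lra.
apply/seteqP; split => [x h|x [[h0 h1] h2] k].
  have h0 := h ord0; have h1 := h o1; have h2 := h o2.
  rewrite !side !inE in h0 h1 h2.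
  by split; [split|].
rewrite side inE.
by case: (ord3P k) => ->.
Qed.

Lemma cube_next v : exists C : R, 0 <= C /\ forall t, 0 < t -> t <= 1 ->
  `|rexchange unit_cube (next_cube s v) t - s ^+ 2 * face_loss t| <= C * t32 t.
Proof.
have [C [C0 HC]] := cube_next_exchange v.2 s_gt0 (s_lt1 s_small).
exists C; split=> // t t0 t1; have [x [Hx hx]] := HC t t0 t1.
suff -> : rexchange unit_cube (next_cube s v) t = x by [].
have mU : measurable (unit_itv : set X1) by exact: measurable_itv.
have mC : measurable (centred_itv s : set X1) by exact: measurable_itv.
have mN : measurable (next_itv s v.2 : set X1).
  by rewrite /next_itv; case: v.2; exact: measurable_itv.
apply: rexchange_val.
have mI k : measurable (if v.1 == k then next_itv s v.2 else centred_itv s : set X1).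
  by case: ifP.
rewrite unit_cubeE next_cubeE (exchange_product t0 mU mU mU (mI _) (mI _) (mI _)).
move: Hx; clear; case: v => k b /=; case: (ord3P k) => -> /= Hx.
- by rewrite Hx.
- by rewrite (muleC (line_exchange unit_itv (centred_itv s) t)) Hx.
- by rewrite muleC muleA Hx.
Qed.

Lemma cube_self : exists C : R, 0 <= C /\ forall t, 0 < t -> t <= 1 ->
  `|rexchange unit_cube unit_cube t - (1 - 6 * face_loss t + 12 / pi * t)| <= C * t32 t.
Proof.
have [C [C0 HC]] := @cube_self_exchange R.
exists C; split=> // t t0 t1; have [x [Hx hx]] := HC t t0 t1.
suff -> : rexchange unit_cube unit_cube t = x by [].
have mU : measurable (unit_itv : set X1) by exact: measurable_itv.
apply: rexchange_val.
by rewrite unit_cubeE (exchange_product t0 mU mU mU mU mU mU) Hx.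
Qed.

Lemma sum6_le (r : seq face) (P : pred face) (F : face -> R) (K : R) :
  0 <= K -> (size r <= 6)%N -> (forall v, P v -> F v <= K) ->
  \sum_(v <- r | P v) F v <= 6 * K.
Proof.
move=> K0 r6 FK; apply: (@le_trans _ _ ((size r)%:R * K)); last first.
  by rewrite ler_wpM2r// ler_nat.
elim: r {r6} => [|v r IH]; first by rewrite big_nil mul0r.
rewrite big_cons /= -addn1 natrD mulrDl mul1r.
case: ifP => Pv; first by rewrite addrC lerD// FK.
by apply: le_trans IH _; rewrite lerDl.
Qed.

Lemma limb_split v t : 0 < t -> rexchange unit_cube (limb s v) t =
  rexchange unit_cube (next_cube s v) t + rexchange unit_cube (limb_tip s v) t.
Proof.
move=> t0; have hQ := finite_volume_cube; have hl := finite_volume_limb v.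
have hn := finite_volume_sub (measurable_next_cube v) (@next_cube_limb v) hl.
have ht := finite_volume_sub (measurable_limb_tip v) (@limb_tip_limb v) hl.
have dis : next_cube s v `&` limb_tip s v = set0.
  apply/seteqP; split => x // -[hx [w _ hw]].
  have := limb_beyond s_gt0 s_small hw; have := unit_cube_near w hx.
  by move=> /lt_trans /[apply]; rewrite ltxx.
have E : limb s v = next_cube s v `|` limb_tip s v.
  by apply/seteqP; split => x; rewrite limbE.
rewrite (rexchangeC t hQ hn) (rexchangeC t hQ ht) -(rexchangeUl t0 hn ht hQ dis) -E.
exact: rexchangeC.
Qed.

(** A branch is its root together with its limbs. Distinct limbs are at a positive
    distance, and so are the root and the part of a limb beyond its first cube; these
    pairs only contribute to the error. There remain the root with itself, the root
    with the first cube of each limb, counted twice by symmetry, and each limb with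
    itself, which is a branch at the scale s. *)
Lemma self_exchange_recursion : exists C : R, 0 <= C /\ forall o t, 0 < t -> t <= 1 ->
  `|self_exchange o t - (1 - 6 * face_loss t + 12 / pi * t +
     \sum_(v <- free_faces o) (2 * (s ^+ 2 * face_loss t) +
        s ^+ 3 * self_exchange (Some v) (t / s ^+ 2)))| <= C * t32 t.
Proof.
have g0 := gap_gt0 s_small.
have [Kg [Kg0 HKg]] := heat_kernel_far g0.
have [Kt [Kt0 HKt]] := heat_kernel_far (mulr_gt0 s_gt0 g0).
have [Cs [Cs0 HCs]] := cube_self.
have [Cn HCn] := choice cube_next.
pose CN := \sum_(v : face) Cn v.
have CN0 : 0 <= CN by apply: sumr_ge0 => v _; case: (HCn v).
have CnN v : Cn v <= CN.
  rewrite /CN (bigD1 v)//= lerDl; apply: sumr_ge0 => w _; by case: (HCn w).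
pose G := Kg * V * V; pose T := Kt * V * V.
have G0 : 0 <= G by rewrite mulr_ge0// mulr_ge0.
have T0 : 0 <= T by rewrite mulr_ge0// mulr_ge0.
exists (Cs + 6 * (2 * (CN + T)) + 6 * (6 * G)); split.
  by move: Cs0 CN0 G0 T0; clearbody G T CN; lra.
move=> o t t0 t1; have /andP[e0 _] := t32_bound t0 t1.
set eps := t32 t in e0 *; set l := face_loss t; set r := free_faces o.
have r6 : (size r <= 6)%N := size_free o.
have far v w : v != w -> 0 <= rexchange (limb s v) (limb s w) t <= G * eps.
  move=> vw; rewrite rexchange_ge0/= /G.
  have -> : Kg * V * V * eps = Kg * eps * V * V by ring.
  apply: (@rexchange_le _ _ t (Kg * eps) V t0 (mulr_ge0 Kg0 e0) V0 (measurable_limb s v)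
    (measurable_limb s w) (volume_limb v) (volume_limb w)) => x y hx hy.
  by apply: HKg => //; exact: limbs_apart hx hy.
have tip v : 0 <= rexchange unit_cube (limb_tip s v) t <= T * eps.
  rewrite rexchange_ge0/= /T.
  have -> : Kt * V * V * eps = Kt * eps * V * V by ring.
  apply: (@rexchange_le _ _ t (Kt * eps) V t0 (mulr_ge0 Kt0 e0) V0 measurable_unit_cube
    (measurable_limb_tip v) volume_cube_le (volume_limb_tip v)) => x y hx hy.
  by apply: HKt => //; exact: limb_tip_apart hx hy.
have next v : `|2 * rexchange unit_cube (limb s v) t - 2 * (s ^+ 2 * l)| <= 2 * (CN + T) * eps.
  rewrite -mulrBr normrM ger0_norm// -mulrA ler_wpM2l//.
  rewrite limb_split// addrAC; apply: le_trans (ler_normD _ _) _; rewrite mulrDl.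
  have /andP[tip0 tip1] := tip v.
  apply: lerD; last by rewrite ger0_norm.
  by apply: le_trans ((HCn v).2 t t0 t1) _; rewrite ler_wpM2r.
have := HCs t t0 t1; rewrite -/eps -/l => self.
pose off v := \sum_(w <- r | w != v) rexchange (limb s v) (limb s w) t.
have off_bound v : 0 <= off v <= 6 * (G * eps).
  apply/andP; split; first by apply: sumr_ge0 => w _; exact: rexchange_ge0.
  apply: sum6_le => //; first by rewrite mulr_ge0.
  by move=> w wv; rewrite eq_sym in wv; have /andP[] := far v w wv.
have alg (h q z S1 SS D O C X Y : R) : h = q + 2 * S1 + SS -> SS = D + O ->
    X = C + D -> Y = 2 * S1 - C -> h - (z + X) = q - z + Y + O.
  by move=> -> -> -> ->; ring.
have pairs : \sum_(v <- r) \sum_(w <- r) rexchange (limb s v) (limb s w) t =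
    \sum_(v <- r) s ^+ 3 * self_exchange (Some v) (t / s ^+ 2) + \sum_(v <- r) off v.
  rewrite -big_split/= big_seq [RHS]big_seq; apply: eq_bigr => v vr.
  by rewrite (bigD1_seq v vr (uniq_free o))/= (limb_self v t0).
have sum_next : \sum_(v <- r) (2 * rexchange unit_cube (limb s v) t - 2 * (s ^+ 2 * l)) =
    2 * (\sum_(v <- r) rexchange unit_cube (limb s v) t) - \sum_(v <- r) 2 * (s ^+ 2 * l).
  by rewrite sumrB mulr_sumr.
rewrite (alg _ _ _ _ _ _ _ _ _ _ (self_exchangeE o t0) pairs (big_split _ _ _ _ _) sum_next).
apply: le_trans (ler_normD _ _) _; rewrite [leRHS]mulrDl; apply: lerD; last first.
  rewrite ger0_norm; last by apply: sumr_ge0 => v _; case/andP: (off_bound v).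
  have -> : 6 * (6 * G) * eps = 6 * (6 * (G * eps)) by ring.
  apply: sum6_le => //; first by rewrite mulr_ge0// mulr_ge0.
  by move=> v _; case/andP: (off_bound v).
apply: le_trans (ler_normD _ _) _; rewrite [leRHS]mulrDl; apply: lerD => //.
apply: le_trans (ler_norm_sum _ _ _) _.
have -> : 6 * (2 * (CN + T)) * eps = 6 * (2 * (CN + T) * eps) by ring.
by apply: sum6_le => //; rewrite mulr_ge0// mulr_ge0// addr_ge0.
Qed.

Lemma self_exchange_continuous o t : 0 < t -> {for t, continuous (self_exchange o)}.
Proof.
by have [mb fb] := finite_volume_branch o => t0; exact: (rexchange_continuous mb mb fb fb).
Qed.

Lemma self_exchange_bounded : exists M : R, 0 <= M /\ forall o t, 1 <= t ->
  0 <= self_exchange o t <= M.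
Proof.
exists (V * V); split=> [|o t t1]; first by rewrite mulr_ge0.
rewrite /self_exchange rexchange_ge0/= -[V * V]mul1r mulrA.
have t0 : 0 < t by apply: lt_le_trans t1.
apply: (@rexchange_le _ _ t 1 V t0 ler01 V0 (measurable_branch s o)
  (measurable_branch s o) (volume_branch o) (volume_branch o)).
move=> x y _ _; apply: le_trans (heat_kernel_le x y (ltW t0)) _.
rewrite powRN invf_le1 ?powR_gt0 ?mulr_gt0 ?pi_gt0//.
have pt1 : 1 <= 4 * pi * t by rewrite mulr_ege1//; have := @pi_ge2 R; lra.
by rewrite -[leLHS](powRr0 (4 * pi * t)) ler_powR// divr_ge0.
Qed.

End Recursion.

(** * Asymptotically periodic functions *)

Section Renewal.
Context {R : realType}.

Lemma geometric_small (q A eps : R) : 2 <= q -> 0 < eps -> exists N, A / q ^+ N < eps.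
Proof.
move=> q2 eps0; have q0 : 0 < q by apply: lt_le_trans q2.
exists (Num.truncn (A / eps)).+1; set N := (Num.truncn _).+1.
rewrite ltr_pdivrMr ?exprn_gt0// mulrC -ltr_pdivrMr//.
apply: lt_le_trans (truncnS_gt _) _; rewrite -/N.
apply: (@le_trans _ _ (2 ^+ N)).
  by rewrite -natrX ler_nat; apply: ltnW; exact: ltn_expl.
by rewrite lerXn2r ?nnegrE// ltW.
Qed.

(** A function that is almost invariant under a translation, with an error that
    decays in the opposite direction, is asymptotic to a periodic function: the
    limit of its translates. When each translation divides the error by at least 2,
    the sum of the errors is at most K exp (k x). *)
Lemma asymptotically_periodic (g : R -> R) (L k K : R) :
  continuous g -> 0 <= k -> 0 <= K -> 2 <= expR (k * L) ->
  (forall x, `|g x - g (x + L)| <= K * expR (k * x)) ->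
  exists p : R -> R, [/\ continuous p, periodic p L &
    forall x, `|g x - p x| <= K * expR (k * x)].
Proof.
move=> cg k0 K0; set q := expR (k * L) => q2 hg.
have q0 : 0 < q by exact: expR_gt0.
have q_ge0 : 0 <= q by exact: ltW.
pose u (x : R) (n : nat) := g (x - n%:R * L).
pose A x := K * expR (k * x).
have A0 x : 0 <= A x by rewrite mulr_ge0 ?expR_ge0.
have step x n : `|u x n.+1 - u x n| <= A x / q ^+ n.+1.
  have := hg (x - n.+1%:R * L); rewrite -/(u x n.+1).
  have -> : x - n.+1%:R * L + L = x - n%:R * L by rewrite -natr1; ring.
  rewrite -/(u x n) => h; apply: le_trans h _; rewrite /A mulrBr expRD.
  have -> : - (k * (n.+1%:R * L)) = - (n.+1%:R * (k * L)) by ring.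
  by rewrite expRN expRM_natl mulrA.
have far x n m : `|u x (n + m)%N - u x n| <= A x / q ^+ n - A x / q ^+ (n + m).
  elim: m => [|m IH]; first by rewrite addn0 !subrr normr0.
  rewrite addnS; have := step x (n + m)%N; move: IH.
  have -> : A x / q ^+ (n + m) = q * (A x / q ^+ (n + m).+1).
    by rewrite exprS; field; rewrite expf_neq0 gt_eqF.
  have B0 : 0 <= A x / q ^+ (n + m).+1 by rewrite divr_ge0 ?exprn_ge0.
  have := ler_wpM2r B0 q2.
  rewrite !ler_norml => h0 /andP[h1 h2] /andP[h3 h4]; apply/andP; split; lra.
have cauchy_u x : cvgn (u x).
  apply: cauchy_cvg; apply: cauchy_exP => eps eps0.
  have [N hN] := geometric_small (A x) q2 eps0.
  exists (u x N); exists N => // n /= Nn.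
  rewrite /ball/= distrC; apply: le_lt_trans hN; rewrite -(subnKC Nn).
  by apply: le_trans (far x N _) _; rewrite gerBl divr_ge0 ?exprn_ge0.
pose p x := limn (u x).
have pu x : u x @ \oo --> p x by exact: cauchy_u.
have dist x n : `|p x - u x n| <= A x / q ^+ n.
  have : `|u x m - u x n| @[m --> \oo] --> `|p x - u x n|.
    by apply: cvg_norm; apply: cvgB; [exact: pu|exact: cvg_cst].
  apply: (closed_cvg (fun y => y <= A x / q ^+ n)); first exact: closed_le.
  exists n => // m /= nm; rewrite -(subnKC nm).
  by apply: le_trans (far x n _) _; rewrite gerBl divr_ge0 ?exprn_ge0.
exists p; split.
- move=> x; apply/cvgrPdist_lt => eps eps0.
  have e3 : 0 < eps / 3 by rewrite divr_gt0.
  have [N hN] := geometric_small (A (x + 1)) q2 e3.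
  have cu : {for x, continuous (fun y => u y N)}.
    apply: (@continuous_comp _ _ _ (fun y => y - N%:R * L) g); last exact: cg.
    by apply: cvgB; [exact: cvg_id|exact: cvg_cst].
  have uniform y : y <= x + 1 -> `|p y - u y N| < eps / 3.
    move=> yx; apply: le_lt_trans (dist y N) _; apply: le_lt_trans hN.
    rewrite ler_pM2r ?invr_gt0 ?exprn_gt0// /A ler_wpM2l// ler_expR.
    by rewrite ler_wpM2l.
  near=> y.
  have h1 : `|p x - u x N| < eps / 3 by apply: uniform; rewrite lerDl.
  have h2 : `|p y - u y N| < eps / 3.
    by apply: uniform; apply: ltW; near: y; apply: lt_nbhsl; rewrite ltrDl.
  have h3 : `|u x N - u y N| < eps / 3.
    by near: y; move/cvgrPdist_lt : cu; exact.
  have -> : p x - p y = (p x - u x N) + (u x N - u y N) - (p y - u y N) by ring.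
  apply: le_lt_trans (ler_normB _ _) _.
  have := ler_normD (p x - u x N) (u x N - u y N).
  lra.
- move=> x; have h1 : u (x + L) n.+1 @[n --> \oo] --> p (x + L).
    by rewrite (cvg_shiftS (u (x + L))); exact: pu.
  apply: (@cvg_unique _ (@Rhausdorff R) (u x @ \oo)) => //; last exact: pu.
  have -> : u x = (fun n => u (x + L) n.+1) by apply/funext => n; rewrite /u -natr1; congr g; ring.
  exact: h1.
- move=> x; have := dist x 0%N; rewrite /u mul0r subr0 expr0 divr1 distrC.
  exact.
Unshelve. all: by end_near.
Qed.

End Renewal.

(** * Asymptotics of the branches *)

Section BranchAsymptotics.
Context {R : realType}.
Variable s : R.
Hypothesis s_gt0 : 0 < s.
Hypothesis s_small : s ^+ 2 + 2 * s < 1.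
Hypothesis s5 : s != 5^-1.

Let s_lt12 : s < 2^-1.
Proof. by have := s_small; have := sqr_ge0 s; lra. Qed.

Lemma five_squares_lt : 5 * s ^+ 2 < 1.
Proof.
have h := s_small.
have E : (5 / 12) ^+ 2 = 25 / 144 :> R by field.
have h1 : s < 5 / 12.
  rewrite ltNge; apply/negP => h2.
  have : (5 / 12) ^+ 2 <= s ^+ 2 by rewrite ler_pXn2r ?nnegrE ?divr_ge0// ltW.
  by rewrite E; lra.
have : s ^+ 2 < (5 / 12) ^+ 2 by rewrite ltr_pXn2r ?nnegrE ?divr_ge0// ltW.
by rewrite E; lra.
Qed.

Lemma five_cubes_lt : 5 * s ^+ 3 < 1.
Proof.
have -> : 5 * s ^+ 3 = s * (5 * s ^+ 2) by ring.
have s1 : s <= 1 by have := s_lt12; lra.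
by apply: le_lt_trans five_squares_lt; rewrite ler_piMl// mulr_ge0 ?sqr_ge0.
Qed.

Lemma five_sides_neq : 1 - 5 * s != 0.
Proof.
apply: contra s5 => /eqP h; apply/eqP.
have h2 : 5 * s = 1 by apply/eqP; rewrite eq_sym -subr_eq0 h.
by rewrite -[LHS](mulKf (x := 5)) ?h2 ?mulr1.
Qed.

Lemma sum_face_const (c : R) : \sum_(u : face) c = 6 * c.
Proof. by rewrite sumr_const card_prod card_ord card_bool mulr_natl. Qed.

Lemma sum_free_faces (f : face -> R) :
  \sum_(u : face) \sum_(v <- free_faces (Some u)) f v = 5 * \sum_(v : face) f v.
Proof.
have oppK : involutive opposite by case=> i b; rewrite /opposite/= negbK.
have inner u : \sum_(v <- free_faces (Some u)) f v = \sum_(v : face) f v - f (opposite u).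
  rewrite /free_faces big_filter big_enum_cond/=.
  by rewrite [in RHS](bigD1 (opposite u))//= [RHS]addrAC subrr add0r.
under eq_bigr do rewrite inner.
rewrite sumrB sum_face_const.
have -> : \sum_(u : face) f (opposite u) = \sum_(u : face) f u.
  by rewrite [RHS](reindex_inj (inv_inj oppK)).
by ring.
Qed.

(** The total self-exchange of the six branches. Every face carries a limb in five of them,
    which is why summing over the branches closes the recursion. *)
Definition total t : R := \sum_(u : face) self_exchange s (Some u) t.

Lemma total_recursion : exists C : R, 0 <= C /\ forall t, 0 < t -> t <= 1 ->
  `|total t - (6 * (1 - 6 * face_loss t + 12 / pi * t) + 60 * (s ^+ 2 * face_loss t) +
     5 * s ^+ 3 * total (t / s ^+ 2))| <= C * t32 t.
Proof.
have [C [C0 HC]] := self_exchange_recursion s_gt0 s_small.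
exists (6 * C); split=> [|t t0 t1]; first by rewrite mulr_ge0.
set l := face_loss t; set q := 1 - 6 * l + 12 / pi * t.
pose F v := 2 * (s ^+ 2 * l) + s ^+ 3 * self_exchange s (Some v) (t / s ^+ 2).
have -> : 6 * q + 60 * (s ^+ 2 * l) + 5 * s ^+ 3 * total (t / s ^+ 2) =
    \sum_(u : face) (q + \sum_(v <- free_faces (Some u)) F v).
  rewrite big_split/= sum_free_faces sum_face_const /F big_split/= sum_face_const -mulr_sumr.
  have -> : \sum_(v : face) self_exchange s (Some v) (t / s ^+ 2) = total (t / s ^+ 2) by [].
  by move: (total _) => T; ring.
rewrite /total -sumrB; apply: le_trans (ler_norm_sum _ _ _) _.
apply: (@le_trans _ _ (\sum_(u : face) C * t32 t)).
  by apply: ler_sum => u _; exact: HC.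
by rewrite sum_face_const mulrA.
Qed.

Lemma total_continuous t : 0 < t -> {for t, continuous total}.
Proof.
move=> t0; rewrite /total; elim: (index_enum _) => [|u r IH].
  rewrite (_ : (fun t => _) = cst 0); first exact: cvg_cst.
  by apply/funext => z; rewrite big_nil.
rewrite (_ : (fun t => _) =
    (fun t => self_exchange s (Some u) t + \sum_(v <- r) self_exchange s (Some v) t)).
  by apply: cvgD; [exact: self_exchange_continuous|exact: IH].
by apply/funext => z; rewrite big_cons.
Qed.

Lemma total_bounded : exists M : R, 0 <= M /\ forall t, 1 <= t -> 0 <= total t <= M.
Proof.
have [M [M0 HM]] := self_exchange_bounded s_gt0 s_small.
exists (6 * M); split=> [|t t1]; first by rewrite mulr_ge0.
rewrite -sum_face_const /total; apply/andP; split.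
  by apply: sumr_ge0 => v _; case/andP: (HM (Some v) t t1).
by apply: ler_sum => v _; case/andP: (HM (Some v) t t1).
Qed.

(** The terms of the recursion are dominated one by one by multiples of e, which
    stands for t^(3/2) with t at least 1. *)
Lemma large_time_bound (T M M' l e c x1 x2 x3 x4 x5 x6 : R) :
  0 <= T -> T <= M -> M <= M' -> 0 <= l -> l <= e -> 1 <= e -> 0 <= c ->
  0 <= x1 -> x1 <= x2 -> 0 <= x3 -> x3 <= x4 -> 0 <= x5 -> x5 <= x6 ->
  `|T - (6 * (1 - 6 * l + 12 * x3) + 60 * x5 + x1)| <=
  c + (M' + x2 + 6 * e + 36 * e + 72 * x4 + 60 * x6).
Proof. by move=> *; rewrite ler_norml; apply/andP; split; lra. Qed.

Opaque total.

(** The power t^dimension solves the homogeneous equation w t = 5 s^3 w (t / s^2). *)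
Definition dimension : R := 3 / 2 + 1 / 2 * (ln 5 / ln s).

(** The first three terms are particular solutions of the recursion for a constant, a
    multiple of sqrt t and a multiple of t. The remainder w satisfies the homogeneous
    equation up to t^(3/2), for all times because everything is bounded for large
    times. In the variable x = ln t the quotient of w by t^dimension is then
    invariant under the translation by L up to an error of order exp (k x), where
    k = 3/2 - dimension > 0. *)
Lemma total_asymptotics : exists p : R -> R,
  [/\ continuous p, periodic p (ln (s ^- 2)) &
   exists C : R, 0 <= C /\ forall t, 0 < t -> t <= 1 ->
    `|total t - (6 / (1 - 5 * s ^+ 3)
        + (60 * s ^+ 2 - 36) / (1 - 5 * s ^+ 2) * face_loss t
        + 72 / pi / (1 - 5 * s) * t + p (ln t) * t `^ dimension)| <= C * t32 t].
Proof.
have [C [C0 HC]] := total_recursion.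
have [M6 [M60 HM]] := total_bounded.
have h2 := five_squares_lt; have h3 := five_cubes_lt; have hs1 := five_sides_neq.
have s12 := s_lt12.
have s0 := s_gt0; have s_neq0 : s != 0 by rewrite gt_eqF.
have n2 : 1 - 5 * s ^+ 2 != 0 by rewrite subr_eq0 eq_sym lt_eqF.
have n3 : 1 - 5 * s ^+ 3 != 0 by rewrite subr_eq0 eq_sym lt_eqF.
pose al := 6 / (1 - 5 * s ^+ 3).
pose be := (60 * s ^+ 2 - 36) / (1 - 5 * s ^+ 2).
pose ga := 72 / pi / (1 - 5 * s).
pose w t := total t - (al + be * face_loss t + ga * t).
pose r t := w t - 5 * s ^+ 3 * w (t / s ^+ 2).
have lossE t : 0 < t -> face_loss (t / s ^+ 2) = face_loss t / s.
  move=> t0; rewrite /face_loss sqrtrM ?(ltW t0)// sqrtrV ?sqr_ge0//.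
  by rewrite sqrtr_sqr gtr0_norm//; ring.
have rE t : 0 < t -> r t = total t - (6 * (1 - 6 * face_loss t + 12 / pi * t) +
    60 * (s ^+ 2 * face_loss t) + 5 * s ^+ 3 * total (t / s ^+ 2)).
  move=> t0; rewrite /r /w lossE// /al /be /ga.
  move: (total t) (total (t / s ^+ 2)) (face_loss t) => T T' l.
  have : pi != 0 :> R by rewrite gt_eqF// pi_gt0.
  move: (pi : R) => P P0.
  field.
  by rewrite ?hs1 ?n2 ?n3 ?s_neq0 ?P0.
have [K [K0 HK]] : exists K, 0 <= K /\ forall t, 0 < t -> `|r t| <= K * t32 t.
  pose B := M6 + 5 * s ^+ 3 * M6 + 6 + 36 + 72 / pi + 60 * s ^+ 2.
  have pi0 : 0 < pi :> R := pi_gt0 R.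
  have sc0 : 0 <= 5 * s ^+ 3 by rewrite mulr_ge0 ?exprn_ge0// ltW.
  have B0 : 0 <= B.
    have b1 : 0 <= 5 * s ^+ 3 * M6 by rewrite mulr_ge0.
    have b2 : 0 <= 72 / pi :> R by rewrite divr_ge0// ltW.
    have b3 : 0 <= 60 * s ^+ 2 by rewrite mulr_ge0 ?sqr_ge0.
    by rewrite /B; lra.
  exists (C + B); split=> [|t t0]; first exact: addr_ge0.
  case: (leP t 1) => [t1|/ltW t1].
    rewrite rE//; apply: le_trans (HC t t0 t1) _.
    by have /andP[e0 _] := t32_bound t0 t1; rewrite ler_wpM2r// lerDl.
  have q1 : 1 <= Num.sqrt t by rewrite -[leLHS]sqrtr1 ler_wsqrtr.
  have T1 : t <= t32 t by rewrite /t32 ler_peMr// ltW.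
  have T0 : 1 <= t32 t by apply: le_trans T1.
  have l0 : 0 <= face_loss t <= t32 t.
    rewrite /face_loss divr_ge0 ?sqrtr_ge0//= ler_pdivrMr ?sqrt_pi_gt0//.
    have : Num.sqrt t <= t32 t by rewrite /t32 ler_peMl ?sqrtr_ge0.
    move=> /le_trans; apply; rewrite ler_peMr ?sqrt_pi_ge1//.
    exact: le_trans T0.
  have ts1 : 1 <= t / s ^+ 2.
    rewrite ler_pdivlMr ?exprn_gt0// mul1r (le_trans _ t1)// expr_le1// ?(ltW s0)//.
    by lra.
  have /andP[a0 a1] := HM _ t1; have /andP[b0 b1] := HM _ ts1.
  have /andP[l00 l1] := l0.
  have sq0 : 0 <= s ^+ 2 by rewrite sqr_ge0.
  have bnd (c z : R) : 0 <= c -> 0 <= z <= t32 t -> 0 <= c * z <= c * t32 t.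
    by move=> c0 /andP[z0 z1]; rewrite mulr_ge0//= ler_wpM2l.
  have ip : 0 <= pi^-1 :> R by rewrite invr_ge0 ltW.
  have t0T : 0 <= t <= t32 t by rewrite T1 ltW.
  have /andP[c1 c2] := bnd _ _ ip t0T.
  have /andP[c3 c4] := bnd _ _ sq0 l0.
  have /andP[c5 c6] : 0 <= 5 * s ^+ 3 * total (t / s ^+ 2) <= 5 * s ^+ 3 * M6 * t32 t.
    rewrite mulr_ge0//= -[leRHS]mulrA ler_wpM2l//; apply: le_trans b1 _.
    by rewrite ler_peMr.
  have d1 : M6 <= M6 * t32 t by rewrite ler_peMr.
  have CT : 0 <= C * t32 t by rewrite mulr_ge0// (le_trans ler01).
  have BE : B * t32 t = M6 * t32 t + 5 * s ^+ 3 * M6 * t32 t + 6 * t32 t + 36 * t32 t +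
     72 * (pi^-1 * t32 t) + 60 * (s ^+ 2 * t32 t) by rewrite /B; ring.
  rewrite mulrDl BE rE//.
  have -> : 12 / pi * t = 12 * (pi^-1 * t) by ring.
  exact: large_time_bound a0 a1 d1 l00 l1 T0 CT c5 c6 c1 c2 c3 c4.
pose L := ln (s ^- 2); pose k := 3 / 2 - dimension.
have lns : ln s < 0 by rewrite ln_lt0// s0/=; lra.
have LE : L = - 2 * ln s.
  by rewrite /L lnV ?posrE ?exprn_gt0// lnXn// mulNr mulr_natl.
have kL : expR (k * L) = 5.
  have -> : k * L = ln 5 by rewrite LE /k /dimension; field; rewrite lt_eqF.
  by rewrite lnK// posrE.
have eL : expR L = s ^- 2 by rewrite /L lnK// posrE invr_gt0 exprn_gt0.
have dL : expR (- (dimension * L)) = 5 * s ^+ 3.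
  have -> : - (dimension * L) = ln 5 + 3 * ln s.
    by rewrite LE /dimension; field; rewrite lt_eqF.
  by rewrite expRD lnK ?posrE// expRM_natl lnK.
have k0 : 0 <= k.
  have -> : k = 2^-1 * (ln 5 / - ln s) by rewrite /k /dimension; field; rewrite lt_eqF.
  rewrite mulr_ge0// divr_ge0// ?oppr_ge0 ?(ltW lns)//.
  by rewrite ln_ge0// ler1n.
pose g x := expR (- (dimension * x)) * w (expR x).
have cg : continuous g.
  move=> x; apply: cvgM.
    apply: (@continuous_comp _ _ _ (fun x : R => - (dimension * x)) expR).
      by apply: cvgN; apply: cvgM; [exact: cvg_cst|exact: cvg_id].
    exact: continuous_expR.
  apply: (@continuous_comp _ _ _ expR w); first exact: continuous_expR.
  apply: cvgB; first exact: total_continuous (expR_gt0 x).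
  apply: cvgD; last by apply: cvgM; [exact: cvg_cst|exact: cvg_id].
  apply: cvgD; first exact: cvg_cst.
  apply: cvgM; first exact: cvg_cst.
  by apply: cvgM; [exact: sqrt_continuous|exact: cvg_cst].
have t32E x : t32 (expR x) = expR (3 / 2 * x).
  have -> : 3 / 2 * x = x + 2^-1 * x by field.
  rewrite expRD /t32; congr (_ * _).
  by rewrite mulrC expRM powR12_sqrt// expR_ge0.
have hg x : `|g x - g (x + L)| <= K * expR (k * x).
  have -> : g x - g (x + L) = expR (- (dimension * x)) * r (expR x).
    have E1 : expR (- (dimension * (x + L))) = expR (- (dimension * x)) * (5 * s ^+ 3).
      by rewrite mulrDr opprD expRD dL.
    have E2 : expR (x + L) = expR x / s ^+ 2 by rewrite expRD eL.
    rewrite /g /r E1 E2; move: (w (expR x)) (w _) => w1 w2; ring.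
  rewrite normrM gtr0_norm ?expR_gt0//.
  apply: le_trans (ler_wpM2l (expR_ge0 _) (HK _ (expR_gt0 x))) _.
  rewrite t32E mulrCA -expRD le_eqVlt; apply/orP; left; apply/eqP.
  by congr (_ * expR _); rewrite /k; ring.
have q2 : 2 <= expR (k * L) by rewrite kL; lra.
have [p [cp pp hp]] := asymptotically_periodic cg k0 K0 q2 hg.
exists p; split=> //; exists K; split=> // t t0 t1.
have powE : t `^ dimension = expR (dimension * ln t) by rewrite /powR gt_eqF.
have -> : total t - (al + be * face_loss t + ga * t + p (ln t) * t `^ dimension) =
    t `^ dimension * (g (ln t) - p (ln t)).
  have -> : total t - (al + be * face_loss t + ga * t + p (ln t) * t `^ dimension) =
     w t - p (ln t) * t `^ dimension by rewrite /w; ring.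
  rewrite mulrBr [t `^ _ * p _]mulrC; congr (_ - _).
  by rewrite /g powE lnK ?posrE// expRN mulVKf// gt_eqF// expR_gt0.
rewrite normrM ger0_norm ?powR_ge0//.
apply: le_trans (ler_wpM2l (powR_ge0 _ _) (hp _)) _.
rewrite powE mulrCA -expRD le_eqVlt; apply/orP; left; apply/eqP; congr (_ * _).
have -> : dimension * ln t + k * ln t = 3 / 2 * ln t by rewrite /k; ring.
by rewrite -t32E lnK ?posrE.
Qed.

(** One more step of the recursion, from the six branches to the initial cube with its
    six limbs. *)
Lemma initial_asymptotics : exists p : R -> R,
  [/\ continuous p, periodic p (ln (s ^- 2)) &
   exists C : R, 0 <= C /\ forall t, 0 < t -> t <= s ^+ 2 ->
    `|self_exchange s None t - ((1 + s ^+ 3) / (1 - 5 * s ^+ 3)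
        - 6 * ((1 - s ^+ 2) / (1 - 5 * s ^+ 2)) * face_loss t
        + 12 / pi * ((1 + s) / (1 - 5 * s)) * t
        + 6 * p (ln t) * t `^ dimension)| <= C * t32 t].
Proof.
have [C [C0 HC]] := self_exchange_recursion s_gt0 s_small.
have [p [cp pp [K [K0 HK]]]] := total_asymptotics.
(* The scaling step divides the oscillating term by 5, and the factor 6 of the
   conclusion divides it once more. *)
exists (fun x => p x / 30); split.
- by move=> x; apply: cvgM; [exact: cp|exact: cvg_cst].
- by move=> x; rewrite pp.
exists (C + K); split=> [|t t0 ts]; first exact: addr_ge0.
have s1 : s < 1 by have := s_lt12; lra.
have s_neq0 : s != 0 by rewrite gt_eqF.
have s2_gt0 : 0 < s ^+ 2 by rewrite exprn_gt0.
have t1 : t <= 1 by apply: le_trans ts _; rewrite expr_le1 ?ltW.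
set u := t / s ^+ 2.
have u0 : 0 < u by rewrite divr_gt0.
have u1 : u <= 1 by rewrite ler_pdivrMr// mul1r.
have freeE F : \sum_(v <- free_faces None) F v = \sum_(v : face) F v :> R.
  by rewrite big_enum; apply: eq_bigl.
have := HC None t t0 t1.
rewrite freeE -/u big_split/= sum_face_const -mulr_sumr.
have -> : \sum_(v : face) self_exchange s (Some v) u = total u by [].
have := HK u u0 u1.
have sqrtu : Num.sqrt u = Num.sqrt t / s.
  by rewrite sqrtrM ?ltW// sqrtrV ?sqrtr_sqr ?gtr0_norm// exprn_ge0 ?ltW.
have -> : t32 u = t32 t / s ^+ 3.
  by rewrite /t32 sqrtu /u; field.
have -> : face_loss u = face_loss t / s by rewrite /face_loss sqrtu mulrAC.
have -> : p (ln u) = p (ln t).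
  by rewrite /u lnM ?posrE ?invr_gt0// pp.
have -> : u `^ dimension = t `^ dimension / (5 * s ^+ 3).
  rewrite powRM ?invr_ge0 ?ltW//; congr (_ * _).
  rewrite /powR gt_eqF ?invr_gt0// lnV ?posrE// lnXn//.
  have ls0 : ln s < 0 by rewrite ln_lt0// s_gt0.
  have -> : dimension * - (ln s *+ 2) = - (ln 5 + 3 * ln s).
    by rewrite /dimension -mulr_natl; field; rewrite lt_eqF.
  by rewrite expRN expRD expRM_natl !lnK ?posrE.
have s3_neq0 : 1 - 5 * s ^+ 3 != 0 by rewrite subr_eq0 eq_sym lt_eqF// five_cubes_lt.
have s2_neq0 : 1 - 5 * s ^+ 2 != 0 by rewrite subr_eq0 eq_sym lt_eqF// five_squares_lt.
have s1_neq0 := five_sides_neq.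
have P0 : pi != 0 :> R by rewrite gt_eqF// pi_gt0.
rewrite /u {u u0 u1 sqrtu}.
move: (pi : R) P0 => P P0.
move: (total _) (self_exchange s None t) (t32 t) (face_loss t)
  (t `^ dimension) (p (ln t)) => T S tt l td pt h1 h2.
rewrite -[_ - _]addr0.
set X := T - _ in h1; set Y := S - _ in h2.
have -> : S - ((1 + s ^+ 3) / (1 - 5 * s ^+ 3) -
     6 * ((1 - s ^+ 2) / (1 - 5 * s ^+ 2)) * l +
     12 / P * ((1 + s) / (1 - 5 * s)) * t + 6 * (pt / 30) * td) + 0 = Y + s ^+ 3 * X.
  by rewrite /X /Y; field; rewrite ?P0 ?s_neq0 ?s1_neq0 ?s2_neq0 ?s3_neq0.
apply: le_trans (ler_normD _ _) _; rewrite mulrDl; apply: lerD => //.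
rewrite normrM (gtr0_norm (exprn_gt0 3 s_gt0)).
apply: le_trans (ler_wpM2l _ h1) _; first by rewrite exprn_ge0// ltW.
by rewrite le_eqVlt; apply/orP; left; apply/eqP; field.
Qed.

End BranchAsymptotics.

(** * The heat content of the polyhedron *)

Section Polyhedron.
Context {R : realType}.
Local Notation X1 := (measurableTypeR R).
Local Notation X3 := (X1 * X1 * X1)%type.
Local Notation mu3 := (@lebesgue3 R).
Variables (e : 'I_3 -> space3 R) (x0 : space3 R) (s : R).
Hypothesis he : orthonormal_frame e.
Hypothesis s_gt0 : 0 < s.
Hypothesis s_small : s ^+ 2 + 2 * s < 1.

Let place (x : X3) : X3 := coords e (x - x0).

Lemma measurable_place : measurable_fun setT place.
Proof.
apply: (measurableT_comp (measurable_coords e)).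
by apply: measurable_funB3; [exact: measurable_id|exact: measurable_cst].
Qed.

Lemma volume_place (A : set X3) : measurable A -> mu3 (place @^-1` A) = mu3 A.
Proof.
move=> mA; have mA' := measurable_preim (measurable_coords e) mA.
rewrite -[RHS](volume_coords he mA).
exact: (volume_translation (- x0) mA').
Qed.

(** The interior of the closure lies between the union of the cubes and its closure,
    which differ by a null set. *)
Lemma heat_content_polyhedron t : 0 < t ->
  heat_content (fractal_polyhedron e x0 s) t =
  exchange (branch s None) (branch s None) t.
Proof.
move=> t0; pose f (x : space3 R) : space3 R := coords e (x - x0).
have cf : continuous f by exact: continuous_coords.
pose U : set (space3 R) := f @^-1` branch s None; pose D := interior (closure U).
have -> : fractal_polyhedron e x0 s = D.
  by rewrite /fractal_polyhedron (cubes_branch x0 he s_gt0).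
have oU : open U.
  by apply: open_comp (@open_branch _ s None) => x _; exact: cf.
have UD : U `<=` D.
  by rewrite -open_subsetE//; exact: subset_closure.
have DU : D `\` U `<=` place @^-1` (residue s None).
  move=> x [Dx nUx]; split => //.
  have cK : closed (f @^-1` closure (branch s None)).
    by apply: closed_comp; [move=> y _; exact: cf|exact: closed_closure].
  have cUx : closure U x by exact: interior_subset Dx.
  suff : (f @^-1` closure (branch s None)) x by [].
  move: cUx; rewrite closureE; apply; split=> // y.
  exact: (@subset_closure _ (branch s None) (f y)).
have mU : measurable (U : set X3) by exact: open_measurable3.
have mD : measurable (D : set X3) by apply: open_measurable3; exact: open_interior.
have mDU : measurable (D `\` U : set X3) by exact: measurableD.
have DU0 : mu3 (D `\` U) = 0.
  have mres : measurable (residue s None : set X3) by exact: measurable_residue.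
  apply: (@subset_measure0 _ X3 _ mu3 _ (place @^-1` residue s None) mDU _ DU).
    exact: (measurable_preim measurable_place mres).
  exact: (etrans (volume_place mres) (residue_negligible s_gt0 s_small None)).
have -> : D = U `|` (D `\` U) by rewrite setDUK.
transitivity (exchange U U t); first exact: (exchange_negligible (ltW t0) mU mDU DU0).
have mb := measurable_branch s None.
rewrite -[RHS]mul1e.
apply: (exchange_change (sigma := place) ltr01 measurable_place _ _ mb mb).
- by move=> C mC; rewrite volume_place// mul1e.
- move=> x y; rewrite invr1 mul1r /heat_kernel /place -coordsB dot_coords//.
  by rewrite opprB addrA subrK.
Qed.

End Polyhedron.

Theorem theorem2 (R : realType) (e : 'I_3 -> space3 R) (x0 : space3 R) (s : R)
    (he : orthonormal_frame e) (hs : 0 < s < Num.sqrt 2 - 1) (hs5 : s != 1 / 5) :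
  let d : R := 3 / 2 + 1 / 2 * (ln 5 / ln s) in
  let D := fractal_polyhedron e x0 s in
  exists p : R -> R,
    [/\ continuous p,
        periodic p (ln (s ^- 2)) &
        exists2 err : R -> R,
          err =O_ (0^'+) (fun t : R => t `^ (3 / 2) * ln (t^-1) `^ (3 / 2)) &
          \forall t \near 0^'+,
            heat_content D t =
              ((1 + s ^+ 3) / (1 - 5 * s ^+ 3)
               - 6 * ((1 - s ^+ 2) / (1 - 5 * s ^+ 2)) * (t `^ (1 / 2) / Num.sqrt pi)
               + 12 / pi * ((1 + s) / (1 - 5 * s)) * t
               + 6 * p (ln t) * t `^ d
               + err t)%:E].
Proof.
move=> d D; case/andP: hs => s_gt0 s_lt.
have s_small : s ^+ 2 + 2 * s < 1.
  have h : 0 <= s + 1 < Num.sqrt 2 by apply/andP; split; lra.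
  case/andP: h => h1 h2.
  have : (s + 1) ^+ 2 < Num.sqrt 2 ^+ 2 by rewrite ltr_pXn2r ?nnegrE ?sqrtr_ge0.
  by rewrite sqr_sqrtr//; lra.
have s5 : s != 5^-1 by rewrite -div1r.
have [p [cp pp [C [C0 HC]]]] := initial_asymptotics s_gt0 s_small s5.
exists p; split=> //.
pose main t := (1 + s ^+ 3) / (1 - 5 * s ^+ 3)
  - 6 * ((1 - s ^+ 2) / (1 - 5 * s ^+ 2)) * (t `^ (1 / 2) / Num.sqrt pi)
  + 12 / pi * ((1 + s) / (1 - 5 * s)) * t + 6 * p (ln t) * t `^ d.
exists (fun t => self_exchange s None t - main t); last first.
  near=> t.
  have t0 : 0 < t by [].
  rewrite heat_content_polyhedron//.
  have hb := finite_volume_branch s_gt0 s_small None.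
  rewrite (rexchangeK t0 hb hb); congr EFin.
  by rewrite /main addrC subrK.
rewrite eqOP; exists C; split; first exact: ger0_real.
move=> M /ltW CM; near=> t.
have t0 : 0 < t by [].
have ts : t <= s ^+ 2.
  by near: t; apply: nbhs_right_le; rewrite exprn_gt0.
(* For t < exp (- 1) the logarithm is at least 1: the error is even O(t^(3/2)). *)
have log1 : 1 <= ln t^-1.
  have te : t <= expR (-1) by near: t; apply: nbhs_right_le; exact: expR_gt0.
  by rewrite lnV ?posrE// lerNr -(expRK (-1)) ler_ln ?posrE ?expR_gt0.
have -> : self_exchange s None t - main t = self_exchange s None t -
   ((1 + s ^+ 3) / (1 - 5 * s ^+ 3) - 6 * ((1 - s ^+ 2) / (1 - 5 * s ^+ 2)) * face_loss t
    + 12 / pi * ((1 + s) / (1 - 5 * s)) * t + 6 * p (ln t) * t `^ dimension s).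
  by rewrite /main div1r powR12_sqrt// ltW.
apply: le_trans (HC t t0 ts) _.
apply: ler_pM => //; first by rewrite mulr_ge0 ?sqrtr_ge0// ltW.
have -> : t32 t = t `^ (3 / 2).
  have -> : 3 / 2 = 1 + 2^-1 :> R by field.
  by rewrite powRD ?(gt_eqF t0) ?implybT// powRr1 ?powR12_sqrt// ltW.
rewrite ger0_norm ?mulr_ge0 ?powR_ge0// ler_peMr ?powR_ge0//.
have {1}<- : 1 `^ (3 / 2) = 1 :> R by rewrite powR1.
by rewrite ge0_ler_powR ?nnegrE// (le_trans ler01).
Unshelve. all: by end_near.
Qed.
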